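(* Let $p=1$, let $K$ satisfy (H1), (H2), (H3), let $g\in L^1(\Omega)$ and $f\in L^1([0,T];L^1(\Omega))$. For any $T>0$ there exists a unique solution on $[0,T]$ of problem (P) for $p=1$ with kernel $K$ and data $(f,g)$, in the sense defined below.
   Context: $d\ge1$, $\Omega=[0,1]^d$, $T>0$. A kernel $K:\Omega\times\Omega\to\mathbb R$ may satisfy: (H1) $K$ is nonnegative and measurable; (H2) $K(x,y)=K(y,x)$; (H3) $\sup_{x\in\Omega}\int_\Omega K(x,y)\,dy<+\infty$. Let $\partial|\cdot|(s)=\{1\}$ if $s>0$, $[-1,1]$ if $s=0$, $\{-1\}$ if $s<0$. The $1$-Laplacian $\Delta_1^K$ is the set-valued operator on $L^1(\Omega)$ with $\eta\in\Delta_1^Ku$ iff $\eta(x)=-\int_\Omega K(x,y)w(x,y)\,dy$ a.e. for some $w$ with $\|w\|_{L^\infty(\Omega^2)}\le1$, $w(x,y)=-w(y,x)$ and $w(x,y)\in\partial|\cdot|(u(y)-u(x))$. A solution of (P) for $p=1$ with kernel $K$ and data $(f,g)$ on $[0,T]$ is $u\in C([0,T];L^1(\Omega))\cap W^{1,1}(]0,T[;L^1(\Omega))$ with $u(\cdot,0)=g$ a.e. and $\partial_tu(x,t)=-\eta(x,t)+f(x,t)$ a.e. in $\Omega\times]0,T[$, where $\eta(\cdot,t)\in\Delta_1^Ku(\cdot,t)$. *)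

(* Defs.v *)
From HB Require Import structures.
From mathcomp Require Import all_boot all_order all_algebra.
From mathcomp Require Import all_classical all_reals all_analysis.
Unset Printing Implicit Defensive.
Import Order.TTheory GRing.Theory Num.Theory.
Import numFieldNormedType.Exports.
Local Open Scope classical_set_scope.
Local Open Scope ring_scope.

Section Defs.
Context {R : realType}.

(* d-dimensional Lebesgue measure on n.-tuple R (product sigma-algebra),
   defined as the iterated (Tonelli) product of the 1-dimensional Lebesgue
   measure: lebn 0 = Dirac mass at the empty tuple,
   lebn (n+1) A = \int dx lebn n {t | x :: t \in A}. *)
Fixpoint lebn (n : nat) : set (n.-tuple R) -> \bar R :=
  match n return set (n.-tuple R) -> \bar R with
  | 0 => fun A => (\1_A [tuple] : R)%:E
  | n'.+1 => fun A =>
      (\int[@lebesgue_measure R]_x lebn n' [set t | A (cons_tuple x t)])%E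
  end.

Definition Omega (d : nat) : set (d.-tuple R) :=
  [set x | forall i : 'I_d, 0 <= tnth x i <= 1].

Definition I0T (T : R) : set R := `]0, T[.

Definition QT (d : nat) (T : R) : set (d.-tuple R * R) :=
  Omega d `*` I0T T.

Definition mOO (d : nat) := (lebn d \x lebn d)%E.
Definition mOT (d : nat) := (lebn d \x @lebesgue_measure R)%E.

Definition subdiff_abs (s : R) : set R :=
  if 0 < s then [set 1] else if s < 0 then [set -1] else [set r | -1 <= r <= 1].

Definition H1 (d : nat) (K : d.-tuple R -> d.-tuple R -> R) : Prop :=
  (forall x y, Omega d x -> Omega d y -> 0 <= K x y) /\
  measurable_fun (Omega d `*` Omega d) (fun p => K p.1 p.2).

Definition H2 (d : nat) (K : d.-tuple R -> d.-tuple R -> R) : Prop :=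
  forall x y, Omega d x -> Omega d y -> K x y = K y x.

Definition H3 (d : nat) (K : d.-tuple R -> d.-tuple R -> R) : Prop :=
  exists M : R, forall x, Omega d x ->
    (\int[lebn d]_(y in Omega d) (K x y)%:E <= M%:E)%E.

Definition Delta1 (d : nat) (K : d.-tuple R -> d.-tuple R -> R)
    (u eta : d.-tuple R -> R) : Prop :=
  (lebn d).-integrable (Omega d) (EFin \o u) /\
  (lebn d).-integrable (Omega d) (EFin \o eta) /\
  exists w : d.-tuple R -> d.-tuple R -> R,
    [/\ measurable_fun (Omega d `*` Omega d) (fun p => w p.1 p.2),
        {ae mOO d, forall p, (Omega d `*` Omega d) p -> `|w p.1 p.2| <= 1},
        {ae mOO d, forall p, (Omega d `*` Omega d) p -> w p.1 p.2 = - w p.2 p.1},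
        {ae mOO d, forall p, (Omega d `*` Omega d) p ->
            subdiff_abs (u p.2 - u p.1) (w p.1 p.2)} &
        {ae lebn d, forall x, Omega d x ->
            eta x = - fine (\int[lebn d]_(y in Omega d) (K x y * w x y)%:E)}].

Definition test_fun (T : R) (phi : R -> R) : Prop :=
  (forall (n : nat) (t : R), derivable (derive1n n phi) t 1) /\
  exists a b : R, [/\ 0 < a, a <= b, b < T &
                      forall t, t < a \/ b < t -> phi t = 0].

(* u in W^{1,1}(]0,T[; L^1(Omega)) with weak time derivative v, where
   L^1(]0,T[; L^1(Omega)) is identified with L^1(Omega x ]0,T[) *)
Definition weak_time_deriv (d : nat) (T : R) (u v : d.-tuple R -> R -> R) :=
  (mOT d).-integrable (QT d T) (fun p => (u p.1 p.2)%:E) /\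
  (mOT d).-integrable (QT d T) (fun p => (v p.1 p.2)%:E) /\
  forall phi, test_fun T phi ->
    {ae lebn d, forall x, Omega d x ->
      (\int[@lebesgue_measure R]_(t in I0T T) (u x t * derive1 phi t)%:E
       = - \int[@lebesgue_measure R]_(t in I0T T) (v x t * phi t)%:E)%E}.

Definition C_L1 (d : nat) (T : R) (u : d.-tuple R -> R -> R) : Prop :=
  (forall t, 0 <= t <= T -> (lebn d).-integrable (Omega d) (fun x => (u x t)%:E)) /\
  (forall t0, 0 <= t0 <= T ->
     (fun t => \int[lebn d]_(x in Omega d) (`|u x t - u x t0|)%:E)%E
       @ within [set t | 0 <= t <= T] (nbhs t0) --> (0 : \bar R)).

Definition solution (d : nat) (K : d.-tuple R -> d.-tuple R -> R)
    (f : d.-tuple R -> R -> R) (g : d.-tuple R -> R) (T : R)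
    (u : d.-tuple R -> R -> R) : Prop :=
  C_L1 d T u /\
  exists v eta : d.-tuple R -> R -> R,
    [/\ weak_time_deriv d T u v,
        {ae lebn d, forall x, Omega d x -> u x 0 = g x},
        {ae mOT d, forall p, QT d T p -> v p.1 p.2 = - eta p.1 p.2 + f p.1 p.2} &
        {ae @lebesgue_measure R, forall t, 0 < t < T ->
            Delta1 d K (fun x => u x t) (fun x => eta x t)}].

End Defs.

(* Main.v *)
(** Existence. Replace [u(s)] by the delayed [u(s - h)] inside the sign; the
    resulting field [w_h(x,y,s)] is then computed step by step in time. The
    sign is monotone and [K] is symmetric, so the time derivative of the squared
    L^2 distance of two delayed solutions is controlled by the delays: the
    integrated drifts of [u_h] form a Cauchy family, fast enough along
    [h = T / 4^k] to converge almost everywhere. Midpoint combinations of tails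
    of the [w_h] which nearly minimise the L^2 norm form a Cauchy sequence by
    the parallelogram identity, and its limit [w] is antisymmetric and belongs
    to the subdifferential, the constraint being convex and stable where the
    limit of [u_h(y) - u_h(x)] does not vanish.

    Uniqueness. If [D] is the difference of two solutions and [v] its weak
    derivative, then [D - \int_0^t v] has zero weak derivative, hence is
    constant by testing against a smooth plateau function, hence vanishes by
    continuity at [0]. Thus [D(t) = \int_0^t v] with [v] bounded, and the
    monotonicity of the subdifferential gives [\int D(t)^2 <= 0]. *)
Require Import Defs.
From HB Require Import structures.
From mathcomp Require Import all_boot all_order all_algebra.
From mathcomp Require Import ring lra.
From mathcomp Require Import all_classical all_reals all_analysis measurable_realfun.
Import Order.TTheory GRing.Theory Num.Theory.
Import numFieldNormedType.Exports.
Local Open Scope classical_set_scope.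
Local Open Scope ring_scope.
Set Implicit Arguments.
Unset Strict Implicit.

(** * Products and almost everywhere properties *)

(** The data are only integrable, so a solution need not be square integrable; every L^2 estimate
    concerns a difference of two solutions. There [g] and [f] cancel, and what remains is a time
    integral of [K]-averages of a field bounded by 2, hence bounded thanks to (H3). The delay spoils
    monotonicity by at most the distance a solution moves within one delay. This distance is not of
    order [h] pointwise, since [f] is only integrable, but its integral over space and time is.
    Hence an L^2 distance of order sqrt(h), which [h = T / 4^k] turns into a geometric rate of ratio
    1/2. The sign is discontinuous: convergence of the solutions leaves the limit of the signs open
    where the limit solution takes equal values at [x] and [y]. The averages supply a limit field
    there, and since the drift is linear in the field, averaging the fields averages the solutions.
    For uniqueness, continuity in time holds in L^1(Omega) and not at fixed [x], so the weak
    derivative is exploited after integration over [x]. The analysis takes place on whole spaces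
    with finite measures; the cube and the time interval enter through restricted measures and
    extension by zero. *)

Section almost_everywhere.
Context (d : measure_display) (T : measurableType d) (R : realType).
Variable m : {measure set T -> \bar R}.

Lemma ae_imply (P Q : T -> Prop) : (forall x, P x -> Q x) ->
  {ae m, forall x, P x} -> {ae m, forall x, Q x}.
Proof. by move=> PQ; apply: filterS. Qed.

Lemma ae_imply2 (P Q S : T -> Prop) : (forall x, P x -> Q x -> S x) ->
  {ae m, forall x, P x} -> {ae m, forall x, Q x} -> {ae m, forall x, S x}.
Proof. by move=> PQS; apply: filterS2. Qed.

End almost_everywhere.

Section almost_everywhere_product.
Context (d1 d2 : measure_display) (T1 : measurableType d1)
  (T2 : measurableType d2) (R : realType).
Variables (m1 : {sigma_finite_measure set T1 -> \bar R})
  (m2 : {sigma_finite_measure set T2 -> \bar R}).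

(** The product measure is by definition the integral of the measures of the sections, and a
    nonnegative function has zero integral exactly when it vanishes almost everywhere. *)
Lemma prod_null_xsection (A : set (T1 * T2)%type) : measurable A ->
  (m1 \x m2)%E A = 0%E <->
  {ae m1, forall x, m2 (xsection A x) = 0%E}.
Proof.
move=> mA.
have mf := measurable_fun_xsection m2 mA.
have -> : (m1 \x m2)%E A = (\int[m1]_x `|(m2 \o xsection A) x|)%E.
  by apply: eq_integral => x _; rewrite gee0_abs//=; exact: measure_ge0.
rewrite (ae_eq_integral_abs m1 measurableT mf).
by split; apply: filterS => x /=; [apply|move=> + _].
Qed.

Lemma prod_null_ysection (A : set (T1 * T2)%type) : measurable A ->
  (m1 \x m2)%E A = 0%E <->
  {ae m2, forall y, m1 (ysection A y) = 0%E}.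
Proof.
move=> mA.
have mf := measurable_fun_ysection m1 mA.
have -> : (m1 \x m2)%E A = (\int[m2]_y `|(m1 \o ysection A) y|)%E.
  transitivity (\int[(m1 \x m2)%E]_z (\1_A z)%:E)%E.
    by rewrite integral_indic// setIT.
  rewrite fubini_tonelli2//; last first.
    by apply/measurable_EFinP; exact: measurable_indic.
  apply: eq_integral => y _; rewrite gee0_abs//=.
  exact: (congr1 (fun h => h y) (indic_fubini_tonelli_GE m1 mA)).
rewrite (ae_eq_integral_abs m2 measurableT mf).
by split; apply: filterS => x /=; [apply|move=> + _].
Qed.

Lemma ae_prod_xsection (P : T1 -> T2 -> Prop) :
  {ae (m1 \x m2)%E, forall z, P z.1 z.2} ->
  {ae m1, forall x, {ae m2, forall y, P x y}}.
Proof.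
move=> [N [mN N0 PN]]; move/(prod_null_xsection mN) : N0.
apply: filterS => x Nx; exists (xsection N x); split => //.
  exact: measurable_xsection.
by move=> y /= nP; rewrite /xsection/= inE; apply: PN.
Qed.

Lemma ae_prod_ysection (P : T1 -> T2 -> Prop) :
  {ae (m1 \x m2)%E, forall z, P z.1 z.2} ->
  {ae m2, forall y, {ae m1, forall x, P x y}}.
Proof.
move=> [N [mN N0 PN]]; move/(prod_null_ysection mN) : N0.
apply: filterS => y Ny; exists (ysection N y); split => //.
  exact: measurable_ysection.
by move=> x /= nP; rewrite /ysection/= inE; apply: PN.
Qed.

(** Converse direction to [ae_prod_ysection]: the measurability of [A] lets Tonelli assemble the
    null slices into a null set. *)
Lemma ysection_ae_prod (A : set (T1 * T2)%type) : measurable A ->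
  {ae m2, forall y, {ae m1, forall x, A (x, y)}} ->
  {ae (m1 \x m2)%E, forall z, A z}.
Proof.
move=> mA aeA; exists (~` A); split => //; first exact: measurableC.
apply/prod_null_ysection; first exact: measurableC.
apply: filterS aeA => y [N [mN N0 AN]].
apply: (subset_measure0 _ mN _ N0).
  by apply: measurable_ysection; exact: measurableC.
by move=> x; rewrite /ysection/= inE => nA; apply: AN.
Qed.

Lemma ae_fst (P : T1 -> Prop) : {ae m1, forall x, P x} ->
  {ae (m1 \x m2)%E, forall z, P z.1}.
Proof.
move=> [N [mN N0 PN]]; exists (N `*` setT); split.
- exact: measurableX.
- by rewrite product_measure1E//= N0 mul0e.
- by move=> [x y] /= nP; split => //; apply: PN.
Qed.

Lemma ae_snd (P : T2 -> Prop) : {ae m2, forall x, P x} ->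
  {ae (m1 \x m2)%E, forall z, P z.2}.
Proof.
move=> [N [mN N0 PN]]; exists (setT `*` N); split.
- exact: measurableX.
- by rewrite product_measure1E//= N0 mule0.
- by move=> [x y] /= nP; split => //; apply: PN.
Qed.

End almost_everywhere_product.

Section Rintegral_product.
Context (d1 d2 : measure_display) (T1 : measurableType d1)
  (T2 : measurableType d2) (R : realType).

(** Tonelli makes the integrals of the positive and negative parts measurable in [x], and [fine] is
    measurable on all extended reals, so sections with infinite integral do no harm. *)
Lemma measurable_Rintegral_snd (m2 : {sigma_finite_measure set T2 -> \bar R})
    (f : T1 -> T2 -> R) :
  measurable_fun setT (fun z : T1 * T2 => f z.1 z.2) ->
  measurable_fun setT (fun x => \int[m2]_y f x y).
Proof.
move=> mf; apply: (measurableT_comp (fine_measurable measurableT)).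
have mfE : measurable_fun setT (fun z : T1 * T2 => (f z.1 z.2)%:E).
  exact/measurable_EFinP.
pose F : T1 * T2 -> \bar R := fun z => (f z.1 z.2)%:E.
rewrite (_ : (fun x => _) = fun x => (fubini_F m2 F^\+ x - fubini_F m2 F^\- x)%E).
  apply: emeasurable_funB; apply: measurable_fun_fubini_tonelli_F => //.
  - exact: measurable_funepos.
  - exact: measurable_funeneg.
apply/funext => x; rewrite [LHS]integralE.
by congr (_ - _)%E; apply: eq_integral => y _;
  rewrite ?funeposE ?funenegE.
Qed.

Lemma measurable_Rintegral_fst (m1 : {sigma_finite_measure set T1 -> \bar R})
    (f : T1 -> T2 -> R) :
  measurable_fun setT (fun z : T1 * T2 => f z.1 z.2) ->
  measurable_fun setT (fun y => \int[m1]_x f x y).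
Proof.
move=> mf; apply: (measurableT_comp (fine_measurable measurableT)).
have mfE : measurable_fun setT (fun z : T1 * T2 => (f z.1 z.2)%:E).
  exact/measurable_EFinP.
pose F : T1 * T2 -> \bar R := fun z => (f z.1 z.2)%:E.
rewrite (_ : (fun x => _) = fun y => (fubini_G m1 F^\+ y - fubini_G m1 F^\- y)%E).
  apply: emeasurable_funB; apply: measurable_fun_fubini_tonelli_G => //.
  - exact: measurable_funepos.
  - exact: measurable_funeneg.
apply/funext => x; rewrite [LHS]integralE.
by congr (_ - _)%E; apply: eq_integral => y _;
  rewrite ?funeposE ?funenegE.
Qed.

Variables (m1 : {sigma_finite_measure set T1 -> \bar R})
  (m2 : {sigma_finite_measure set T2 -> \bar R}) (f : T1 -> T2 -> R).
Hypothesis intf : (m1 \x m2)%E.-integrable setT (fun z => (f z.1 z.2)%:E).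

Let mf : measurable_fun setT (fun z : T1 * T2 => f z.1 z.2).
Proof. by apply/measurable_EFinP; exact: measurable_int intf. Qed.

Lemma ae_integrable_xsection :
  {ae m1, forall x, m2.-integrable setT (EFin \o f x)}.
Proof. exact: (ae_integrable1 intf). Qed.

Lemma ae_integrable_ysection :
  {ae m2, forall y, m1.-integrable setT (fun x => (f x y)%:E)}.
Proof. exact: (ae_integrable2 intf). Qed.

Lemma Rintegral12 : \int[m1]_x (\int[m2]_y f x y) =
  \int[(m1 \x m2)%E]_z f z.1 z.2.
Proof.
congr fine; rewrite -(integral12_prod_meas1 intf).
apply: ae_eq_integral => //.
- apply/measurable_EFinP; exact: measurable_Rintegral_snd.
- exact: measurable_fubini_F intf.
apply: filterS ae_integrable_xsection => x ix _ /=.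
by rewrite /Rintegral fineK//; exact: integrable_fin_num ix.
Qed.

Lemma Rintegral21 : \int[m2]_y (\int[m1]_x f x y) =
  \int[(m1 \x m2)%E]_z f z.1 z.2.
Proof.
congr fine; rewrite -(integral21_prod_meas1 intf).
apply: ae_eq_integral => //.
- apply/measurable_EFinP; exact: measurable_Rintegral_fst.
- exact: measurable_fubini_G intf.
apply: filterS ae_integrable_ysection => x ix _ /=.
by rewrite /Rintegral fineK//; exact: integrable_fin_num ix.
Qed.

Lemma integrable_Rintegral_snd :
  m1.-integrable setT (fun x => (\int[m2]_y f x y)%:E).
Proof.
apply/integrableP; split.
  by apply/measurable_EFinP; exact: measurable_Rintegral_snd.
have := (integrable12ltyP m1 m2 (measurable_int _ intf)).1 intf.
apply: le_lt_trans; apply: ae_ge0_le_integral => //.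
- apply: measurableT_comp => //; apply/measurable_EFinP.
  exact: measurable_Rintegral_snd.
- by move=> x _; exact: integral_ge0.
- apply: (measurable_fun_fubini_tonelli_F (fun z => `|f z.1 z.2|%:E)) => //.
  by apply/measurable_EFinP; exact: measurableT_comp.
apply: filterS ae_integrable_xsection => x ix _ /=.
rewrite EFin_normr_Rintegral//; apply: le_abse_integral => //.
exact: measurable_int ix.
Qed.

Lemma integrable_Rintegral_fst :
  m2.-integrable setT (fun y => (\int[m1]_x f x y)%:E).
Proof.
apply/integrableP; split.
  by apply/measurable_EFinP; exact: measurable_Rintegral_fst.
have := (integrable21ltyP m1 m2 (measurable_int _ intf)).1 intf.
apply: le_lt_trans; apply: ae_ge0_le_integral => //.
- apply: measurableT_comp => //; apply/measurable_EFinP.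
  exact: measurable_Rintegral_fst.
- by move=> x _; exact: integral_ge0.
- apply: (measurable_fun_fubini_tonelli_G (fun z => `|f z.1 z.2|%:E)) => //.
  by apply/measurable_EFinP; exact: measurableT_comp.
apply: filterS ae_integrable_ysection => x ix _ /=.
rewrite EFin_normr_Rintegral//; apply: le_abse_integral => //.
exact: measurable_int ix.
Qed.

Lemma integrable_prod_swap :
  (m2 \x m1)%E.-integrable setT (fun z => (f z.2 z.1)%:E).
Proof.
apply/integrable12ltyP; last first.
  exact: (integrable21ltyP m1 m2 (measurable_int _ intf)).1 intf.
by apply/measurable_EFinP; exact: (measurableT_comp mf (@measurable_swap _ _ _ _)).
Qed.

End Rintegral_product.

Lemma finite_measure_lty (d : measure_display) (T : measurableType d)
    (R : realType) (m : {finite_measure set T -> \bar R}) :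
  (m setT < +oo)%E.
Proof. by rewrite ltey_eq fin_num_measure. Qed.

Lemma product_measure_lty (d1 d2 : measure_display) (T1 : measurableType d1)
    (T2 : measurableType d2) (R : realType)
    (m1 : {sigma_finite_measure set T1 -> \bar R})
    (m2 : {sigma_finite_measure set T2 -> \bar R}) :
  (m1 setT < +oo)%E -> (m2 setT < +oo)%E -> ((m1 \x m2) setT < +oo)%E.
Proof.
move=> m1oo m2oo; rewrite -setXTT product_measure1E//.
by apply: lte_mul_pinfty => //; rewrite ge0_fin_numE.
Qed.

(* A head symbol for the product of finite measures: on [m1 \x m2] itself the
   finiteness structure is only inferred for subprobabilities. *)
Definition finite_product (d1 d2 : measure_display) (T1 : measurableType d1)
    (T2 : measurableType d2) (R : realType)
    (m1 : {finite_measure set T1 -> \bar R})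
    (m2 : {finite_measure set T2 -> \bar R}) : set (T1 * T2)%type -> \bar R :=
  (m1 \x m2)%E.

Section finite_product.
Context (d1 d2 : measure_display) (T1 : measurableType d1)
  (T2 : measurableType d2) (R : realType).
Variables (m1 : {finite_measure set T1 -> \bar R})
  (m2 : {finite_measure set T2 -> \bar R}).

HB.instance Definition _ := Measure.on (finite_product m1 m2).

Let finite_product_fin : fin_num_fun (finite_product m1 m2).
Proof.
by apply: lty_fin_num_fun; apply: product_measure_lty; exact: finite_measure_lty.
Qed.

HB.instance Definition _ :=
  Measure_isFinite.Build _ _ _ (finite_product m1 m2) finite_product_fin.

End finite_product.

(** * Integral inequalities and almost everywhere convergence *)

Section finite_measure.
Context (d : measure_display) (T : measurableType d) (R : realType).
Variable m : {measure set T -> \bar R}.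

Lemma bounded_integrable (f : T -> R) (c : R) : (m setT < +oo)%E ->
  measurable_fun setT f -> (forall x, `|f x| <= c) ->
  m.-integrable setT (EFin \o f).
Proof.
move=> moo mf fc; apply: measurable_bounded_integrable => //.
by exists c; split; [exact: num_real|] => r cr x _; apply: (le_trans (fc x)); exact: ltW.
Qed.

Lemma ae_eq_Rintegral (f g : T -> R) : measurable_fun setT f ->
  measurable_fun setT g -> {ae m, forall x, f x = g x} ->
  \int[m]_x f x = \int[m]_x g x.
Proof.
move=> mf mg fg; congr fine; apply: ae_eq_integral => //.
- exact/measurable_EFinP.
- exact/measurable_EFinP.
- by apply: filterS fg => x -> _.
Qed.

Lemma Rintegral_norm_eq0 (f : T -> R) : m.-integrable setT (EFin \o f) ->
  \int[m]_x `|f x| <= 0 -> {ae m, forall x, f x = 0}.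
Proof.
move=> intf f0; have mf := measurable_int _ intf.
have : (\int[m]_x `|(EFin \o f) x| = 0)%E.
  have intn := integrable_norm intf.
  rewrite -[LHS]fineK//; last exact: integrable_fin_num intn.
  congr EFin; apply/eqP; rewrite eq_le f0/=.
  by apply: fine_ge0; exact: integral_ge0.
by move/(ae_eq_integral_abs m measurableT mf); apply: filterS => x /(_ I) [].
Qed.

Lemma ae_le_Rintegral (f g : T -> R) : m.-integrable setT (EFin \o f) ->
  m.-integrable setT (EFin \o g) -> {ae m, forall x, f x <= g x} ->
  \int[m]_x f x <= \int[m]_x g x.
Proof.
move=> intf intg fg.
have mf : measurable_fun setT f by apply/measurable_EFinP; exact: measurable_int intf.
have mg : measurable_fun setT g by apply/measurable_EFinP; exact: measurable_int intg.
rewrite -subr_ge0 -RintegralB//.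
rewrite (@ae_eq_Rintegral _ (fun x => `|g x - f x|)).
- by apply: Rintegral_ge0.
- exact: measurable_funB.
- by apply: measurableT_comp => //; exact: measurable_funB.
- by apply: filterS fg => x fg; rewrite ger0_norm// subr_ge0.
Qed.

Lemma Rintegral_le_cst (f : T -> R) (c : R) : (m setT < +oo)%E ->
  m.-integrable setT (EFin \o f) -> {ae m, forall x, f x <= c} ->
  \int[m]_x f x <= c * fine (m setT).
Proof.
move=> moo intf fc; rewrite -Rintegral_cst//; apply: ae_le_Rintegral => //.
exact: (@bounded_integrable _ `|c|).
Qed.

Lemma L1dist_triangle (a b c : T -> R) : m.-integrable setT (EFin \o a) ->
  m.-integrable setT (EFin \o b) -> m.-integrable setT (EFin \o c) ->
  \int[m]_x `|b x - c x| <= \int[m]_x `|a x - b x| + \int[m]_x `|a x - c x|.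
Proof.
move=> ia ib ic.
have iab : m.-integrable setT (EFin \o (fun x => `|a x - b x|)).
  by apply: integrable_norm; exact: (integrableB measurableT ia ib).
have iac : m.-integrable setT (EFin \o (fun x => `|a x - c x|)).
  by apply: integrable_norm; exact: (integrableB measurableT ia ic).
rewrite -RintegralD//; apply: le_Rintegral => //.
- by apply: integrable_norm; exact: (integrableB measurableT ib ic).
- by apply: eq_integrable (integrableD measurableT iab iac) => // x _.
by move=> x _; rewrite (distrC (a x) (b x)) ler_distD.
Qed.

Lemma Rintegral_dominated (f_ : nat -> T -> R) (f g : T -> R) :
  (forall n, measurable_fun setT (f_ n)) -> measurable_fun setT f ->
  m.-integrable setT (EFin \o g) ->
  {ae m, forall x, f_ n x @[n --> \oo] --> f x} ->
  (forall n x, `|f_ n x| <= g x) ->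
  \int[m]_x f_ n x @[n --> \oo] --> \int[m]_x f x.
Proof.
move=> mf_ mf intg cvgf domf.
have [|||||intf _ cvgi] := @dominated_convergence _ _ _ m _ measurableT
    (fun n => EFin \o f_ n) (EFin \o f) (EFin \o g).
- by move=> n; exact/measurable_EFinP.
- exact/measurable_EFinP.
- by apply: filterS cvgf => x fx _; apply/fine_cvgP; split => //; exact: nearW.
- by [].
- by apply: aeW => x n _; rewrite /= lee_fin.
- by apply: fine_cvg; rewrite fineK//; exact: integrable_fin_num intf.
Qed.

(** By monotone convergence the full sum [S] has integral at most [2 * c], so it is finite almost
    everywhere. *)
Lemma ae_cvg_series_norm (h : nat -> T -> R) (c : R) :
  (forall n, measurable_fun setT (h n)) -> 0 <= c ->
  (forall n, (\int[m]_x `|h n x|%:E <= (c * 2^-1 ^+ n)%:E)%E) ->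
  {ae m, forall x, cvgn (series (fun n => `|h n x|))}.
Proof.
move=> mh c0 hc.
pose S (x : T) : \bar R := (\sum_(0 <= n <oo) `|h n x|%:E)%E.
have mh' n : measurable_fun setT (fun x => `|h n x|%:E).
  by apply/measurable_EFinP; exact: measurableT_comp.
have S0 x : (0 <= S x)%E by apply: nneseries_ge0 => n _ _; rewrite lee_fin.
have half_sum n : \sum_(0 <= k < n) (c * 2^-1 ^+ k) = c * (2 - 2 * 2^-1 ^+ n).
  elim: n => [|n IH]; first by rewrite big_nil expr0 mulr1 subrr mulr0.
  by rewrite big_nat_recr//= IH exprS; field.
have iS : (\int[m]_x S x <= (c * 2)%:E)%E.
  rewrite integral_nneseries//.
  apply: lime_le.
    by apply: is_cvg_nneseries => n _ _; apply: integral_ge0 => x _; rewrite lee_fin.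
  apply: nearW => n; apply: (@le_trans _ _ (\sum_(0 <= k < n) (c * 2^-1 ^+ k)%:E)%E).
    by apply: lee_sum => k _; exact: hc.
  rewrite sumEFin lee_fin half_sum ler_wpM2l// lerBlDr lerDl.
  by rewrite mulr_ge0// exprn_ge0.
have intS : m.-integrable setT S.
  apply/integrableP; split.
    by apply: ge0_emeasurable_sum => // n x _; rewrite lee_fin.
  under eq_integral do rewrite gee0_abs//.
  by rewrite (le_lt_trans iS)// ltry.
apply: filterS (integrable_ae measurableT intS) => x /(_ I) Sfin.
apply: nondecreasing_is_cvgn.
  by apply/nondecreasing_seqP => n; rewrite /series/= big_nat_recr//= lerDl.
exists (fine (S x)) => _ [n _ <-].
rewrite -lee_fin fineK// /series/= -sumEFin.
by apply: nneseries_lim_ge => k _; rewrite lee_fin.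
Qed.

Lemma ae_cvg0_fast (h : nat -> T -> R) (c : R) :
  (forall n, measurable_fun setT (h n)) -> 0 <= c ->
  (forall n, (\int[m]_x `|h n x|%:E <= (c * 2^-1 ^+ n)%:E)%E) ->
  {ae m, forall x, h n x @[n --> \oo] --> 0}.
Proof.
move=> mh c0 hc; apply: filterS (@ae_cvg_series_norm h c mh c0 hc) => x.
move=> /cvg_series_cvg_0 cv; apply: norm_cvg0; exact: cv.
Qed.

(** The sequence is its first term plus the telescoping series of its increments, which converges
    absolutely almost everywhere. *)
Lemma ae_cvg_fast (v : nat -> T -> R) (c : R) :
  (forall n, measurable_fun setT (v n)) -> 0 <= c ->
  (forall n, (\int[m]_x `|v n.+1 x - v n x|%:E <= (c * 2^-1 ^+ n)%:E)%E) ->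
  {ae m, forall x, cvgn (fun n => v n x)}.
Proof.
move=> mv c0 hc.
have mdv n : measurable_fun setT (fun x => v n.+1 x - v n x).
  exact: measurable_funB.
apply: filterS (@ae_cvg_series_norm _ c mdv c0 hc) => x /normed_cvg cv.
rewrite (_ : (fun n => v n x) = (fun n => v 0%N x + series (fun n => v n.+1 x - v n x) n)).
  by apply: is_cvgD => //; exact: is_cvg_cst.
by apply/funext => n; rewrite /series/= telescope_sumr// addrC subrK.
Qed.

End finite_measure.

(** * Convex combinations and weak limits *)

Section midpoint_averages.
Context {R : realType}.

(* The functionals on sequences obtained from the evaluations at ranks [>= n]
   by taking midpoints: parallelograms need no other convex combinations. *)
Inductive tail_average (n : nat) : ((nat -> R) -> R) -> Prop :=
| tail_eval k : (n <= k)%N -> tail_average n (fun a => a k)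
| tail_midpoint L1 L2 : tail_average n L1 -> tail_average n L2 ->
    tail_average n (fun a => (L1 a + L2 a) / 2).

Lemma tail_averageW n k L : (k <= n)%N -> tail_average n L -> tail_average k L.
Proof.
move=> kn; elim=> [i ni|L1 L2 _ L1k _ L2k]; last exact: tail_midpoint.
by apply: tail_eval; exact: leq_trans ni.
Qed.

(** Intervals centred at [l] are convex, hence stable under midpoints. *)
Lemma tail_average_dist n L (a : nat -> R) (l e : R) : tail_average n L ->
  (forall k, (n <= k)%N -> `|a k - l| <= e) -> `|L a - l| <= e.
Proof.
move=> + ae; elim=> [k nk|L1 L2 _ h1 _ h2]; first exact: ae.
rewrite (_ : _ - l = (L1 a - l) / 2 + (L2 a - l) / 2); last by field.
rewrite (le_trans (ler_normD _ _))// !normrM.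
by rewrite (@ger0_norm _ 2^-1)//; lra.
Qed.

Lemma tail_average_cvg (L : nat -> (nat -> R) -> R) (a : nat -> R) (l : R) :
  (forall n, tail_average n (L n)) -> a @ \oo --> l ->
  L n a @[n --> \oo] --> l.
Proof.
move=> Ltail al; apply/cvgrPdist_le => e e0.
move/cvgrPdist_le : al => /(_ e e0)[N _ aN].
exists N => // n /= Nn; rewrite distrC.
apply: (tail_average_dist (Ltail n)) => k nk; rewrite distrC.
by apply: aN => /=; exact: leq_trans nk.
Qed.

Lemma tail_averageN n L (a : nat -> R) : tail_average n L ->
  L (fun k => - a k) = - L a.
Proof. by elim=> // L1 L2 _ -> _ ->; field. Qed.

Lemma tail_averageZ n L (a : nat -> R) (c : R) : tail_average n L ->
  L (fun k => c * a k) = c * L a.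
Proof. by elim=> // L1 L2 _ -> _ ->; field. Qed.

End midpoint_averages.

Section measurable_averages.
Context (d : measure_display) (T : measurableType d) (R : realType).
Variable m : {measure set T -> \bar R}.
Implicit Types w : nat -> T -> R.

Lemma measurable_tail_average n L w : tail_average n L ->
  (forall k, measurable_fun setT (w k)) ->
  measurable_fun setT (fun x => L (w ^~ x)).
Proof.
move=> + mw; elim=> [k _|L1 L2 _ m1 _ m2]; first exact: mw.
by apply: measurable_funM => //; exact: measurable_funD.
Qed.

Lemma integrable_tail_average n L w : tail_average n L ->
  (forall k, m.-integrable setT (EFin \o w k)) ->
  m.-integrable setT (EFin \o (fun x => L (w ^~ x))) /\
  \int[m]_x L (w ^~ x) = L (fun k => \int[m]_x w k x).
Proof.
move=> + iw; elim=> [k _|L1 L2 _ [i1 e1] _ [i2 e2]]; first by split.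
have i12 : m.-integrable setT (EFin \o (fun x => L1 (w ^~ x) + L2 (w ^~ x))).
  by apply: eq_integrable (integrableD measurableT i1 i2) => // x _.
split; last by rewrite RintegralZr// RintegralD// e1 e2.
by apply: eq_integrable (integrableZr measurableT 2^-1 i12) => // x _.
Qed.

Lemma le_norm_tail_average n L w (c : R) : tail_average n L ->
  (forall k x, `|w k x| <= c) -> forall x, `|L (w ^~ x)| <= c.
Proof.
move=> Ln wc x; rewrite -[X in `|X|]subr0; apply: (tail_average_dist Ln) => k _.
by rewrite subr0.
Qed.

(** Replaces the Cauchy-Schwarz inequality. With [b = 2^n |a|], dividing [b <= 1 + b^2] by [2^n]
    gives [|a| <= 2^-n + 2^n a^2], a weight for which both terms integrate to a multiple of
    [2^-n]. *)
Lemma le_Rintegral_norm_sqr (a : T -> R) (c C : R) n : (m setT < +oo)%E ->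
  measurable_fun setT a -> (forall x, `|a x| <= c) ->
  \int[m]_x (a x ^+ 2) <= C * 4^-1 ^+ n ->
  \int[m]_x `|a x| <= (fine (m setT) + C) * 2^-1 ^+ n.
Proof.
move=> moo ma ac aC; have c0 : 0 <= c by exact: le_trans (ac point).
have ia : m.-integrable setT (EFin \o (fun x => `|a x|)).
  apply: (@bounded_integrable _ _ _ _ _ c) => //; first exact: measurableT_comp.
  by move=> x; rewrite normr_id.
have ia2 : m.-integrable setT (EFin \o (fun x => a x ^+ 2)).
  apply: (@bounded_integrable _ _ _ _ _ (c ^+ 2)) => //; first exact: measurable_funX.
  by move=> x; rewrite normrX ler_sqr ?nnegrE.
have i2 : m.-integrable setT (EFin \o (fun x => 2 ^+ n * a x ^+ 2)).
  exact: (integrableZl measurableT (2 ^+ n) ia2).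
have i1 : m.-integrable setT (EFin \o (fun x => 2^-1 ^+ n)).
  exact: (@bounded_integrable _ _ _ _ _ `|2^-1 ^+ n|).
have p2 : 0 < (2 ^+ n : R) by rewrite exprn_gt0.
have e : (2 ^+ n : R) * 2^-1 ^+ n = 1 by rewrite -exprMn mulfV// expr1n.
apply: (@le_trans _ _ (\int[m]_x (2^-1 ^+ n + 2 ^+ n * a x ^+ 2))).
  apply: le_Rintegral => //.
    by apply: eq_integrable (integrableD measurableT i1 i2) => // x _.
  move=> x _; rewrite -(@real_normK _ (a x)) ?num_real//.
  rewrite -(ler_pM2l p2) mulrDr e mulrA -expr2 -exprMn.
  have : 0 <= 2 ^+ n * `|a x| by rewrite mulr_ge0// ltW.
  by have := sqr_ge0 (2 ^+ n * `|a x| - 1); move: (2 ^+ n * `|a x|) => b; nra.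
rewrite RintegralD// Rintegral_cst// RintegralZl// mulrDl; apply: lerD.
  by rewrite mulrC.
apply: (le_trans (_ : _ <= 2 ^+ n * (C * 4^-1 ^+ n))); first by rewrite ler_pM2l.
rewrite (_ : (4^-1 : R) = 2^-1 * 2^-1); last by field.
by rewrite exprMn mulrCA [X in C * X]mulrA e mul1r.
Qed.

Lemma tail_average_L1dist n L (a : nat -> T -> R) (b : T -> R) (e : R) :
  tail_average n L -> (forall k, m.-integrable setT (EFin \o a k)) ->
  m.-integrable setT (EFin \o b) ->
  (forall k, (n <= k)%N -> \int[m]_x `|a k x - b x| <= e) ->
  \int[m]_x `|L (a ^~ x) - b x| <= e.
Proof.
move=> Ln ia ib abe.
have iLb L' : tail_average n L' ->
    m.-integrable setT (EFin \o (fun x => `|L' (a ^~ x) - b x|)).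
  move=> L'n; apply: integrable_norm.
  exact: (integrableB measurableT (integrable_tail_average L'n ia).1 ib).
elim: Ln => [k nk|L1 L2 L1n h1 L2n h2]; first exact: abe.
have i1 := iLb _ L1n; have i2 := iLb _ L2n.
have i12 : m.-integrable setT
    (EFin \o (fun x => `|L1 (a ^~ x) - b x| + `|L2 (a ^~ x) - b x|)).
  by apply: eq_integrable (integrableD measurableT i1 i2) => // x _.
apply: (@le_trans _ _ (\int[m]_x
    ((`|L1 (a ^~ x) - b x| + `|L2 (a ^~ x) - b x|) * 2^-1))).
  apply: le_Rintegral => //.
  - exact: (iLb _ (tail_midpoint L1n L2n)).
  - by apply: eq_integrable (integrableZr measurableT 2^-1 i12) => // x _.
  move=> x _; rewrite (_ : _ - b x = ((L1 (a ^~ x) - b x) + (L2 (a ^~ x) - b x)) / 2).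
    by rewrite normrM (@ger0_norm _ 2^-1)// ler_wpM2r// ler_normD.
  by field.
by rewrite RintegralZr// RintegralD//; lra.
Qed.

(* Near minimisers of the L^2 norm over the convex tails form a Cauchy
   sequence, by the parallelogram identity. *)
Lemma mazur_bounded w : (m setT < +oo)%E ->
  (forall k, measurable_fun setT (w k)) -> (forall k x, `|w k x| <= 1) ->
  exists L : nat -> (nat -> R) -> R, (forall n, tail_average n (L n)) /\
    {ae m, forall x, cvgn (fun n => L n (w ^~ x))}.
Proof.
move=> moo mw w1.
pose I (L : (nat -> R) -> R) := \int[m]_x (L (w ^~ x)) ^+ 2.
have mL n L : tail_average n L -> measurable_fun setT (fun x => L (w ^~ x)).
  by move=> Ln; exact: measurable_tail_average Ln mw.
have L1 n L : tail_average n L -> forall x, `|L (w ^~ x)| <= 1.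
  by move=> Ln; exact: le_norm_tail_average Ln w1.
have Lsq n L : tail_average n L ->
    m.-integrable setT (EFin \o (fun x => (L (w ^~ x)) ^+ 2)).
  move=> Ln; apply: (@bounded_integrable _ _ _ _ _ 1) => //.
    by apply: measurable_funX; exact: mL Ln.
  by move=> x; rewrite normrX expr_le1//; exact: L1 Ln _.
have I0 L : 0 <= I L by apply: Rintegral_ge0 => x _; exact: sqr_ge0.
have IC n L : tail_average n L -> I L <= fine (m setT).
  move=> Ln; rewrite -[leRHS]mul1r; apply: Rintegral_le_cst => //.
    exact: Lsq Ln.
  apply: aeW => x; rewrite -real_normK ?num_real// expr_le1//.
  exact: L1 Ln _.
pose E n := [set I L | L in tail_average n].
have E0 n : E n !=set0 by exists (I (fun a => a n)), (fun a => a n) => //; exact: tail_eval.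
have Elb n : has_lbound (E n) by exists 0 => _ [L _ <-].
have Einf n : has_inf (E n) by split.
pose D n := inf (E n).
have DI n L : tail_average n L -> D n <= I L.
  by move=> Ln; apply: ge_inf => //; exists L.
have DC n : D n <= fine (m setT).
  have [_ [L Ln _]] := E0 n; exact: le_trans (DI _ _ Ln) (IC _ _ Ln).
have Dnd n k : (n <= k)%N -> D n <= D k.
  move=> nk; apply: lb_le_inf => // _ [L Lk <-]; apply: DI.
  exact: tail_averageW Lk.
have Dsup : has_sup (range D).
  by split; [exists (D 0%N), 0%N|exists (fine (m setT)) => _ [n _ <-]].
pose D_ := sup (range D).
have DD n : D n <= D_ by apply: ub_le_sup; [case: Dsup|exists n].
(* [D_] is the limit of the nondecreasing infima [D n]. The tail is started late enough for [D N] to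
   be within [4^-n] of [D_], and only then is a near minimiser taken in it. *)
have choose n : exists L, exists N, [/\ (n <= N)%N, tail_average N L,
    I L <= D_ + 4^-1 ^+ n & D_ - 4^-1 ^+ n <= D N].
  have e0 : 0 < (4^-1 ^+ n : R) by rewrite exprn_gt0// invr_gt0.
  have [_ [N0 _ <-] /ltW DN0] := sup_adherent e0 Dsup.
  pose N := maxn n N0.
  have [_ [L LN <-] /ltW IL] := inf_adherent e0 (Einf N).
  exists L, N; split => //; first exact: leq_maxl.
    by rewrite (le_trans IL)// lerD2r; exact: DD.
  by rewrite (le_trans DN0)// Dnd// leq_maxr.
have [L Lp] := boolp.choice choose.
exists L; split.
  by move=> n; have [N [nN LN _ _]] := Lp n; exact: tail_averageW LN.
pose v n x := L n (w ^~ x).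
have mv n : measurable_fun setT (v n).
  by have [N [nN LN _ _]] := Lp n; exact: mL LN.
have v1 n x : `|v n x| <= 1.
  by have [N [nN LN _ _]] := Lp n; exact: L1 LN _.
have dv2 n x : (v n.+1 x - v n x) ^+ 2 <= 4.
  rewrite -real_normK ?num_real//.
  have : `|v n.+1 x - v n x| <= 2.
    by rewrite (le_trans (ler_normB _ _))//; have := v1 n x; have := v1 n.+1 x; lra.
  by move=> h; rewrite (_ : 4 = 2 ^+ 2); [rewrite ler_sqr ?nnegrE|ring].
have mdv n : measurable_fun setT (fun x => v n.+1 x - v n x).
  exact: measurable_funB.
have idv2 n : m.-integrable setT (EFin \o (fun x => (v n.+1 x - v n x) ^+ 2)).
  apply: (@bounded_integrable _ _ _ _ _ 4) => //; first exact: measurable_funX.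
  by move=> x; rewrite ger0_norm ?sqr_ge0.
have idv n : m.-integrable setT (EFin \o (fun x => `|v n.+1 x - v n x|)).
  apply: (@bounded_integrable _ _ _ _ _ 2) => //; first exact: measurableT_comp.
  move=> x; rewrite normr_id (le_trans (ler_normB _ _))//.
  by have := v1 n x; have := v1 n.+1 x; lra.
have key n : \int[m]_x (v n.+1 x - v n x) ^+ 2 <= 8 * 4^-1 ^+ n.
  have [N [nN LN ILn DN]] := Lp n.
  have [N' [nN' LN' ILn' DN']] := Lp n.+1.
  pose N'' := minn N N'.
  (* The midpoint belongs to the longer of the two tails, so its energy is at least [D_ - 4^-n]. The
     parallelogram identity then bounds the squared distance by [2 + 2 + 4 = 8] times [4^-n]. *)
  have mid : tail_average N'' (fun a => (L n.+1 a + L n a) / 2).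
    apply: tail_midpoint; first by apply: tail_averageW LN'; exact: geq_minr.
    by apply: tail_averageW LN; exact: geq_minl.
  have e4 : (4^-1 ^+ n.+1 : R) <= 4^-1 ^+ n.
    rewrite exprS; have : 0 <= (4^-1 ^+ n : R) by rewrite exprn_ge0// invr_ge0.
    by lra.
  have DN'' : D_ - 4^-1 ^+ n <= D N''.
    rewrite /N''; case: (leqP N N') => _ //.
    by apply: le_trans DN'; lra.
  have Imid := DI _ _ mid.
  have -> : \int[m]_x (v n.+1 x - v n x) ^+ 2 =
      2 * I (L n.+1) + 2 * I (L n) - 4 * I (fun a => (L n.+1 a + L n a) / 2).
    have i1 := Lsq _ _ LN'; have i2 := Lsq _ _ LN; have i3 := Lsq _ _ mid.
    have cZ c (f : T -> R) : m.-integrable setT (EFin \o f) ->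
        m.-integrable setT (EFin \o (fun x => c * f x)).
      move=> intf.
      by apply: eq_integrable (integrableZl measurableT c intf) => // x _.
    rewrite /I -!RintegralZl// -RintegralD//; [|exact: cZ|exact: cZ].
    rewrite -RintegralB//; [|exact: (integrableD measurableT (cZ 2 _ i1) (cZ 2 _ i2))
                             |exact: cZ].
    by apply: eq_Rintegral => x _; rewrite /v; field.
  by lra.
apply: (@ae_cvg_fast _ _ _ m v (fine (m setT) + 8)) => //.
move=> n.
have -> : (\int[m]_x `|v n.+1 x - v n x|%:E = (\int[m]_x `|v n.+1 x - v n x|)%:E)%E.
  by rewrite /Rintegral fineK//; exact: integrable_fin_num (idv n).
rewrite lee_fin; apply: (@le_Rintegral_norm_sqr _ 2) => // x.
rewrite (le_trans (ler_normB _ _))//.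
by have := v1 n x; have := v1 n.+1 x; lra.
Qed.

End measurable_averages.

(** * Antisymmetric pairings and the energy identity *)

Section antisymmetric_kernel.
Context (d : measure_display) (X : measurableType d) (R : realType).
Variables (mu : {finite_measure set X -> \bar R}) (K : X -> X -> R) (M : R).
Hypothesis mK : measurable_fun setT (fun z : X * X => K z.1 z.2).
Hypothesis K0 : forall x y, 0 <= K x y.
Hypothesis Ksym : forall x y, K x y = K y x.
Hypothesis KM : forall x, (\int[mu]_y (K x y)%:E <= M%:E)%E.

Lemma measurable_kernel_section x : measurable_fun setT (K x).
Proof. exact: (measurableT_comp mK (pair1_measurable x)). Qed.

Lemma integrable_kernel_section x : mu.-integrable setT (EFin \o K x).
Proof.
apply/integrableP; split.
  by apply/measurable_EFinP; exact: measurable_kernel_section.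
under eq_integral do rewrite /= ger0_norm//.
by apply: le_lt_trans (KM x) _; rewrite ltry.
Qed.

Lemma Rintegral_kernel_section_le x : \int[mu]_y K x y <= M.
Proof.
rewrite -lee_fin /Rintegral fineK//.
exact: (integrable_fin_num _ (integrable_kernel_section x)).
Qed.

Lemma integrable_kernelM x (a : X -> R) (c : R) : measurable_fun setT a ->
  (forall y, `|a y| <= c) -> mu.-integrable setT (EFin \o (fun y => K x y * a y)).
Proof.
move=> ma ac.
apply: (@le_integrable _ _ _ _ _ measurableT _ (fun y => (c * K x y)%:E)) => //.
- apply/measurable_EFinP; apply: measurable_funM => //.
  exact: measurable_kernel_section.
- move=> y _ /=; rewrite lee_fin !normrM mulrC ler_wpM2r//.
  by rewrite (le_trans (ac y))// ler_norm.
- exact: (integrableZl measurableT c (integrable_kernel_section x)).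
Qed.

Lemma le_norm_Rintegral_kernelM x (a : X -> R) (c : R) : measurable_fun setT a ->
  (forall y, `|a y| <= c) -> `|\int[mu]_y (K x y * a y)| <= c * M.
Proof.
move=> ma ac.
have c0 : 0 <= c by exact: le_trans (ac point).
rewrite (le_trans (le_normr_Rintegral measurableT (integrable_kernelM x ma ac)))//.
apply: (@le_trans _ _ (\int[mu]_y (c * K x y))).
  apply: le_Rintegral => //.
  - exact: (integrable_norm (integrable_kernelM x ma ac)).
  - exact: (integrableZl measurableT c (integrable_kernel_section x)).
  - by move=> y _; rewrite normrM mulrC (ger0_norm (K0 _ _)) ler_wpM2r.
rewrite RintegralZl//; last exact: integrable_kernel_section.
by rewrite ler_wpM2l// Rintegral_kernel_section_le.
Qed.

(** Integrating in the second variable first costs a factor [M] uniformly in the first, which leaves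
    a multiple of the integral of [|e|]. *)
Lemma integrable_kernel_fst (e : X -> R) : mu.-integrable setT (EFin \o e) ->
  (mu \x mu)%E.-integrable setT (fun z => (K z.1 z.2 * e z.1)%:E).
Proof.
move=> inte; have me : measurable_fun setT e.
  by apply/measurable_EFinP; exact: measurable_int inte.
apply/integrable12ltyP.
  apply/measurable_EFinP; apply: measurable_funM => //.
  exact: measurableT_comp.
apply: (@le_lt_trans _ _ (\int[mu]_x (M%:E * `|(e x)%:E|))%E).
  apply: ge0_le_integral => //.
  - by move=> x _; exact: integral_ge0.
  - apply: (measurable_fun_fubini_tonelli_F (fun z => `|K z.1 z.2 * e z.1|%:E)) => //.
    apply/measurable_EFinP; apply: measurableT_comp => //.
    by apply: measurable_funM => //; exact: measurableT_comp.
  - apply: emeasurable_funM => //; apply/measurable_EFinP.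
    exact: measurableT_comp.
  - move=> x _ /=; under eq_integral do rewrite normrM (ger0_norm (K0 _ _)) EFinM.
    rewrite ge0_integralZr//; last first.
    + by move=> y _; rewrite lee_fin.
    + by apply/measurable_EFinP; exact: measurable_kernel_section.
    by rewrite lee_wpmul2r.
have /integrableP[_ ioo] := integrableZl measurableT M inte.
apply: le_lt_trans ioo; apply: ge0_le_integral => //.
- move=> x _; rewrite mule_ge0// lee_fin.
  by apply: le_trans (Rintegral_kernel_section_le x); apply: Rintegral_ge0.
- apply: emeasurable_funM => //; apply/measurable_EFinP.
  exact: measurableT_comp.
- by apply: measurableT_comp => //; apply: emeasurable_funM => //; exact/measurable_EFinP.
- by move=> x _; rewrite abseM lee_wpmul2r// lee_fin ler_norm.
Qed.

Lemma Rintegral_kernel_fst_le (e : X -> R) : mu.-integrable setT (EFin \o e) ->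
  (forall x, 0 <= e x) ->
  \int[(mu \x mu)%E]_z (K z.1 z.2 * e z.1) <= M * \int[mu]_x e x.
Proof.
move=> inte e0; rewrite -(Rintegral12 (f := fun x y => K x y * e x)); last first.
  exact: integrable_kernel_fst.
rewrite -RintegralZl//; apply: le_Rintegral => //.
- exact: (integrable_Rintegral_snd (f := fun x y => K x y * e x) (integrable_kernel_fst inte)).
- exact: (integrableZl measurableT M inte).
- move=> x _; rewrite RintegralZr//; last exact: integrable_kernel_section.
  by rewrite ler_wpM2r// Rintegral_kernel_section_le.
Qed.

Lemma integrable_kernel_prod : (mu \x mu)%E.-integrable setT (fun z => (K z.1 z.2)%:E).
Proof.
have := @integrable_kernel_fst (cst 1) (finite_measure_integrable_cst _ _ measurableT).
by under eq_fun do rewrite mulr1.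
Qed.

Lemma integrable_kernel_prodM (a : X * X -> R) (c : R) : measurable_fun setT a ->
  (forall z, `|a z| <= c) ->
  (mu \x mu)%E.-integrable setT (fun z => (K z.1 z.2 * a z)%:E).
Proof.
move=> ma ac.
apply: (@le_integrable _ _ _ _ _ measurableT _ (fun z => (c * K z.1 z.2)%:E)) => //.
- by apply/measurable_EFinP; apply: measurable_funM.
- move=> z _ /=; rewrite lee_fin !normrM mulrC ler_wpM2r//.
  by rewrite (le_trans (ac z))// ler_norm.
- exact: (integrableZl measurableT c integrable_kernel_prod).
Qed.

(* Antisymmetrising the double integral turns [V x] into [(V x - V y) / 2]. *)
Lemma antisymmetric_pairing_le (w : X -> X -> R) (V e : X -> R) (c : R) :
  measurable_fun setT (fun z : X * X => w z.1 z.2) ->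
  (forall x y, `|w x y| <= 2) ->
  measurable_fun setT V -> (forall x, `|V x| <= c) ->
  mu.-integrable setT (EFin \o e) -> (forall x, 0 <= e x) ->
  {ae (mu \x mu)%E, forall z, w z.1 z.2 = - w z.2 z.1} ->
  {ae (mu \x mu)%E, forall z,
     - (2 * (e z.1 + e z.2)) <= w z.1 z.2 * (V z.2 - V z.1)} ->
  \int[mu]_x ((\int[mu]_y (K x y * w x y)) * V x) <= 2 * M * \int[mu]_x e x.
Proof.
move=> mw w2 mV Vc inte e0 wanti wmono.
have mV1 : measurable_fun setT (fun z : X * X => V z.1) by exact: measurableT_comp.
have mV2 : measurable_fun setT (fun z : X * X => V z.2) by exact: measurableT_comp.
have c0 : 0 <= c by exact: le_trans (Vc point).
pose Ga x y := K x y * (w x y * V x).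
pose Gb x y := K x y * (w x y * V y).
have iGa : (mu \x mu)%E.-integrable setT (fun z => (Ga z.1 z.2)%:E).
  apply: (@integrable_kernel_prodM (fun z => w z.1 z.2 * V z.1) (2 * c)).
    exact: measurable_funM.
  by move=> z; rewrite normrM ler_pM.
have iGb : (mu \x mu)%E.-integrable setT (fun z => (Gb z.1 z.2)%:E).
  apply: (@integrable_kernel_prodM (fun z => w z.1 z.2 * V z.2) (2 * c)).
    exact: measurable_funM.
  by move=> z; rewrite normrM ler_pM.
have ie1 := integrable_kernel_fst inte.
have ie2 : (mu \x mu)%E.-integrable setT (fun z => (K z.1 z.2 * e z.2)%:E).
  have := integrable_prod_swap (f := fun x y => K x y * e x) ie1.
  by under eq_fun do rewrite Ksym.
have swapE (f : X -> X -> R) : (mu \x mu)%E.-integrable setT (fun z => (f z.1 z.2)%:E) ->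
    \int[(mu \x mu)%E]_z f z.1 z.2 = \int[(mu \x mu)%E]_z f z.2 z.1.
  move=> intf; rewrite -(Rintegral12 intf).
  by rewrite -(Rintegral21 (f := fun x y => f y x))//; exact: integrable_prod_swap.
have LHSE : \int[mu]_x ((\int[mu]_y (K x y * w x y)) * V x) =
    \int[(mu \x mu)%E]_z Ga z.1 z.2.
  rewrite -(Rintegral12 iGa); apply: eq_Rintegral => x _.
  rewrite -RintegralZr//.
    by apply: eq_Rintegral => y _; rewrite /Ga mulrA.
  apply: (@integrable_kernelM x (w x) 2) => //.
  exact: (measurableT_comp mw (pair1_measurable x)).
have GaGb : \int[(mu \x mu)%E]_z Ga z.1 z.2 = - \int[(mu \x mu)%E]_z Gb z.1 z.2.
  rewrite (swapE _ iGa) -[RHS]mulN1r -RintegralZl//.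
  have mGa : measurable_fun setT (fun z : X * X => Ga z.1 z.2).
    by apply/measurable_EFinP; exact: measurable_int iGa.
  have mGb : measurable_fun setT (fun z : X * X => Gb z.1 z.2).
    by apply/measurable_EFinP; exact: measurable_int iGb.
  apply: ae_eq_Rintegral.
  - exact: (measurableT_comp mGa (@measurable_swap _ _ _ _)).
  - exact: measurable_funM.
  apply: filterS wanti => z wz.
  by rewrite /Ga /Gb wz Ksym; ring.
have Ga2 : 2 * \int[(mu \x mu)%E]_z Ga z.1 z.2 =
    \int[(mu \x mu)%E]_z (Ga z.1 z.2 - Gb z.1 z.2).
  by rewrite RintegralB//; rewrite GaGb; ring.
have le4 : \int[(mu \x mu)%E]_z (Ga z.1 z.2 - Gb z.1 z.2) <=
    \int[(mu \x mu)%E]_z (2 * (K z.1 z.2 * e z.1) + 2 * (K z.1 z.2 * e z.2)).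
  apply: ae_le_Rintegral.
  - exact: (integrableB measurableT iGa iGb).
  - exact: (integrableD measurableT (integrableZl measurableT 2 ie1)
      (integrableZl measurableT 2 ie2)).
  apply: filterS wmono => z; rewrite /Ga /Gb.
  have := K0 z.1 z.2; move: (K z.1 z.2) (w z.1 z.2) (V z.1) (V z.2) => k a v1 v2.
  move: (e z.1) (e z.2) => e1 e2 k0 h.
  have := ler_wpM2l k0 h; lra.
have sumE : \int[(mu \x mu)%E]_z (2 * (K z.1 z.2 * e z.1) + 2 * (K z.1 z.2 * e z.2)) =
    2 * \int[(mu \x mu)%E]_z (K z.1 z.2 * e z.1) +
    2 * \int[(mu \x mu)%E]_z (K z.1 z.2 * e z.2).
  rewrite RintegralD//; first by rewrite !RintegralZl.
  - exact: (integrableZl measurableT 2 ie1).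
  - exact: (integrableZl measurableT 2 ie2).
have e12 : \int[(mu \x mu)%E]_z (K z.1 z.2 * e z.2) =
    \int[(mu \x mu)%E]_z (K z.1 z.2 * e z.1).
  rewrite (swapE (fun x y => K x y * e y))//.
  by apply: eq_Rintegral => z _; rewrite Ksym.
have := Rintegral_kernel_fst_le inte e0.
by rewrite LHSE; rewrite sumE e12 in le4; lra.
Qed.

End antisymmetric_kernel.

(** * Primitives in time *)

Section primitive.
Context (R : realType) (tau : {finite_measure set (measurableTypeR R) -> \bar R}).
Local Notation RT := (measurableTypeR R).

(** The cut-off is a factor of the integrand rather than a domain depending on [t], so Fubini always
    works on a fixed product. The formula makes sense for every real [t], including the negative
    times reached by the delay. *)
Definition primitive (q : R -> R) (t : R) : R :=
  \int[tau]_s (q s * (s < t)%R%:R).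

Lemma measurable_ltb (d : measure_display) (T : measurableType d) (f g : T -> R) :
  measurable_fun setT f -> measurable_fun setT g ->
  measurable_fun setT (fun x => (f x < g x)%R%:R : R).
Proof.
move=> mf mg.
rewrite (_ : (fun x => _) = (fun x => if f x < g x then 1 else 0 : R)).
  apply: measurable_fun_ifT => //; exact: measurable_fun_ltr.
by apply/funext => x; case: ifP.
Qed.

Lemma measurable_primitive (d : measure_display) (X : measurableType d)
    (q : X -> R -> R) : measurable_fun setT (fun z : X * RT => q z.1 z.2) ->
  measurable_fun setT (fun z : X * RT => primitive (q z.1) z.2).
Proof.
move=> mq.
apply: (@measurable_Rintegral_snd _ _ (X * RT)%type RT R tau
  (fun (z : X * RT) s => q z.1 s * (s < z.2)%R%:R)).
apply: measurable_funM.
  apply: (measurableT_comp mq (g := fun z : (X * RT) * RT => (z.1.1, z.2))).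
  by apply: measurable_fun_pair => //; exact: measurableT_comp.
by apply: measurable_ltb => //; exact: measurableT_comp.
Qed.

Lemma integrable_primitive (q : R -> R) t : tau.-integrable setT (EFin \o q) ->
  tau.-integrable setT (EFin \o (fun s => q s * (s < t)%R%:R)).
Proof.
move=> iq; have mq : measurable_fun setT q.
  by apply/measurable_EFinP; exact: measurable_int iq.
apply: (le_integrable measurableT _ _ iq).
  apply/measurable_EFinP; apply: measurable_funM => //; exact: measurable_ltb.
move=> s _ /=; rewrite lee_fin normrM normr_nat.
by case: (s < t)%R; rewrite ?mulr1 ?mulr0.
Qed.

Lemma le_norm_primitive (q : R -> R) t c : measurable_fun setT q ->
  (forall s, `|q s| <= c) -> `|primitive q t| <= c * fine (tau setT).
Proof.
move=> mq qc; have tauoo : (tau setT < +oo)%E by exact: finite_measure_lty.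
have iq := bounded_integrable tauoo mq qc.
have iqt := integrable_primitive t iq.
rewrite (le_trans (le_normr_Rintegral measurableT iqt))//.
apply: Rintegral_le_cst => //; first exact: integrable_norm iqt.
apply: aeW => s; rewrite normrM normr_nat.
apply: le_trans (qc s); by case: (s < t)%R; rewrite ?mulr1 ?mulr0.
Qed.

Hypothesis tau1 : forall t : R, tau [set t] = 0%E.

(** The square of an integral is a double integral; the diagonal cuts it into two triangles that
    Fubini shows to be equal. On the triangle [r < s < t] the inner integral is [primitive q s]. *)
Lemma primitive_sqr (q : R -> R) t c : measurable_fun setT q ->
  (forall s, `|q s| <= c) ->
  primitive q t ^+ 2 = 2 * \int[tau]_s (q s * primitive q s * (s < t)%R%:R).
Proof.
move=> mq qc; have tauoo : (tau setT < +oo)%E by exact: finite_measure_lty.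
pose A (s : R) := q s * (s < t)%R%:R.
have mA : measurable_fun setT (A : RT -> R).
  by apply: measurable_funM => //; exact: measurable_ltb.
have Ac s : `|A s| <= c.
  rewrite /A normrM normr_nat.
  apply: le_trans (qc s); by case: (s < t)%R; rewrite ?mulr1 ?mulr0.
have c0 : 0 <= c by exact: le_trans (qc 0).
have tau2oo : ((tau \x tau) setT < +oo)%E.
  exact: product_measure_lty.
pose h (s r : R) := A s * (A r * (r < s)%R%:R).
have ih : (tau \x tau)%E.-integrable setT (fun z : RT * RT => (h z.1 z.2)%:E).
  apply: (@bounded_integrable _ _ _ _ (fun z : RT * RT => h z.1 z.2) (c * c)) => //.
    apply: measurable_funM; first exact: measurableT_comp.
    apply: measurable_funM; first exact: measurableT_comp.
    exact: measurable_ltb.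
  move=> z; rewrite normrM ler_pM//.
  rewrite normrM normr_nat; apply: le_trans (Ac z.2).
  by case: (_ < _)%R; rewrite ?mulr1 ?mulr0.
have iA := bounded_integrable tauoo mA Ac.
have iAlt (b : R -> bool) : measurable_fun setT (b : RT -> bool) ->
    tau.-integrable setT (EFin \o (fun r : RT => A r * (b r)%:R)).
  move=> mb; apply: (@bounded_integrable _ _ _ _ _ c) => //.
    apply: measurable_funM => //.
    rewrite (_ : (fun x => _) = (fun x => if b x then 1 else 0 : R)).
      exact: measurable_fun_ifT.
    by apply/funext => x; case: ifP.
  move=> r; rewrite normrM normr_nat.
  by apply: le_trans (Ac r); case: (b r); rewrite ?mulr1 ?mulr0.
have mlt s : measurable_fun setT (fun r : RT => r < s) by exact: measurable_fun_ltr.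
have mgt s : measurable_fun setT (fun r : RT => s < r) by exact: measurable_fun_ltr.
have splitA s : \int[tau]_r A r =
    \int[tau]_r (A r * (r < s)%R%:R) + \int[tau]_r (A r * (s < r)%R%:R).
  rewrite -RintegralD//; [|exact: iAlt|exact: iAlt].
  apply: ae_eq_Rintegral => //.
    by apply: measurable_funD; apply: measurable_funM => //; exact: measurable_ltb.
  exists [set s]; split; [exact: measurable_set1|exact: tau1|].
  move=> r /= nr; apply: contrapT => rs; apply: nr.
  by case: (ltgtP r s) rs => //= _ _; rewrite ?mulr1 ?mulr0 ?addr0 ?add0r.
have primA s : s < t -> \int[tau]_r (A r * (r < s)%R%:R) = primitive q s.
  move=> st; apply: eq_Rintegral => r _; rewrite /A.
  by case: (ltP r s) => rs; rewrite ?mulr0// (lt_trans rs st) !mulr1.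
have hE : \int[tau]_s \int[tau]_r h s r =
    \int[tau]_s (q s * primitive q s * (s < t)%R%:R).
  apply: eq_Rintegral => s _; rewrite /h RintegralZl//; last exact: iAlt.
  rewrite /A; case: (ltP s t) => st; last by rewrite !mulr0 mul0r.
  by rewrite -primA// /A !mulr1.
have -> : primitive q t ^+ 2 = \int[tau]_s (A s * \int[tau]_r A r).
  by rewrite RintegralZr// expr2.
transitivity (\int[tau]_s (\int[tau]_r h s r + \int[tau]_r h r s)).
  apply: eq_Rintegral => s _; rewrite (splitA s) mulrDr; congr (_ + _).
    by rewrite /h RintegralZl//; exact: iAlt.
  rewrite -RintegralZl//; last exact: iAlt.
  by apply: eq_Rintegral => r _; rewrite /h; ring.
rewrite RintegralD//.
- rewrite (Rintegral21 ih) -(Rintegral12 ih) hE; ring.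
- exact: integrable_Rintegral_snd ih.
- exact: integrable_Rintegral_fst ih.
Qed.

(** Integrated form of [d/dt |P|^2 = 2 <q, P>] for the primitive [P] of [q]: a bound on the pairing
    at almost every time suffices. Since [e] is nonnegative, the cut-off at [t] can be forgotten in
    the final bound. *)
Lemma energy_le (d : measure_display) (X : measurableType d)
    (mu : {finite_measure set X -> \bar R}) (q : X -> R -> R) (e : R -> R)
    (c t : R) :
  measurable_fun setT (fun z : X * RT => q z.1 z.2) ->
  (forall x s, `|q x s| <= c) ->
  tau.-integrable setT (EFin \o e) -> (forall s, 0 <= e s) ->
  {ae tau, forall s, \int[mu]_x (q x s * primitive (q x) s) <= e s} ->
  \int[mu]_x (primitive (q x) t ^+ 2) <= 2 * \int[tau]_s e s.
Proof.
move=> mq qc ie e0 qe.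
have muoo : (mu setT < +oo)%E by exact: finite_measure_lty.
have tauoo : (tau setT < +oo)%E by exact: finite_measure_lty.
have mqx x : measurable_fun setT (q x : RT -> R).
  exact: (measurableT_comp mq (pair1_measurable x)).
have mqs s : measurable_fun setT (q ^~ s).
  exact: (measurableT_comp mq (pair2_measurable (s : RT))).
have mp := measurable_primitive mq.
have pc x s := le_norm_primitive s (mqx x) (qc x).
have c0 : 0 <= c by exact: le_trans (qc point 0).
have mutau : ((mu \x tau) setT < +oo)%E.
  exact: product_measure_lty.
pose C := c * (c * fine (tau setT)).
have C0 : 0 <= C by rewrite !mulr_ge0// fine_ge0.
have qpC x s : `|q x s * primitive (q x) s| <= C by rewrite normrM ler_pM.
have mqp : measurable_fun setT (fun z : X * RT => q z.1 z.2 * primitive (q z.1) z.2).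
  exact: measurable_funM.
have mh : measurable_fun setT (fun z : X * RT =>
    q z.1 z.2 * primitive (q z.1) z.2 * (z.2 < t)%R%:R).
  by apply: measurable_funM => //; exact: measurable_ltb.
have ih : (mu \x tau)%E.-integrable setT (fun z : X * RT =>
    (q z.1 z.2 * primitive (q z.1) z.2 * (z.2 < t)%R%:R)%:E).
  apply: (@bounded_integrable _ _ _ _ (fun z : X * RT =>
    q z.1 z.2 * primitive (q z.1) z.2 * (z.2 < t)%R%:R) C) => //.
  move=> z; apply: le_trans (qpC z.1 z.2).
  by rewrite normrM normr_nat; case: (_ < _)%R; rewrite ?mulr1 ?mulr0.
have -> : \int[mu]_x (primitive (q x) t ^+ 2) =
    \int[mu]_x (2 * \int[tau]_s (q x s * primitive (q x) s * (s < t)%R%:R)).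
  by apply: eq_Rintegral => x _; exact: primitive_sqr (mqx x) (qc x).
pose h x (s : RT) := q x s * primitive (q x) s * (s < t)%R%:R.
rewrite (RintegralZl _ measurableT (integrable_Rintegral_snd (f := h) ih)).
rewrite ler_pM2l// (Rintegral12 (f := h) ih) -(Rintegral21 (f := h) ih).
apply: ae_le_Rintegral => //; first exact: (integrable_Rintegral_fst (f := h) ih).
apply: ae_imply qe => s qes; rewrite /h.
rewrite RintegralZr; last 2 first.
- by [].
- apply: (@bounded_integrable _ _ _ _ _ C) => //.
  exact: (measurableT_comp mqp (pair2_measurable (s : RT))).
case: (s < t)%R; rewrite ?mulr1 ?mulr0//; exact: e0.
Qed.

End primitive.

Lemma sgrEltb (R : realType) (x : R) : Num.sg x = (0 < x)%R%:R - (x < 0)%R%:R.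
Proof. by case: sgrP => _; rewrite ?subr0 ?sub0r ?subrr. Qed.

(** The sign is monotone at the delayed values [p] and [q]. Passing to the undelayed values [D] and
    [E] costs the displacements times [|sg p - sg q| <= 2]. *)
Lemma sgr_monotone_defect (R : realType) (p q D E : R) :
  - (2 * (`|D - p| + `|E - q|)) <= (Num.sg p - Num.sg q) * (D - E).
Proof.
have mono : 0 <= (Num.sg p - Num.sg q) * (p - q).
  by case: sgrP => ?; case: sgrP => ?; nra.
have : `|(Num.sg p - Num.sg q) * ((D - p) - (E - q))| <= 2 * (`|D - p| + `|E - q|).
  rewrite normrM ler_pM ?ler_normB//.
  by rewrite (le_trans (ler_normB _ _))//; do 2 case: sgrP => _;
    rewrite ?normr0 ?normr1 ?normrN1; lra.
by rewrite ler_norml => /andP[+ _]; move: mono; lra.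
Qed.

Section integrable_coordinates.
Context (d1 d2 : measure_display) (T1 : measurableType d1)
  (T2 : measurableType d2) (R : realType).
Variables (m1 : {sigma_finite_measure set T1 -> \bar R})
  (m2 : {sigma_finite_measure set T2 -> \bar R}).

Lemma integrable_fst (f : T1 -> R) : (m2 setT < +oo)%E -> m1.-integrable setT (EFin \o f) ->
  (m1 \x m2)%E.-integrable setT (fun z => (f z.1)%:E).
Proof.
move=> moo intf; have mf : measurable_fun setT f.
  by apply/measurable_EFinP; exact: measurable_int intf.
apply/integrable12ltyP.
  by apply/measurable_EFinP; exact: measurableT_comp.
under eq_integral do rewrite /= integral_cst//.
rewrite ge0_integralZr//; last by apply/measurable_EFinP; exact: measurableT_comp.
have /integrableP[_ ioo] := intf.
apply: lte_mul_pinfty; [exact: integral_ge0| |exact: moo].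
by rewrite ge0_fin_numE//; exact: integral_ge0.
Qed.

Lemma integrable_snd (f : T2 -> R) : (m1 setT < +oo)%E -> m2.-integrable setT (EFin \o f) ->
  (m1 \x m2)%E.-integrable setT (fun z => (f z.2)%:E).
Proof.
move=> moo intf; have mf : measurable_fun setT f.
  by apply/measurable_EFinP; exact: measurable_int intf.
apply/integrable21ltyP.
  by apply/measurable_EFinP; exact: measurableT_comp.
under eq_integral do rewrite /= integral_cst//.
rewrite ge0_integralZr//; last by apply/measurable_EFinP; exact: measurableT_comp.
have /integrableP[_ ioo] := intf.
apply: lte_mul_pinfty; [exact: integral_ge0| |exact: moo].
by rewrite ge0_fin_numE//; exact: integral_ge0.
Qed.

End integrable_coordinates.

(** * Increments over one delay *)

Section window.
Context (R : realType) (tau : {finite_measure set (measurableTypeR R) -> \bar R}).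
Local Notation RT := (measurableTypeR R).
Hypothesis tau_itv : forall a b : R, a <= b -> (tau `[a, b]%classic <= (b - a)%:E)%E.

(** For [h >= 0] this is the indicator of [[s - h, s[] in the variable [r], written as a difference
    of the cut-offs of [primitive] so that increments of primitives are read off by linearity. *)
Definition window (h s r : R) : R := (r < s)%R%:R - (r < s - h)%R%:R.

Lemma window_ge0 h s r : 0 <= h -> 0 <= window h s r.
Proof.
move=> h0; rewrite /window.
case: (ltP r (s - h)) => rsh; last by rewrite subr0.
by rewrite (_ : r < s) ?subrr//; move: h0 rsh; lra.
Qed.

Lemma window_le1 h s r : window h s r <= 1.
Proof. by rewrite /window; case: (_ < _)%R; case: (_ < _)%R; rewrite /=; lra. Qed.

Lemma norm_window_le1 h s r : 0 <= h -> `|window h s r| <= 1.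
Proof. by move=> h0; rewrite ger0_norm ?window_le1// window_ge0. Qed.

Lemma measurable_window (d : measure_display) (T : measurableType d)
    (f g : T -> R) h :
  measurable_fun setT f -> measurable_fun setT g ->
  measurable_fun setT (fun x => window h (f x) (g x)).
Proof.
move=> mf mg; apply: measurable_funB; apply: measurable_ltb => //.
exact: measurable_funB.
Qed.

Lemma Rintegral_itv_le (p : R -> R) (a b : R) : a <= b ->
  measurable_fun setT (p : RT -> R) -> (forall s, 0 <= p s <= 1) ->
  (forall s, ~~ (a <= s <= b) -> p s = 0) -> \int[tau]_s p s <= b - a.
Proof.
move=> ab mp p01 p0; have tauoo : (tau setT < +oo)%E by exact: finite_measure_lty.
rewrite -lee_fin; apply: le_trans (tau_itv ab).
have ip : tau.-integrable setT (EFin \o p).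
  apply: (@bounded_integrable _ _ _ _ _ 1) => // s.
  by have /andP[? ?] := p01 s; rewrite ger0_norm.
rewrite /Rintegral fineK; last exact: integrable_fin_num ip.
have <- : (\int[tau]_s (\1_(`[a, b]%classic) s)%:E = tau `[a, b]%classic)%E.
  by rewrite integral_indic// setIT.
apply: ge0_le_integral => //.
- by move=> s _; rewrite lee_fin; have /andP[] := p01 s.
- exact/measurable_EFinP.
- by apply/measurable_EFinP; exact: measurable_indic.
move=> s _; rewrite lee_fin indicE.
have [sab|sab] := boolP (a <= s <= b).
  by rewrite mem_set/=; [have /andP[] := p01 s|rewrite in_itv].
by rewrite p0.
Qed.

Lemma Rintegral_window_le h s : 0 <= h -> \int[tau]_r window h s r <= h.
Proof.
move=> h0; rewrite [leRHS](_ : h = s - (s - h)); last by ring.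
apply: Rintegral_itv_le.
- by move: h0; lra.
- exact: measurable_window.
- by move=> r; rewrite window_ge0// window_le1.
move=> r; rewrite negb_and -!ltNge /window => /orP[rh|sr].
  by rewrite rh (_ : r < s) ?subrr//; move: rh h0; lra.
by rewrite !ltNge (ltW sr) (_ : s - h <= r) ?subrr//; move: sr h0; lra.
Qed.

(** At fixed [r] the window is nonzero for [s] in []r, r + h]]. This is the inner integral once
    Fubini has exchanged the two times. *)
Lemma Rintegral_window_snd_le h r : 0 <= h -> \int[tau]_s window h s r <= h.
Proof.
move=> h0; rewrite [leRHS](_ : h = (r + h) - r); last by ring.
apply: Rintegral_itv_le.
- by move: h0; lra.
- exact: measurable_window.
- by move=> s; rewrite window_ge0// window_le1.
move=> s; rewrite negb_and -!ltNge /window => /orP[rh|sr].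
  rewrite ltNge (ltW rh) ltNge (_ : s - h <= r) ?subrr//.
  by move: rh h0; lra.
have rs : r < s by move: sr h0; lra.
have rsh : r < s - h by move: sr; lra.
by rewrite rs rsh subrr.
Qed.

Lemma integrable_window (q : R -> R) h s : 0 <= h ->
  tau.-integrable setT (EFin \o q) ->
  tau.-integrable setT (EFin \o (fun r => q r * window h s r)).
Proof.
move=> h0 iq; have mq : measurable_fun setT (q : RT -> R).
  by apply/measurable_EFinP; exact: measurable_int iq.
apply: (le_integrable measurableT _ _ iq).
  by apply/measurable_EFinP; apply: measurable_funM => //; exact: measurable_window.
move=> r _ /=; rewrite lee_fin normrM ler_piMr//; exact: norm_window_le1.
Qed.

Lemma primitive_increment (q : R -> R) h s : tau.-integrable setT (EFin \o q) ->
  primitive tau q s - primitive tau q (s - h) = \int[tau]_r (q r * window h s r).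
Proof.
move=> iq; rewrite /primitive -RintegralB//; try exact: integrable_primitive.
by apply: eq_Rintegral => r _; rewrite -mulrBr.
Qed.

Lemma primitive_increment_le (q : R -> R) h s : 0 <= h ->
  tau.-integrable setT (EFin \o q) ->
  `|primitive tau q s - primitive tau q (s - h)| <=
  \int[tau]_r (`|q r| * window h s r).
Proof.
move=> h0 iq; rewrite primitive_increment//.
rewrite (le_trans (le_normr_Rintegral measurableT (integrable_window s h0 iq)))//.
apply: le_Rintegral => //.
- exact: integrable_norm (integrable_window s h0 iq).
- by apply: integrable_window => //; exact: integrable_norm iq.
by move=> r _; rewrite normrM (ger0_norm (window_ge0 _ _ h0)).
Qed.

Lemma primitive_lipschitz (q : R -> R) h s c : 0 <= h ->
  measurable_fun setT (q : RT -> R) -> (forall r, `|q r| <= c) ->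
  `|primitive tau q s - primitive tau q (s - h)| <= c * h.
Proof.
move=> h0 mq qc; have tauoo : (tau setT < +oo)%E by exact: finite_measure_lty.
have iq := bounded_integrable tauoo mq qc.
have c0 : 0 <= c by exact: le_trans (qc 0).
rewrite (le_trans (primitive_increment_le s h0 iq))//.
have iw : tau.-integrable setT (EFin \o (fun r : RT => window h s r)).
  apply: (@bounded_integrable _ _ _ _ _ 1) => //; first exact: measurable_window.
  by move=> r; exact: norm_window_le1.
apply: (@le_trans _ _ (\int[tau]_r (c * window h s r))).
  apply: le_Rintegral => //.
  - by apply: integrable_window => //; exact: integrable_norm iq.
  - exact: (integrableZl measurableT c iw).
  - by move=> r _; rewrite ler_wpM2r// window_ge0.
by rewrite RintegralZl// ler_wpM2l// Rintegral_window_le.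
Qed.

(** Every fixed [r] eventually leaves the window [[s - h n, s[]; dominated convergence concludes. *)
Lemma cvg_Rintegral_window (q : R -> R) (h : nat -> R) s :
  (forall n, 0 <= h n) -> h n @[n --> \oo] --> 0 ->
  tau.-integrable setT (EFin \o q) ->
  \int[tau]_r (`|q r| * window (h n) s r) @[n --> \oo] --> 0.
Proof.
move=> h0 hcvg iq; have mq : measurable_fun setT (q : RT -> R).
  by apply/measurable_EFinP; exact: measurable_int iq.
rewrite (_ : 0 = \int[tau]_(r in setT) (cst 0 r)); last first.
  by rewrite Rintegral_cst// mul0r.
apply: (@Rintegral_dominated _ _ _ tau (fun n r => `|q r| * window (h n) s r)
  (cst 0) (fun r => `|q r|)) => //.
- move=> n; apply: measurable_funM; first exact: measurableT_comp.
  exact: measurable_window.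
- exact: integrable_norm iq.
- apply: aeW => r; have [rs|sr] := ltP r s.
    apply: cvg_near_cst; move/cvgrPdist_lt : hcvg => /(_ (s - r)).
    rewrite subr_gt0 => /(_ rs); apply: filterS => n.
    rewrite sub0r normrN ger0_norm// => hn.
    by rewrite /window rs (_ : r < s - h n) ?subrr ?mulr0//; move: hn; lra.
  apply: cvg_near_cst; apply: nearW => n.
  rewrite /window !ltNge sr (_ : s - h n <= r) ?subrr ?mulr0//.
  by have := h0 n; move: sr; lra.
- move=> n r; rewrite normrM normr_id ler_piMr//; exact: norm_window_le1.
Qed.

Context (d : measure_display) (X : measurableType d)
  (mu : {finite_measure set X -> \bar R}) (f : X -> R -> R).
Hypothesis intf : (mu \x tau)%E.-integrable setT (fun z : X * RT => (f z.1 z.2)%:E).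
Hypothesis intfx : forall x, tau.-integrable setT (EFin \o f x).

Lemma integrable_prod_window h : 0 <= h -> (mu \x tau)%E.-integrable setT
  (fun z : X * RT => (\int[tau]_r (`|f z.1 r| * window h z.2 r))%:E).
Proof.
move=> h0; have mf : measurable_fun setT (fun z : X * RT => f z.1 z.2).
  by apply/measurable_EFinP; exact: measurable_int intf.
pose G x := \int[tau]_r `|f x r|.
have intG : mu.-integrable setT (EFin \o G).
  exact: (integrable_Rintegral_snd (f := fun x (r : RT) => `|f x r|)
           (integrable_norm intf)).
apply: (le_integrable measurableT _ _ (integrable_fst (finite_measure_lty tau) intG)).
  apply/measurable_EFinP.
  apply: (@measurable_Rintegral_snd _ _ (X * RT)%type RT R tau
    (fun (z : X * RT) r => `|f z.1 r| * window h z.2 r)).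
  apply: measurable_funM.
    apply: measurableT_comp => //.
    apply: (measurableT_comp mf (g := fun z : (X * RT) * RT => (z.1.1, z.2))).
    by apply: measurable_fun_pair => //; exact: measurableT_comp.
  by apply: measurable_window => //; exact: measurableT_comp.
move=> z _ /=; rewrite lee_fin ger0_norm; last first.
  by apply: Rintegral_ge0 => r _; rewrite mulr_ge0// window_ge0.
rewrite ger0_norm; last exact: Rintegral_ge0.
apply: le_Rintegral => //.
- by apply: integrable_window => //; exact: integrable_norm (intfx z.1).
- exact: integrable_norm (intfx z.1).
- by move=> r _; rewrite ler_piMr// window_le1.
Qed.

(** The primitive of an integrable function has no rate of continuity at a given time. On average
    over time it has one: after exchanging [s] and [r], each value [|f x r|] is counted during a
    time at most [h]. *)
Lemma Rintegral_prod_window_le h : 0 <= h ->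
  \int[(mu \x tau)%E]_z (\int[tau]_r (`|f z.1 r| * window h z.2 r)) <=
  h * \int[(mu \x tau)%E]_z `|f z.1 z.2|.
Proof.
move=> h0.
have mfx x : measurable_fun setT (f x : RT -> R).
  by apply/measurable_EFinP; exact: measurable_int (intfx x).
have intn : (mu \x tau)%E.-integrable setT (fun z : X * RT => `|f z.1 z.2|%:E).
  exact: integrable_norm intf.
pose H x (s : RT) := \int[tau]_r (`|f x r| * window h s r).
rewrite -(Rintegral12 (f := H) (integrable_prod_window h0)).
rewrite -(Rintegral12 (f := fun x (r : RT) => `|f x r|) intn).
have iG := integrable_Rintegral_snd (f := fun x (r : RT) => `|f x r|) intn.
rewrite -RintegralZl//; apply: le_Rintegral => //.
- exact: (integrable_Rintegral_snd (f := H) (integrable_prod_window h0)).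
- exact: (integrableZl measurableT h iG).
move=> x _; have ifx := integrable_norm (intfx x).
pose G (s r : RT) := `|f x r| * window h s r.
have iGr : (tau \x tau)%E.-integrable setT (fun z : RT * RT => (G z.1 z.2)%:E).
  apply: (le_integrable measurableT _ _ (integrable_snd (finite_measure_lty tau) ifx)).
    apply/measurable_EFinP; apply: measurable_funM.
      by do 2 apply: measurableT_comp => //.
    exact: measurable_window.
  move=> z _ /=; rewrite lee_fin normrM ler_piMr//; exact: norm_window_le1.
rewrite /H (Rintegral12 (f := G) iGr) -(Rintegral21 (f := G) iGr).
rewrite -RintegralZl//; apply: le_Rintegral => //.
- exact: (integrable_Rintegral_fst (f := G) iGr).
- exact: (integrableZl measurableT h ifx).
move=> r _; rewrite /G RintegralZl//.
  by rewrite mulrC ler_wpM2r// Rintegral_window_snd_le.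
apply: (@bounded_integrable _ _ _ _ _ 1).
- exact: finite_measure_lty.
- exact: measurable_window.
- by move=> s; exact: norm_window_le1.
Qed.

End window.

(** * Existence by time delay *)

Section evolution.
Context (R : realType) (d : measure_display) (X : measurableType d).
Local Notation RT := (measurableTypeR R).
Variables (mu : {finite_measure set X -> \bar R}) (K : X -> X -> R) (M : R).
Hypothesis mK : measurable_fun setT (fun z : X * X => K z.1 z.2).
Hypothesis K0 : forall x y, 0 <= K x y.
Hypothesis Ksym : forall x y, K x y = K y x.
Hypothesis KM : forall x, (\int[mu]_y (K x y)%:E <= M%:E)%E.
Variables (T : R) (tau : {finite_measure set RT -> \bar R}).
Hypothesis T0 : 0 < T.
Hypothesis tau1 : forall t : R, tau [set t] = 0%E.
Hypothesis tau_itv : forall a b : R, a <= b -> (tau `[a, b]%classic <= (b - a)%:E)%E.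
Hypothesis tau_supp : {ae tau, forall s, 0 < s < T}.
Variables (g : X -> R) (f : X -> R -> R).
Hypothesis mg : measurable_fun setT g.
Hypothesis intf : (mu \x tau)%E.-integrable setT (fun z : X * RT => (f z.1 z.2)%:E).
Hypothesis intfx : forall x, tau.-integrable setT (EFin \o f x).

Implicit Types (w : X -> X -> R -> R).

Let muoo : (mu setT < +oo)%E. Proof. exact: finite_measure_lty. Qed.
Let tauoo : (tau setT < +oo)%E. Proof. exact: finite_measure_lty. Qed.

Definition measurable3 w :=
  measurable_fun setT (fun z : (X * X) * RT => w z.1.1 z.1.2 z.2).

(** [drift w] is minus the element of the 1-Laplacian carried by the field [w], so [sol w] solves
    the equation as soon as [w] lies in the subdifferential along [sol w]. With [tau] carried by
    []0, T[], the primitives vanish at times [t <= 0], and [sol] then equals [g]: this is the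
    history that the delayed equation needs. *)
Definition drift w x s : R := \int[mu]_y (K x y * w x y s).
Definition disp w x t : R := primitive tau (drift w x) t.
Definition sol w x t : R := g x + primitive tau (f x) t + disp w x t.

Let mf : measurable_fun setT (fun z : X * RT => f z.1 z.2).
Proof. by apply/measurable_EFinP; exact: measurable_int intf. Qed.

Lemma measurable3_snd w x s : measurable3 w -> measurable_fun setT (fun y => w x y s).
Proof.
move=> mw; apply: (measurableT_comp mw (g := fun y : X => ((x, y), s : RT))).
by apply: measurable_fun_pair => //; exact: measurable_fun_pair.
Qed.

Lemma measurable3_pair w s : measurable3 w ->
  measurable_fun setT (fun z : X * X => w z.1 z.2 s).
Proof.
move=> mw; apply: (measurableT_comp mw (g := fun z : X * X => (z, s : RT))).
exact: measurable_fun_pair.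
Qed.

Lemma measurable_drift w : measurable3 w ->
  measurable_fun setT (fun z : X * RT => drift w z.1 z.2).
Proof.
move=> mw; apply: (@measurable_Rintegral_snd _ _ (X * RT)%type X R mu
  (fun (z : X * RT) y => K z.1 y * w z.1 y z.2)).
apply: measurable_funM.
  apply: (measurableT_comp mK (g := fun z : (X * RT) * X => (z.1.1, z.2))).
  by apply: measurable_fun_pair => //; exact: measurableT_comp.
apply: (measurableT_comp mw (g := fun z : (X * RT) * X => ((z.1.1, z.2), z.1.2))).
apply: measurable_fun_pair; last exact: measurableT_comp.
by apply: measurable_fun_pair => //; exact: measurableT_comp.
Qed.

Lemma measurable_drift_snd w x : measurable3 w ->
  measurable_fun setT (drift w x : RT -> R).
Proof. by move/measurable_drift => mq; exact: (measurableT_comp mq (pair1_measurable x)). Qed.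

Lemma le_norm_drift w c : measurable3 w -> (forall x y s, `|w x y s| <= c) ->
  forall x s, `|drift w x s| <= c * M.
Proof.
move=> mw wc x s; apply: le_norm_Rintegral_kernelM => //; exact: measurable3_snd.
Qed.

Lemma driftB w1 w2 c : measurable3 w1 -> measurable3 w2 ->
  (forall x y s, `|w1 x y s| <= c) -> (forall x y s, `|w2 x y s| <= c) ->
  forall x s, drift w1 x s - drift w2 x s = drift (fun x y s => w1 x y s - w2 x y s) x s.
Proof.
move=> mw1 mw2 w1c w2c x s; rewrite /drift -RintegralB//.
- by apply: eq_Rintegral => y _; rewrite mulrBr.
- exact: (integrable_kernelM mK K0 KM x (measurable3_snd x s mw1) (fun y => w1c x y s)).
- exact: (integrable_kernelM mK K0 KM x (measurable3_snd x s mw2) (fun y => w2c x y s)).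
Qed.

Lemma primitiveB (q1 q2 : R -> R) t : tau.-integrable setT (EFin \o q1) ->
  tau.-integrable setT (EFin \o q2) ->
  primitive tau q1 t - primitive tau q2 t = primitive tau (fun s => q1 s - q2 s) t.
Proof.
move=> i1 i2; rewrite /primitive -RintegralB//; try exact: integrable_primitive.
by apply: eq_Rintegral => s _; rewrite mulrBl.
Qed.

Lemma integrable_drift w c x : measurable3 w -> (forall x y s, `|w x y s| <= c) ->
  tau.-integrable setT (EFin \o drift w x).
Proof.
move=> mw wc; apply: (bounded_integrable tauoo (measurable_drift_snd x mw)) => s.
exact: le_norm_drift.
Qed.

Lemma measurable_disp w : measurable3 w ->
  measurable_fun setT (fun z : X * RT => disp w z.1 z.2).
Proof. by move/measurable_drift; exact: measurable_primitive. Qed.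

Lemma measurable_disp_fst w t : measurable3 w -> measurable_fun setT (disp w ^~ t).
Proof.
by move/measurable_disp => mq; exact: (measurableT_comp mq (pair2_measurable (t : RT))).
Qed.

Lemma measurable_sol w : measurable3 w ->
  measurable_fun setT (fun z : X * RT => sol w z.1 z.2).
Proof.
move=> mw; apply: measurable_funD; last exact: measurable_disp.
by apply: measurable_funD; [exact: measurableT_comp|exact: measurable_primitive].
Qed.

Lemma le_norm_disp w c : measurable3 w -> (forall x y s, `|w x y s| <= c) ->
  forall x t, `|disp w x t| <= c * M * fine (tau setT).
Proof.
move=> mw wc x t; apply: le_norm_primitive; first exact: measurable_drift_snd.
by move=> s; exact: le_norm_drift.
Qed.

Lemma primitive_le0 (q : R -> R) t : measurable_fun setT (q : RT -> R) -> t <= 0 ->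
  primitive tau q t = 0.
Proof.
move=> mq t0; rewrite /primitive (@ae_eq_Rintegral _ _ _ tau _ (cst 0)).
- by rewrite Rintegral_cst// mul0r.
- by apply: measurable_funM => //; exact: measurable_ltb.
- by [].
apply: ae_imply tau_supp => s /andP[s0 _].
by rewrite ltNge (le_trans t0 (ltW s0)) mulr0.
Qed.

(** The equation is demanded before [T] only, since the field is built by finitely many steps of
    length [h] which reach just past [T]. *)
Definition delayed h w := [/\ measurable3 w, forall x y s, `|w x y s| <= 1 &
  forall x y s, s < T -> w x y s = Num.sg (sol w y (s - h) - sol w x (s - h))].

Let delay_step h w : X -> X -> R -> R :=
  fun x y s => Num.sg (sol w y (s - h) - sol w x (s - h)).

Let measurable_delay_step h w : measurable3 w -> measurable3 (delay_step h w).
Proof.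
move=> mw; rewrite /measurable3 /delay_step; have ms := measurable_sol mw.
have mdiff : measurable_fun setT (fun z : (X * X) * RT =>
    sol w z.1.2 (z.2 - h) - sol w z.1.1 (z.2 - h)).
  apply: measurable_funB.
    apply: (measurableT_comp ms (g := fun z : (X * X) * RT => (z.1.2, z.2 - h : RT))).
    apply: measurable_fun_pair; first exact: measurableT_comp.
    exact: measurable_funB.
  apply: (measurableT_comp ms (g := fun z : (X * X) * RT => (z.1.1, z.2 - h : RT))).
  apply: measurable_fun_pair; first exact: measurableT_comp.
  exact: measurable_funB.
under eq_fun do rewrite sgrEltb.
by apply: measurable_funB; exact: measurable_ltb.
Qed.

Let le_norm_sgr (x : R) : `|Num.sg x| <= 1.
Proof. by case: sgrP => _; rewrite ?normr0 ?normr1 ?normrN1. Qed.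

Lemma eq_disp w1 w2 x t : (forall y s, s < t -> w1 x y s = w2 x y s) ->
  disp w1 x t = disp w2 x t.
Proof.
move=> w12; apply: eq_Rintegral => s _.
case: (ltP s t) => st; last by rewrite !mulr0.
by congr (_ * _); apply: eq_Rintegral => y _; rewrite w12.
Qed.

Lemma exists_delayed h : 0 < h -> exists w, delayed h w.
Proof.
move=> h0; pose W n := iter n (delay_step h) (fun _ _ _ => 0).
have mW n : measurable3 (W n).
  elim: n => [|n IH]; first exact: measurable_cst.
  exact: measurable_delay_step.
have W1 n x y s : `|W n x y s| <= 1.
  by case: n => [|n] /=; rewrite ?normr0// le_norm_sgr.
have WS n x y s : W n.+1 x y s =
    Num.sg (sol (W n) y (s - h) - sol (W n) x (s - h)) by [].
clearbody W.
(* Each step determines the solution on one more time interval of length h. *)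
have stab n : forall x t, t <= n%:R * h -> disp (W n.+1) x t = disp (W n) x t.
  elim: n => [x t|n IH x t tn].
    by rewrite mul0r => t0; rewrite /disp !primitive_le0//; exact: measurable_drift_snd.
  apply: eq_disp => y s st; rewrite !WS /sol.
  have sh : s - h <= n%:R * h by move: tn st; rewrite -natr1 mulrDl mul1r; lra.
  by rewrite (IH y _ sh) (IH x _ sh).
have [N TN] : exists N : nat, T <= N%:R * h.
  exists (Num.bound (T / h)); rewrite -ler_pdivrMr//.
  by apply/ltW/archi_boundP; rewrite divr_ge0// ltW.
exists (W N.+1); split => // x y s sT; rewrite {1}WS /sol.
(* [W N.+1] is computed from the solution of [W N]; up to time [N * h], which covers [s - h], that
   solution is already the one of [W N.+1]. *)
have sh : s - h <= N%:R * h by move: sT TN h0; lra.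
by rewrite (stab _ y _ sh) (stab _ x _ sh).
Qed.

Lemma sol_increment_le w h x s : 0 <= h -> measurable3 w ->
  (forall x y s, `|w x y s| <= 1) ->
  `|sol w x s - sol w x (s - h)| <=
  M * h + \int[tau]_r (`|f x r| * window h s r).
Proof.
move=> h0 mw w1.
rewrite (_ : _ - _ = (disp w x s - disp w x (s - h)) +
    (primitive tau (f x) s - primitive tau (f x) (s - h))); last first.
  by rewrite /sol; ring.
rewrite (le_trans (ler_normD _ _))// lerD//.
  apply: primitive_lipschitz => //; first exact: measurable_drift_snd.
  by move=> r; rewrite -[leRHS]mul1r; exact: le_norm_drift.
exact: primitive_increment_le.
Qed.

(** Bounds the displacement per unit of delay, integrated over space and time: the drift has speed
    at most [M], and [f] contributes its L^1 norm. *)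
Let C0 := M * fine ((mu \x tau)%E setT) +
  \int[(mu \x tau)%E]_z `|f z.1 z.2|.

Let M0 : 0 <= M.
Proof.
apply: le_trans (Rintegral_kernel_section_le mK K0 KM point).
exact: Rintegral_ge0.
Qed.

Let C0_ge0 : 0 <= C0.
Proof.
apply: addr_ge0; last by apply: Rintegral_ge0 => z _; exact: normr_ge0.
by apply: mulr_ge0 => //; apply: fine_ge0; exact: measure_ge0.
Qed.

(** [energy_le] is applied to the difference of the drifts, with [e s] the bound that
    [antisymmetric_pairing_le] gives for the displacement defects. Its time integral is at most
    [2 M C0 (h1 + h2)], and the energy inequality doubles it. *)
Lemma delayed_energy_le h1 h2 w1 w2 t : 0 <= h1 -> 0 <= h2 ->
  delayed h1 w1 -> delayed h2 w2 ->
  \int[mu]_x ((disp w1 x t - disp w2 x t) ^+ 2) <= 4 * M * C0 * (h1 + h2).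
Proof.
(* The function [a h x s] introduced next is the bound of [sol_increment_le] for the distance
   travelled at [x] between [s - h] and [s]. *)
move=> h10 h20 [mw1 w11 dw1] [mw2 w21 dw2].
pose a h x (s : RT) := M * h + \int[tau]_r (`|f x r| * window h s r).
have a0 h x s : 0 <= h -> 0 <= a h x s.
  move=> h0; rewrite addr_ge0 ?mulr_ge0//; apply: Rintegral_ge0 => r _.
  by rewrite mulr_ge0// window_ge0.
have mutauoo : ((mu \x tau) setT < +oo)%E by exact: product_measure_lty.
have ia h : 0 <= h -> (mu \x tau)%E.-integrable setT (fun z : X * RT => (a h z.1 z.2)%:E).
  move=> h0; have i1 : (mu \x tau)%E.-integrable setT (fun z : X * RT => (M * h)%:E).
    exact: (@bounded_integrable _ _ _ _ (cst (M * h)) `|M * h|).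
  have i2 := integrable_prod_window intf intfx h0.
  by apply: eq_integrable (integrableD measurableT i1 i2) => // z _.
have aC h : 0 <= h -> \int[(mu \x tau)%E]_z a h z.1 z.2 <= C0 * h.
  move=> h0; rewrite RintegralD//; last 2 first.
  - exact: (@bounded_integrable _ _ _ _ (cst (M * h)) `|M * h|).
  - exact: (integrable_prod_window intf intfx h0).
  rewrite Rintegral_cst// mulrDl; apply: lerD.
    by rewrite mulrAC.
  by rewrite mulrC; exact: Rintegral_prod_window_le.
pose e (s : RT) := 2 * M * \int[mu]_x (a h1 x s + a h2 x s).
have ia12 : (mu \x tau)%E.-integrable setT
    (fun z : X * RT => (a h1 z.1 z.2 + a h2 z.1 z.2)%:E).
  by apply: eq_integrable (integrableD measurableT (ia _ h10) (ia _ h20)) => // z _.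
pose a12 x (s : RT) := a h1 x s + a h2 x s.
have ie : tau.-integrable setT (EFin \o e).
  have := integrableZl measurableT (2 * M) (integrable_Rintegral_fst (f := a12) ia12).
  by apply: eq_integrable => // s _.
have e0 s : 0 <= e s.
  rewrite !mulr_ge0//; apply: Rintegral_ge0 => x _.
  by apply: addr_ge0; exact: a0.
pose w12 x y s := w1 x y s - w2 x y s.
have mw12 : measurable3 w12 by exact: measurable_funB.
have w12c x y s : `|w12 x y s| <= 2.
  by rewrite (le_trans (ler_normB _ _))//; have := w11 x y s; have := w21 x y s; lra.
have dispE x s : disp w1 x s - disp w2 x s = primitive tau (drift w12 x) s.
  rewrite /disp primitiveB; [|exact: integrable_drift w11|exact: integrable_drift w21].
  by apply: eq_Rintegral => r _; rewrite (driftB mw1 mw2 w11 w21).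
have -> : \int[mu]_x ((disp w1 x t - disp w2 x t) ^+ 2) =
    \int[mu]_x (primitive tau (drift w12 x) t ^+ 2).
  by apply: eq_Rintegral => x _; rewrite dispE.
apply: (@le_trans _ _ (2 * \int[tau]_s e s)); last first.
  rewrite /e RintegralZl//; last exact: (integrable_Rintegral_fst (f := a12) ia12).
  rewrite (Rintegral21 (f := a12) ia12) RintegralD//; [|exact: ia|exact: ia].
  have := aC _ h10; have := aC _ h20; move: M0; move: (\int[_]_z _) (\int[_]_z _) => A B.
  by move: C0 => C M_ h h'; have := ler_wpM2l M_ h; have := ler_wpM2l M_ h'; lra.
apply: (energy_le tau1 (c := 2 * M)) => //.
- exact: measurable_drift.
- by move=> x s; exact: le_norm_drift.
apply: (ae_imply2 _ tau_supp (ae_integrable_ysection (f := a12) ia12)).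
move=> s /andP[_ sT] ias.
have -> : \int[mu]_x (drift w12 x s * primitive tau (drift w12 x) s) =
    \int[mu]_x ((\int[mu]_y (K x y * w12 x y s)) * (disp w1 x s - disp w2 x s)).
  by apply: eq_Rintegral => x _; rewrite dispE.
apply: (antisymmetric_pairing_le mK K0 Ksym KM (c := 2 * M * fine (tau setT))) => //.
- exact: measurable3_pair.
- by apply: measurable_funB; exact: measurable_disp_fst.
- by move=> x; rewrite dispE; exact: le_norm_disp.
- by move=> x; rewrite addr_ge0// a0.
- apply: aeW => z; rewrite /w12 dw1// dw2// (dw1 z.2)// (dw2 z.2)//.
  by rewrite -(opprB (sol w1 z.2 _)) -(opprB (sol w2 z.2 _)) !sgrN opprB opprK addrC.
apply: aeW => -[x y] /=; rewrite /w12 dw1// dw2//.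
set p := sol w1 y _ - _; set q := sol w2 y _ - _.
have := sgr_monotone_defect p q (sol w1 y s - sol w1 x s) (sol w2 y s - sol w2 x s).
(* The data [g] and [f] cancel here, which turns differences of solutions into differences of
   bounded displacements. *)
rewrite (_ : sol w1 y s - sol w1 x s - (sol w2 y s - sol w2 x s) =
    disp w1 y s - disp w2 y s - (disp w1 x s - disp w2 x s)); last first.
  rewrite /sol; move: (disp w1 x s) (disp w1 y s) (disp w2 x s) (disp w2 y s).
  by move: (primitive tau (f x) s) (primitive tau (f y) s) => *; ring.
apply: le_trans; rewrite lerN2 ler_pM2l//.
have incr w h : 0 <= h -> measurable3 w -> (forall x y s, `|w x y s| <= 1) ->
    `|sol w y s - sol w x s - (sol w y (s - h) - sol w x (s - h))| <= a h x s + a h y s.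
  move=> h0 mw ww1.
  rewrite (_ : _ - _ - _ = (sol w y s - sol w y (s - h)) - (sol w x s - sol w x (s - h))).
    rewrite (le_trans (ler_normB _ _))// addrC lerD//; exact: sol_increment_le.
  by ring.
have := incr _ _ h10 mw1 w11; have := incr _ _ h20 mw2 w21.
by rewrite -/p -/q; lra.
Qed.

Local Notation mu2 := (finite_product mu mu).

(** Integrable majorant of [K |w1 - w2|] for any two fields bounded by 1. *)
Lemma integrable_kernel3 : (mu2 \x tau)%E.-integrable setT
  (fun z : (X * X) * RT => (2 * K z.1.1 z.1.2)%:E).
Proof.
apply: (@integrable_fst _ _ _ _ _ mu2 tau (fun z => 2 * K z.1 z.2) tauoo).
exact: (integrableZl measurableT 2 (integrable_kernel_prod mK K0 KM)).
Qed.

Lemma le_norm_primitive_Rintegral (q : R -> R) t : tau.-integrable setT (EFin \o q) ->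
  `|primitive tau q t| <= \int[tau]_s `|q s|.
Proof.
move=> iq; have iqt := integrable_primitive t iq.
rewrite (le_trans (le_normr_Rintegral measurableT iqt))//.
apply: le_Rintegral => //.
- exact: integrable_norm iqt.
- exact: integrable_norm iq.
- by move=> s _; rewrite normrM normr_nat; case: (s < t)%R; rewrite ?mulr1 ?mulr0.
Qed.

(** Transfers convergence of fields, in the L^1 norm weighted by [K], to convergence of the
    displacements at a rate independent of [t]. *)
Lemma disp_L1dist_le w1 w2 t : measurable3 w1 -> measurable3 w2 ->
  (forall x y s, `|w1 x y s| <= 1) -> (forall x y s, `|w2 x y s| <= 1) ->
  \int[mu]_x `|disp w1 x t - disp w2 x t| <=
  \int[(mu2 \x tau)%E]_z
    (K z.1.1 z.1.2 * `|w1 z.1.1 z.1.2 z.2 - w2 z.1.1 z.1.2 z.2|).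
Proof.
move=> mw1 mw2 w11 w21.
pose r x y s := `|w1 x y s - w2 x y s|.
pose w12 x y s := w1 x y s - w2 x y s.
have mw12 : measurable3 w12 by exact: measurable_funB.
have mr : measurable3 r by exact: measurableT_comp mw12.
have w12c x y s : `|w12 x y s| <= 2.
  by rewrite (le_trans (ler_normB _ _))//; have := w11 x y s; have := w21 x y s; lra.
have rc x y s : `|r x y s| <= 2 by rewrite normr_id w12c.
have mutauoo : ((mu \x tau) setT < +oo)%E by exact: product_measure_lty.
have ir : (mu \x tau)%E.-integrable setT (fun z : X * RT => (drift r z.1 z.2)%:E).
  apply: (@bounded_integrable _ _ _ _ (fun z : X * RT => drift r z.1 z.2) (2 * M)) => //.
    exact: measurable_drift.
  by move=> z; exact: le_norm_drift.
have dispE x : disp w1 x t - disp w2 x t = primitive tau (drift w12 x) t.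
  rewrite /disp primitiveB; [|exact: integrable_drift w11|exact: integrable_drift w21].
  by apply: eq_Rintegral => s _; rewrite (driftB mw1 mw2 w11 w21).
have iK : (mu2 \x tau)%E.-integrable setT
    (fun z : (X * X) * RT => (K z.1.1 z.1.2 * r z.1.1 z.1.2 z.2)%:E).
  apply: (le_integrable measurableT _ _ integrable_kernel3).
    apply/measurable_EFinP; apply: measurable_funM => //.
    by apply: (measurableT_comp mK); exact: measurable_fst.
  move=> z _ /=; rewrite lee_fin !normrM (ger0_norm (K0 _ _)) mulrC ler_wpM2r//.
  by rewrite (le_trans (rc _ _ _))// ler_norm.
pose H (z : X * X) (s : RT) := K z.1 z.2 * r z.1 z.2 s.
pose D x (s : RT) := drift r x s.
apply: (@le_trans _ _ (\int[mu]_x \int[tau]_s D x s)).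
  apply: le_Rintegral => //.
  - apply: (@bounded_integrable _ _ _ _ _ (2 * M * fine (tau setT))) => //.
      by apply: measurableT_comp => //; apply: measurable_funB; exact: measurable_disp_fst.
    by move=> x; rewrite normr_id dispE; exact: le_norm_disp.
  - exact: (integrable_Rintegral_snd (f := D) ir).
  move=> x _; rewrite dispE.
  have idr := integrable_drift x mw12 w12c.
  rewrite (le_trans (le_norm_primitive_Rintegral t idr))//.
  apply: le_Rintegral => //.
  - exact: integrable_norm idr.
  - exact: (integrable_drift x mr rc).
  move=> s _; have iKw := integrable_kernelM mK K0 KM x (measurable3_snd x s mw12)
    (fun y => w12c x y s).
  rewrite (le_trans (le_normr_Rintegral measurableT iKw))//.
  rewrite le_eqVlt; apply/orP; left; apply/eqP; apply: eq_Rintegral => y _.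
  by rewrite normrM (ger0_norm (K0 _ _)).
rewrite (Rintegral12 (f := D) ir) -(Rintegral21 (f := D) ir).
rewrite -(Rintegral21 (f := H) iK) le_eqVlt; apply/orP; left; apply/eqP.
apply: eq_Rintegral => s _.
rewrite /D /drift /H -(Rintegral12 (f := fun x y => K x y * r x y s))//.
apply: (integrable_kernel_prodM mK K0 KM (a := fun z => r z.1 z.2 s) (c := 2)) => //.
exact: measurable3_pair.
Qed.

(** The displacement is linear in the field and a tail average is a finite convex combination of
    evaluations. *)
Lemma disp_tail_average n L (w_ : nat -> X -> X -> R -> R) x t :
  tail_average n L -> (forall k, measurable3 (w_ k)) ->
  (forall k x y s, `|w_ k x y s| <= 1) ->
  disp (fun x y s => L (fun k => w_ k x y s)) x t = L (fun k => disp (w_ k) x t).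
Proof.
move=> Ln mw w1.
have driftL s : drift (fun x y s => L (fun k => w_ k x y s)) x s =
    L (fun k => drift (w_ k) x s).
  have iKw k := integrable_kernelM mK K0 KM x (measurable3_snd x s (mw k))
    (fun y => w1 k x y s).
  rewrite /drift -(integrable_tail_average Ln iKw).2.
  by apply: eq_Rintegral => y _; rewrite (tail_averageZ _ _ Ln).
have ip k := integrable_primitive t (integrable_drift x (mw k) (w1 k)).
rewrite /disp /primitive -(integrable_tail_average Ln ip).2.
apply: eq_Rintegral => s _; rewrite driftL mulrC -(tail_averageZ _ _ Ln).
by congr (L _); apply/funext => k; rewrite mulrC.
Qed.

(** The error splits into the convergence of the displacements at time [s] and the increment over
    the last delay, which tends to 0 even though [f] is only integrable in time. *)
Lemma delayed_sol_cvg (w_ : nat -> X -> X -> R -> R) w (h : nat -> R) x s :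
  (forall k, 0 <= h k) -> h k @[k --> \oo] --> 0 ->
  (forall k, measurable3 (w_ k)) -> (forall k x y s, `|w_ k x y s| <= 1) ->
  disp (w_ k) x s - disp w x s @[k --> \oo] --> 0 ->
  sol (w_ k) x (s - h k) @[k --> \oo] --> sol w x s.
Proof.
move=> h0 hcvg mw w1 dcvg.
have incr0 : sol (w_ k) x s - sol (w_ k) x (s - h k) @[k --> \oo] --> 0.
  apply: norm_cvg0; apply: (@squeeze_cvgr _ _ _ _ (cst 0) (fun k => M * h k +
      \int[tau]_r (`|f x r| * window (h k) s r))).
  - by apply: nearW => k; rewrite normr_ge0/=; exact: sol_increment_le.
  - exact: cvg_cst.
  rewrite (_ : 0 = M * 0 + 0); last by rewrite mulr0 addr0.
  apply: cvgD; first by apply: cvgM => //; exact: cvg_cst.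
  exact: cvg_Rintegral_window.
rewrite (_ : (fun k => _) = (fun k => sol w x s + (disp (w_ k) x s - disp w x s) -
    (sol (w_ k) x s - sol (w_ k) x (s - h k)))); last first.
  by apply/funext => k; rewrite /sol; ring.
rewrite (_ : sol w x s = sol w x s + 0 - 0); last by rewrite addr0 subr0.
by apply: cvgB => //; apply: cvgD => //; rewrite ?addr0 ?subr0; exact: cvg_cst.
Qed.

Theorem exists_evolution : exists w, [/\ measurable3 w,
  forall x y s, `|w x y s| <= 1,
  {ae tau, forall s, {ae (mu \x mu)%E, forall z, w z.1 z.2 s = - w z.2 z.1 s}} &
  {ae tau, forall s, {ae (mu \x mu)%E, forall z,
    subdiff_abs (sol w z.2 s - sol w z.1 s) (w z.1 z.2 s)}}].
Proof.
pose h k := T * 4^-1 ^+ k.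
have h_gt0 k : 0 < h k by rewrite mulr_gt0// exprn_gt0// invr_gt0.
have h_ge0 k : 0 <= h k by exact: ltW.
have h_cvg : h k @[k --> \oo] --> 0.
  rewrite (_ : 0 = T * 0); last by rewrite mulr0.
  apply: cvgM; first exact: cvg_cst.
  by apply: cvg_expr; rewrite ger0_norm ?invr_ge0// invf_lt1// ltr1n.
have [w_ dw_] := boolp.choice (fun k => exists_delayed (h_gt0 k)).
have mw_ k : measurable3 (w_ k) by case: (dw_ k).
have w_1 k x y s : `|w_ k x y s| <= 1 by case: (dw_ k).
(* For [k <= l] one has [h l + h k <= 2 T 4^-k], so [C1 4^-k] bounds the energy between ranks [k]
   and [l]; [C2] is the constant that [le_Rintegral_norm_sqr] makes out of [C1]. *)
pose C1 := 4 * M * C0 * (2 * T); pose C2 := fine (mu setT) + C1.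
have C1_ge0 : 0 <= C1.
  by rewrite /C1 !mulr_ge0//; exact: ltW.
have C2_ge0 : 0 <= C2 by rewrite addr_ge0// fine_ge0.
have cauchy t k l : (k <= l)%N ->
    \int[mu]_x `|disp (w_ l) x t - disp (w_ k) x t| <= C2 * 2^-1 ^+ k.
  move=> kl; apply: (@le_Rintegral_norm_sqr _ _ _ _ _ (2 * (1 * M * fine (tau setT)))) => //.
  - by apply: measurable_funB; exact: measurable_disp_fst.
  - move=> x; rewrite (le_trans (ler_normB _ _))//.
    have := le_norm_disp (mw_ l) (w_1 l) x t.
    by have := le_norm_disp (mw_ k) (w_1 k) x t; lra.
  apply: le_trans (delayed_energy_le t (h_ge0 l) (h_ge0 k) (dw_ l) (dw_ k)) _.
  rewrite /C1 -!mulrA ler_wpM2l// ler_wpM2l// ler_wpM2l//.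
  have : 4^-1 ^+ l <= 4^-1 ^+ k :> R.
    by apply: ler_wiXn2l => //; rewrite ?invr_ge0// invf_le1// ler1n.
  by rewrite /h => le4; have := ler_wpM2l (ltW T0) le4; lra.
have m3oo : ((mu2 \x tau) setT < +oo)%E.
  by apply: product_measure_lty => //; exact: finite_measure_lty.
have [L [Ltail Lcvg]] := @mazur_bounded _ _ _ (mu2 \x tau)%E
  (fun k (z : (X * X) * RT) => w_ k z.1.1 z.1.2 z.2) m3oo mw_ (fun k z => w_1 k _ _ _).
pose v n x y s := L n (fun k => w_ k x y s).
have mv n : measurable3 (v n) by exact: measurable_tail_average (Ltail n) mw_.
have v1 n x y s : `|v n x y s| <= 1.
  exact: (le_norm_tail_average (Ltail n) (w := fun k z => w_ k z.1.1 z.1.2 z.2)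
    (fun k z => w_1 k _ _ _) (((x, y), s) : (X * X) * RT)).
(* The upper limit is measurable and agrees with the limit wherever there is one; clamping it to
   [[-1, 1]] makes the bound immediate at every point. *)
pose w x y s : R := Num.max (-1) (Num.min 1 (limn_sup (fun n => v n x y s))).
have mw : measurable3 w.
  apply: measurable_maxr => //; apply: measurable_minr => //.
  apply: (measurable_fun_limn_sup (h := fun n (z : (X * X) * RT) => v n z.1.1 z.1.2 z.2)).
  - move=> z _; exists 1 => _ [n _ <-].
    by have := v1 n z.1.1 z.1.2 z.2; rewrite ler_norml => /andP[].
  - move=> z _; exists (-1) => _ [n _ <-].
    by have := v1 n z.1.1 z.1.2 z.2; rewrite ler_norml => /andP[].
  - exact: mv.
have w1 x y s : `|w x y s| <= 1.
  by rewrite /w ler_norml le_max lexx/= ge_max ge_min lexx/= andbT; lra.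
have vw x y s (l : R) : v n x y s @[n --> \oo] --> l -> w x y s = l.
  move=> vl; rewrite /w (cvg_limn_inf_sup vl).2.
  have l1 : l <= 1.
    rewrite -(cvg_lim _ vl)//; apply: limr_le; first by apply/cvg_ex; exists l.
    by apply: nearW => n; have := v1 n x y s; rewrite ler_norml => /andP[].
  have l2 : -1 <= l.
    rewrite -(cvg_lim _ vl)//; apply: limr_ge; first by apply/cvg_ex; exists l.
    by apply: nearW => n; have := v1 n x y s; rewrite ler_norml => /andP[].
  by rewrite min_r// max_r.
clearbody w.
have vcvg : {ae (mu2 \x tau)%E, forall z : (X * X) * RT,
    v n z.1.1 z.1.2 z.2 @[n --> \oo] --> w z.1.1 z.1.2 z.2}.
  apply: ae_imply Lcvg => z /cvg_ex[l vl].
  by rewrite (vw _ _ _ l vl).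
have delta_cvg : \int[(mu2 \x tau)%E]_z
    (K z.1.1 z.1.2 * `|v n z.1.1 z.1.2 z.2 - w z.1.1 z.1.2 z.2|) @[n --> \oo] --> 0.
  rewrite [X in _ --> X](_ : _ = \int[(mu2 \x tau)%E]_z cst 0 z); last first.
    by rewrite Rintegral_cst// mul0r.
  apply: (@Rintegral_dominated _ _ _ (mu2 \x tau)%E (fun n (z : (X * X) * RT) =>
      K z.1.1 z.1.2 * `|v n z.1.1 z.1.2 z.2 - w z.1.1 z.1.2 z.2|) (cst 0)
      (fun z : (X * X) * RT => 2 * K z.1.1 z.1.2)) => //.
  - move=> n; apply: measurable_funM.
      by apply: (measurableT_comp mK); exact: measurable_fst.
    by apply: measurableT_comp => //; apply: measurable_funB; [exact: mv|exact: mw].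
  - exact: integrable_kernel3.
  - apply: ae_imply vcvg => z vz.
    rewrite [X in _ --> X](_ : _ = K z.1.1 z.1.2 * `|w z.1.1 z.1.2 z.2 - w z.1.1 z.1.2 z.2|).
      apply: cvgM; first exact: cvg_cst.
      by apply: cvg_norm; apply: cvgB => //; exact: cvg_cst.
    by rewrite subrr normr0 mulr0.
  - move=> n z; rewrite normrM (ger0_norm (K0 _ _)) normr_id mulrC ler_wpM2r//.
    rewrite (le_trans (ler_normB _ _))//.
    by have := v1 n z.1.1 z.1.2 z.2; have := w1 z.1.1 z.1.2 z.2; lra.
have idisp w' t : measurable3 w' -> (forall x y s, `|w' x y s| <= 1) ->
    mu.-integrable setT (EFin \o disp w' ^~ t).
  move=> mw' w'1; apply: (bounded_integrable muoo (measurable_disp_fst t mw')) => x.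
  exact: le_norm_disp.
(* For [n >= k] the field [v n] averages fields of rank at least [k], so its displacement stays
   within [C2 2^-k] of that of [w_ k]. Letting [n] grow identifies the limit of the displacements as
   [disp w], and keeps the rate. *)
have distw t k : \int[mu]_x `|disp (w_ k) x t - disp w x t| <= C2 * 2^-1 ^+ k.
  apply/ler_addgt0Pr => e e0.
  move/cvgrPdist_le : delta_cvg => /(_ e e0)[N _ deltaN].
  pose n := maxn N k.
  have dvk : \int[mu]_x `|disp (v n) x t - disp (w_ k) x t| <= C2 * 2^-1 ^+ k.
    under eq_Rintegral => x _ do rewrite (disp_tail_average x t (Ltail n) mw_ w_1).
    apply: (@tail_average_L1dist _ _ _ mu n (L n) (fun k x => disp (w_ k) x t)
      (fun x => disp (w_ k) x t)) => //.
    - by move=> j; exact: idisp.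
    - exact: idisp.
    - by move=> j nj; apply: cauchy; apply: leq_trans nj; exact: leq_maxr.
  have dvw : \int[mu]_x `|disp (v n) x t - disp w x t| <= e.
    apply: le_trans (disp_L1dist_le t (mv n) mw (v1 n) w1) _.
    have := deltaN n (leq_maxl _ _); rewrite sub0r normrN => /(le_trans _); apply.
    exact: ler_norm.
  apply: le_trans (lerD dvk dvw).
  exact: (L1dist_triangle (idisp _ t (mv n) (v1 n)) (idisp _ t (mw_ k) (w_1 k))
    (idisp _ t mw w1)).
(* The rate is summable, so the whole sequence converges almost everywhere in [x], at each time
   [t]. *)
have dispcvg t : {ae mu, forall x, disp (w_ k) x t - disp w x t @[k --> \oo] --> 0}.
  apply: (@ae_cvg0_fast _ _ _ mu (fun k x => disp (w_ k) x t - disp w x t) C2) => //.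
    by move=> k; apply: measurable_funB; exact: measurable_disp_fst.
  move=> k; have i1 := integrable_norm
    (integrableB measurableT (idisp _ t (mw_ k) (w_1 k)) (idisp _ t mw w1)).
  have := distw t k; rewrite -lee_fin /Rintegral fineK//.
  exact: (integrable_fin_num _ i1).
have good : {ae tau, forall s, s < T /\ {ae (mu \x mu)%E, forall z,
    v n z.1 z.2 s @[n --> \oo] --> w z.1 z.2 s}}.
  have vs := ae_prod_ysection (P := fun (z : X * X) (s : RT) =>
    v n z.1 z.2 s @[n --> \oo] --> w z.1 z.2 s) vcvg.
  by apply: ae_imply2 tau_supp vs => s /andP[_ sT].
exists w; split => //.
- apply: ae_imply good => s [sT]; apply: ae_imply => z vz.
  (* Before [T] every [w_ k] is exactly antisymmetric and averages preserve this, so convergence at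
     [(x, y)] forces convergence at [(y, x)] to the opposite value. *)
  rewrite -[LHS]opprK; congr (- _); apply/esym; apply: vw.
  rewrite (_ : (fun n => _) = (fun n => - v n z.1 z.2 s)); first exact: cvgN.
  apply/funext => n; rewrite /v -(tail_averageN _ (Ltail n)); congr (L n _).
  apply/funext => k; have [_ _ dk] := dw_ k.
  by rewrite !dk// -(opprB (sol (w_ k) z.2 _)) sgrN.
apply: ae_imply good => s [sT vs].
have vs2 := ae_imply2 (fun z a b => conj a b) (ae_fst mu (dispcvg s)) (ae_snd mu (dispcvg s)).
apply: ae_imply2 vs vs2 => -[x y] /= vz [dx dy].
have Dcvg : sol (w_ k) y (s - h k) - sol (w_ k) x (s - h k) @[k --> \oo] -->
    sol w y s - sol w x s.
  exact: (cvgB (delayed_sol_cvg h_ge0 h_cvg mw_ w_1 dy)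
    (delayed_sol_cvg h_ge0 h_cvg mw_ w_1 dx)).
have w_E k : w_ k x y s = Num.sg (sol (w_ k) y (s - h k) - sol (w_ k) x (s - h k)).
  by have [_ _ dk] := dw_ k; rewrite dk.
(* Where the limit difference is nonzero, the signs [w_ k] are eventually constant, so their tail
   averages have the same limit. Where it vanishes, the subdifferential only asks for [|w| <= 1]. *)
rewrite /subdiff_abs; case: ifPn => [Dpos|_]; last case: ifPn => [Dneg|_].
- apply: vw; apply: tail_average_cvg => //; apply: cvg_near_cst.
  apply: filterS (cvgr_gt _ Dcvg 0 Dpos) => k Dk.
  by rewrite w_E gtr0_sg.
- apply: vw; apply: tail_average_cvg => //; apply: cvg_near_cst.
  apply: filterS (cvgr_lt _ Dcvg 0 Dneg) => k Dk.
  by rewrite w_E ltr0_sg.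
- by have := w1 x y s; rewrite ler_norml.
Qed.

End evolution.

(** * Smooth step functions *)

Section smooth_step.
Context {R : realType}.
Implicit Types (f g : R -> R) (p : {poly R}).

(** Repeated differentiability with the successive derivatives given as witnesses: closure under
    sums, products, inverses and affine changes follows by induction on [n], without formulas for
    higher derivatives. *)
Fixpoint Ck n f : Prop :=
  if n is m.+1 then exists f', (forall t : R, is_derive t 1 f (f' t)) /\ Ck m f'
  else True.

Lemma CkW n f : Ck n.+1 f -> Ck n f.
Proof.
elim: n f => [//|n IH] f [f' [df Cf']].
by exists f'; split => //; exact: IH.
Qed.

Lemma derive1_is_derive f f' : (forall t : R, is_derive t 1 f (f' t)) -> f^`()%classic = f'.
Proof.
by move=> df; apply/funext => t; rewrite derive1E; exact: (@derive_val _ _ _ _ _ _ _ (df t)).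
Qed.

Lemma derivable_derive1n_Ck n f t : Ck n.+1 f -> derivable (derive1n n f) t 1.
Proof.
elim: n f => [|n IH] f [f' [df Cf']].
  by rewrite derive1n0; exact: (@ex_derive _ _ _ _ _ _ _ (df t)).
by rewrite derive1Sn (derive1_is_derive df); exact: IH.
Qed.

Lemma CkD n f g : Ck n f -> Ck n g -> Ck n (fun t => f t + g t).
Proof.
elim: n f g => [//|n IH] f g [f' [df Cf']] [g' [dg Cg']].
exists (fun t => f' t + g' t); split; last exact: IH.
by move=> t; exact: is_deriveD (df t) (dg t).
Qed.

Lemma CkM n f g : Ck n f -> Ck n g -> Ck n (fun t => f t * g t).
Proof.
elim: n f g => [//|n IH] f g Cf Cg.
move: (CkW Cf) (CkW Cg) => Cf0 Cg0.
case: Cf => [f' [df Cf']]; case: Cg => [g' [dg Cg']].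
exists (fun t => f t * g' t + g t * f' t); split.
  by move=> t; exact: is_deriveM (df t) (dg t).
by apply: CkD; exact: IH.
Qed.

Lemma CkC n (c : R) : Ck n (fun=> c).
Proof.
elim: n c => [//|n IH] c; exists (fun=> 0); split; last exact: IH.
by move=> t; exact: is_derive_cst.
Qed.

Lemma CkV n f : (forall t, f t != 0) -> Ck n f -> Ck n (fun t => (f t)^-1).
Proof.
move=> f0; elim: n f f0 => [//|n IH] f f0 Cf; move: (CkW Cf) => Cf0.
case: Cf => [f' [df Cf']].
exists (fun t => - 1 * ((f t)^-1 * (f t)^-1) * f' t); split.
  move=> t; apply: (@is_derive_eq _ _ _ _ _ _ _ _ (is_deriveV (f0 t) (df t))).
  by rewrite /GRing.scale/= expr2 invfM mulN1r.
apply: CkM => //; apply: CkM; first exact: CkC.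
by apply: CkM; exact: IH.
Qed.

Lemma is_derive_affine f f' (c a t : R) : (forall t : R, is_derive t 1 f (f' t)) ->
  is_derive t 1 (fun t => f (c * (t - a))) (f' (c * (t - a)) * c).
Proof.
move=> df; have d1 : is_derive t 1 (fun t : R => t - a) (1 - 0).
  exact: is_deriveB.
have d2 : is_derive t 1 (fun t : R => c * (t - a)) c.
  apply: (@is_derive_eq _ _ _ _ _ _ _ _ (is_deriveZ c d1)).
  by rewrite subr0 /GRing.scale/= mulr1.
exact: (@is_derive1_comp _ f (fun t => c * (t - a)) t _ _ (df _) d2).
Qed.

Lemma Ck_affine n f (c a : R) : Ck n f -> Ck n (fun t => f (c * (t - a))).
Proof.
elim: n f => [//|n IH] f [f' [df Cf']].
exists (fun t => f' (c * (t - a)) * c); split.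
  by move=> t; exact: is_derive_affine.
by apply: CkM; [exact: IH|exact: CkC].
Qed.

(** The functions [p(1/t) exp(-1/t)], extended by 0, form a family stable under differentiation,
    with [p] becoming [X^2 (p - p')]. One differentiability statement for all [p] therefore yields
    all derivatives of [exp(-1/t)]. *)
Definition flat p (t : R) : R := if 0 < t then p.[t^-1] * expR (- t^-1) else 0.

Lemma flat_le0 p t : t <= 0 -> flat p t = 0.
Proof. by move=> t0; rewrite /flat ltNge t0. Qed.

Lemma horner_norm_le p (y : R) : 1 <= y ->
  `|p.[y]| <= (\sum_(i < size p) `|p`_i|) * y ^+ (size p).
Proof.
move=> y1; have y0 : 0 <= y by exact: le_trans y1.
rewrite horner_coef (le_trans (ler_norm_sum _ _ _))// mulr_suml.
apply: ler_sum => i _; rewrite normrM ler_wpM2l// normrX ger0_norm//.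
by apply: ler_weXn2l => //; exact: ltnW.
Qed.

(** Quadratic decay at 0 is what makes the derivative there exist and vanish. *)
Lemma flat_quadratic p : exists C, forall h, `|h| <= 1 -> `|flat p h| <= C * h ^+ 2.
Proof.
pose S := \sum_(i < size p) `|p`_i|; pose n := size p.
have S0 : 0 <= S by exact: sumr_ge0.
pose F : R := (n.+2)`!%:R.
have F0 : 0 < F by rewrite ltr0n fact_gt0.
exists (S * F) => h h1; rewrite /flat; case: ifPn => [h0|_]; last first.
  by rewrite normr0 mulr_ge0 ?sqr_ge0// mulr_ge0// ltW.
pose y := h^-1.
have y1 : 1 <= y by rewrite invf_ge1//; move: h1; rewrite gtr0_norm.
have y0 : 0 < y by exact: lt_le_trans y1.
rewrite normrM (ger0_norm (expR_ge0 _)) -/y.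
(* This comes from [y^(n+2) / (n+2)! <= exp y]. Of the [n + 2] powers of [y = 1/h], [n] absorb the
   polynomial and two remain as [h^2]. *)
have e1 : expR (- y) <= F * y^-1 ^+ n.+2.
  have P0 : 0 < F * y^-1 ^+ n.+2 by apply: mulr_gt0 => //; rewrite exprn_gt0// invr_gt0.
  rewrite expRN -(invrK (F * _)) lef_pV2 ?posrE ?expR_gt0 ?invr_gt0//.
  apply: le_trans (expR_ge1Dxn n.+1 (ltW y0)).
  by rewrite invfM exprVn invrK mulrC lerDr.
apply: le_trans (ler_pM (normr_ge0 _) (expR_ge0 _) (horner_norm_le p y1) e1) _.
rewrite -/S -/n (_ : h = y^-1); last by rewrite /y invrK.
rewrite le_eqVlt; apply/orP; left; apply/eqP.
rewrite -addn2 exprD -/n.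
have -> : S * y ^+ n * (F * (y^-1 ^+ n * y^-1 ^+ 2)) =
    S * F * y^-1 ^+ 2 * (y ^+ n * y^-1 ^+ n) by ring.
by rewrite -exprMn mulfV ?expr1n ?mulr1// gt_eqF.
Qed.

Lemma is_derive_quadratic0 f (C : R) : f 0 = 0 ->
  (forall h, `|h| <= 1 -> `|f h| <= C * h ^+ 2) -> is_derive (0 : R) 1 f 0.
Proof.
move=> f0 fC.
have H : h^-1 *: (f (h *: (1 : R) + 0) - f 0) @[h --> (0 : R)^'] --> (0 : R).
  apply/cvgrPdist_le => e e0.
  have C0 : 0 < `|C| + 1 by rewrite ltr_pwDr.
  near=> h.
  have h0 : h != 0 by near: h; exact: nbhs_dnbhs_neq.
  have h1 : `|h| <= 1 by near: h; exact: dnbhs0_le.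
  have h2 : `|h| <= e / (`|C| + 1) by near: h; apply: dnbhs0_le; rewrite divr_gt0.
  rewrite sub0r normrN f0 subr0 addr0 /GRing.scale/= mulr1 normrM normfV.
  have nh : 0 < `|h| by rewrite normr_gt0.
  rewrite mulrC ler_pdivrMr//; apply: le_trans (fC h h1) _.
  rewrite -(real_normK (num_real h)) expr2 mulrA ler_wpM2r//.
  rewrite ler_pdivlMr// in h2; apply: le_trans h2; rewrite mulrC ler_wpM2l//.
  by rewrite (le_trans (ler_norm C))// lerDl.
apply: DeriveDef; first by apply/cvg_ex; exists 0.
exact: (cvg_lim _ H).
Unshelve. all: by end_near.
Qed.

Lemma is_derive_flat p (t : R) : is_derive t 1 (flat p) (flat ('X^2 * (p - p^`())) t).
Proof.
have [t0|t0|->] := ltgtP t 0.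
- rewrite (flat_le0 _ (ltW t0)).
  apply: (near_eq_is_derive _ (is_derive_cst (0 : R) t 1)).
  have : nbhs t `]-oo, 0[%classic by apply: open_nbhs_nbhs; split => //=; rewrite in_itv.
  by apply: filterS => s /=; rewrite in_itv/= => s0; rewrite flat_le0// ltW.
- have tn0 : t != 0 by rewrite gt_eqF.
  have dinv : is_derive t 1 (fun t : R => t^-1) (- (t ^- 2)).
    apply: (@is_derive_eq _ _ _ _ _ _ _ _ (is_deriveV (f := id) tn0 (is_derive_id _ _))).
    by rewrite /GRing.scale/= mulr1.
  have dp := is_derive1_comp (is_derive_poly p t^-1) dinv.
  have dNinv : is_derive t 1 (fun t : R => - t^-1) (t ^- 2).
    by apply: (@is_derive_eq _ _ _ _ _ _ _ _ (is_deriveN dinv)); rewrite opprK.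
  have de := @is_derive1_comp _ expR (fun t => - t^-1) t _ _ (is_derive_expR _) dNinv.
  have dM := is_deriveM dp de.
  apply: (@near_eq_is_derive _ _ _ (fun t : R => p.[t^-1] * expR (- t^-1))).
    have : nbhs t `]0, +oo[%classic.
      by apply: open_nbhs_nbhs; split => //=; rewrite in_itv/= t0.
    by apply: filterS => s /=; rewrite in_itv/= andbT /flat => ->.
  apply: (@is_derive_eq _ _ _ _ _ _ _ _ dM).
  rewrite /flat t0 /GRing.scale/= hornerM hornerXn hornerD hornerN exprVn.
  by ring.
- rewrite (flat_le0 _ (lexx 0)); have [C pC] := flat_quadratic p.
  by apply: (is_derive_quadratic0 (C := C)) => //; rewrite flat_le0.
Qed.

Lemma Ck_flat n p : Ck n (flat p).
Proof.
elim: n p => [//|n IH] p; exists (flat ('X^2 * (p - p^`()))); split; last exact: IH.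
exact: is_derive_flat.
Qed.

(** The second summand is [flat 1 (1 - t)] in the form [c * (t - a)] expected by [Ck_affine]. The
    denominator never vanishes because [t] and [1 - t] cannot both be nonpositive. *)
Definition step_denom (t : R) : R := flat 1 t + flat 1 (-1 * (t - 1)).
Definition smooth_step (t : R) : R := flat 1 t * (step_denom t)^-1.

Lemma flat1_ge0 t : 0 <= flat 1 t.
Proof. by rewrite /flat; case: ifP => // _; rewrite hornerC mul1r expR_ge0. Qed.

Lemma flat1_gt0 t : 0 < t -> 0 < flat 1 t.
Proof. by move=> t0; rewrite /flat t0 hornerC mul1r expR_gt0. Qed.

Lemma step_denom_neq0 t : step_denom t != 0.
Proof.
rewrite gt_eqF// /step_denom; have [t0|t0] := ltP 0 t.
  by rewrite ltr_pwDl ?flat1_gt0 ?flat1_ge0.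
by rewrite ltr_wpDl ?flat1_ge0// flat1_gt0//; move: t0; lra.
Qed.

Lemma Ck_smooth_step n : Ck n smooth_step.
Proof.
apply: CkM; first exact: Ck_flat.
apply: CkV; first exact: step_denom_neq0.
by apply: CkD; [exact: Ck_flat|apply: Ck_affine; exact: Ck_flat].
Qed.

Lemma smooth_step_le0 t : t <= 0 -> smooth_step t = 0.
Proof. by move=> t0; rewrite /smooth_step flat_le0// mul0r. Qed.

Lemma smooth_step_ge1 t : 1 <= t -> smooth_step t = 1.
Proof.
move=> t1; rewrite /smooth_step /step_denom (@flat_le0 _ (-1 * _)); last by move: t1; lra.
by rewrite addr0 mulfV// gt_eqF// flat1_gt0//; move: t1; lra.
Qed.

Lemma is_derive_smooth_step (t : R) : is_derive t 1 smooth_step (smooth_step^`()%classic t).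
Proof.
have [f' [df _]] := Ck_smooth_step 1; rewrite (derive1_is_derive df); exact: df.
Qed.

Lemma continuous_derive1_smooth_step : continuous (smooth_step^`()%classic : R -> R).
Proof.
move=> t; have [f' [df [f'' [df' _]]]] := Ck_smooth_step 2.
rewrite (derive1_is_derive df); apply: differentiable_continuous.
exact/derivable1_diffP/(@ex_derive _ _ _ _ _ _ _ (df' t)).
Qed.

Lemma derive1_locally_cst f (c t : R) : (\forall s \near t, f s = c) -> f^`()%classic t = 0.
Proof.
move=> fc; have : is_derive t 1 f 0.
  apply: (near_eq_is_derive _ (is_derive_cst c t 1)).
  by apply: filterS fc => s ->.
by rewrite derive1E => df; exact: (@derive_val _ _ _ _ _ _ _ df).
Qed.

Lemma derive1_smooth_step_out t : t < 0 \/ 1 < t -> smooth_step^`()%classic t = 0.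
Proof.
move=> [t0|t1].
  apply: (@derive1_locally_cst _ 0).
  have : nbhs t `]-oo, 0[%classic by apply: open_nbhs_nbhs; split => //=; rewrite in_itv.
  by apply: filterS => s /=; rewrite in_itv/= => s0; rewrite smooth_step_le0// ltW.
apply: (@derive1_locally_cst _ 1).
have : nbhs t `]1, +oo[%classic.
  by apply: open_nbhs_nbhs; split => //=; rewrite in_itv/= t1.
by apply: filterS => s /=; rewrite in_itv/= andbT => s0; rewrite smooth_step_ge1// ltW.
Qed.

Lemma derive1_smooth_step_bounded :
  exists2 C, 0 <= C & forall t, `|smooth_step^`()%classic t| <= C.
Proof.
have cn : {within `[0, 1 : R], continuous (fun t => `|smooth_step^`()%classic t|)}.
  apply: continuous_subspaceT => t.
  by apply: cvg_norm; exact: continuous_derive1_smooth_step.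
have [c _ cmax] := EVT_max ler01 cn.
exists (`|smooth_step^`()%classic c|); first exact: normr_ge0.
move=> t.
have [t0|t0] := ltP t 0; first by rewrite derive1_smooth_step_out ?normr0//; left.
have [t1|t1] := ltP 1 t; first by rewrite derive1_smooth_step_out ?normr0//; right.
by apply: cmax; rewrite in_itv/= t0.
Qed.

End smooth_step.

(** * Weak derivatives in time *)

Section restricted_measure.
Context (d : measure_display) (T : measurableType d) (R : realType).
Variables (m : {measure set T -> \bar R}) (D : set T) (mD : measurable D).

Lemma integral_mrestr_patch (f : T -> \bar R) :
  (\int[mrestr m mD]_x (f \_ D) x = \int[m]_(x in D) f x)%E.
Proof.
rewrite -integral_mkcond; apply: eq_measure_integral => A mA AD.
by rewrite -[LHS]/(m (A `&` D)) setIidl.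
Qed.

Lemma mrestr_ae (P : T -> Prop) : {ae mrestr m mD, forall x, P x} <->
  {ae m, forall x, D x -> P x}.
Proof.
split=> [[N [mN N0 PN]]|[N [mN N0 PN]]].
- exists (N `&` D); split; [exact: measurableI|exact: N0|].
  by move=> x /= /not_implyP[Dx nPx]; split => //; exact: PN.
- exists (N `|` ~` D); split.
  + by apply: measurableU => //; exact: measurableC.
  + rewrite /mrestr setIUl setICl setU0.
    by apply: (subset_measure0 _ mN _ N0); [exact: measurableI|move=> x []].
  + move=> x /= nPx; have [Dx|nDx] := pselect (D x); [left|by right].
    by apply: PN => /= /(_ Dx).
Qed.

Lemma mrestr_supp : {ae mrestr m mD, forall x, D x}.
Proof. by apply/mrestr_ae; exact: aeW. Qed.

Lemma integral_mrestr (f : T -> \bar R) : measurable_fun setT f ->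
  (\int[mrestr m mD]_x f x = \int[m]_(x in D) f x)%E.
Proof.
move=> mf; rewrite -integral_mrestr_patch; apply: ae_eq_integral => //.
  by apply/(measurable_restrictT _ mD); exact: measurable_funTS.
by apply: ae_imply mrestr_supp => x Dx _; rewrite patchE mem_set.
Qed.

Lemma integrable_mrestr_patch (f : T -> R) :
  m.-integrable D (EFin \o f) <-> (mrestr m mD).-integrable setT (EFin \o (f \_ D)).
Proof.
have patchE' : EFin \o (f \_ D) = (EFin \o f) \_ D.
  by apply/funext => x; rewrite /= !patchE; case: ifP.
split=> /integrableP[mf ioo]; apply/integrableP.
- split; first by rewrite patchE'; apply/(measurable_restrictT _ mD).
  move: ioo; rewrite -(integral_mrestr_patch (fun x => `|(f x)%:E|)%E).
  rewrite (_ : _ \_ D = fun x => `|(EFin \o (f \_ D)) x|%E)//.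
  by apply/funext => x; rewrite /= !patchE; case: ifP => //; rewrite normr0.
- move: mf; rewrite patchE' => /(measurable_restrictT _ mD) mf; split => //.
  rewrite -integral_mrestr_patch.
  rewrite (_ : _ \_ D = fun x => `|(EFin \o (f \_ D)) x|%E)//.
  by apply/funext => x; rewrite /= !patchE; case: ifP => //; rewrite normr0.
Qed.

End restricted_measure.

(** * Lebesgue measure on the time interval and weakly constant functions *)

Section time_measure.
Context {R : realType} (T : R).
Local Notation RT := (measurableTypeR R).

Lemma measurable_I0T : measurable (I0T T : set RT).
Proof. exact: measurable_itv. Qed.

Definition time_measure : set RT -> \bar R :=
  mrestr (@lebesgue_measure R) measurable_I0T.

HB.instance Definition _ := Measure.on time_measure.

Let time_measure_fin : fin_num_fun time_measure.
Proof.
apply: lty_fin_num_fun.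
rewrite -[X in (X < _)%E]/(@lebesgue_measure R (setT `&` I0T T)) setTI.
rewrite /I0T lebesgue_measure_itv/=.
by case: ifP => _; rewrite ltry.
Qed.

HB.instance Definition _ := Measure_isFinite.Build _ _ _ time_measure time_measure_fin.

Lemma time_measure_set1 (t : R) : time_measure [set t] = 0%E.
Proof.
rewrite -[LHS]/(@lebesgue_measure R ([set t] `&` I0T T)).
apply/eqP; rewrite -measure_le0 -(lebesgue_measure_set1 t).
apply: le_measure; rewrite ?inE; [|exact: measurable_set1|by move=> s []].
by apply: measurableI; [exact: measurable_set1|exact: measurable_I0T].
Qed.

Lemma time_measure_itv (a b : R) : a <= b ->
  (time_measure `[a, b]%classic <= (b - a)%:E)%E.
Proof.
move=> ab; apply: (@le_trans _ _ (@lebesgue_measure R `[a, b]%classic)).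
  apply: le_measure; rewrite ?inE//.
  by apply: measurableI => //; exact: measurable_I0T.
by rewrite lebesgue_measure_itv/= lte_fin; case: ltgtP ab => // ->; rewrite subrr.
Qed.

Lemma time_measure_supp : {ae time_measure, forall s, 0 < s < T}.
Proof.
by apply: ae_imply (mrestr_supp _ measurable_I0T) => s; rewrite /I0T/= in_itv.
Qed.

(** This is the shape of the inner integral that Fubini leaves when a primitive is paired with a
    derivative; [s = 0] covers the whole interval. *)
Lemma time_FTC (F : R -> R) (s : R) : 0 <= s -> s < T ->
  (forall t : R, derivable F t 1) -> continuous (F^`()%classic : R -> R) ->
  \int[time_measure]_t ((s < t)%R%:R * F^`()%classic t) = F T - F s.
Proof.
move=> s0 sT dF cF.
have mF : measurable_fun setT (F^`()%classic : RT -> R) by exact: continuous_measurable_fun.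
have cF0 : continuous F.
  by move=> t; apply: differentiable_continuous; exact/derivable1_diffP.
rewrite /Rintegral integral_mrestr; last first.
  by apply/measurable_EFinP; apply: measurable_funM => //; exact: measurable_ltb.
have -> : (\int[@lebesgue_measure R]_(t in I0T T) ((s < t)%R%:R * F^`()%classic t)%:E =
    \int[@lebesgue_measure R]_(t in `]s, T[) (F^`()%classic t)%:E)%E.
  rewrite [LHS]integral_mkcond [RHS]integral_mkcond; apply: eq_integral => t _.
  rewrite !patchE; case: (boolP (t \in `]s, T[%classic)); rewrite ?inE ?notin_setE /= in_itv/=.
    move=> /andP[st tT]; rewrite mem_set ?st ?mul1r// /I0T/= in_itv/= tT andbT.
    exact: le_lt_trans st.
  move=> nst; case: ifPn => //; rewrite inE /I0T/= in_itv/= => /andP[_ tT].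
  by case: (ltP s t) nst => [st|st _]; rewrite ?mul0r// st tT.
rewrite -(integral_itv_bndoo true false); last first.
  by apply/measurable_EFinP; exact: measurable_funTS.
have cw : {within `[s, T], continuous (F^`()%classic : R -> R)}.
  exact: continuous_subspaceT.
have dw : derivable_oo_LRcontinuous F s T.
  split; first by move=> t _; exact: dF.
    exact/cvg_at_right_filter/cF0.
  exact/cvg_at_left_filter/cF0.
by rewrite (continuous_FTC2 sT cw dw (fun t _ => erefl)).
Qed.

Lemma test_fun_derivable (phi : R -> R) : test_fun T phi ->
  (forall t : R, derivable phi t 1) /\ continuous (phi^`()%classic : R -> R).
Proof.
move=> [dphi _]; split=> t; first by have := dphi 0%N t; rewrite derive1n0.
apply: differentiable_continuous; apply/derivable1_diffP.
by have := dphi 1%N t; rewrite derive1n1.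
Qed.

Lemma test_fun_bounded (phi : R -> R) : test_fun T phi ->
  exists C, (forall t, `|phi t| <= C) /\ (forall t, `|phi^`()%classic t| <= C).
Proof.
move=> tphi; have [dphi cdphi] := test_fun_derivable tphi.
have [_ [a [b [_ ab _ phi0]]]] := tphi.
have cphi : continuous phi.
  by move=> t; apply: differentiable_continuous; exact/derivable1_diffP.
have bound (f : R -> R) : continuous f -> (forall t, t < a \/ b < t -> f t = 0) ->
    exists C, forall t, `|f t| <= C.
  move=> cf f0; have cn : {within `[a, b], continuous (fun t => `|f t|)}.
    by apply: continuous_subspaceT => t; apply: cvg_norm; exact: cf.
  have [c _ cmax] := EVT_max ab cn; exists `|f c| => t.
  have [ta|ta] := ltP t a; first by rewrite f0 ?normr0 ?normr_ge0//; left.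
  have [tb|tb] := ltP b t; first by rewrite f0 ?normr0 ?normr_ge0//; right.
  by apply: cmax; rewrite in_itv/= ta.
have [C1 C1b] := bound phi cphi phi0.
have [C2 C2b] : exists C, forall t, `|phi^`()%classic t| <= C.
  apply: bound => // t [ta|bt]; apply: (@derive1_locally_cst _ _ 0).
    have : nbhs t `]-oo, a[%classic by apply: open_nbhs_nbhs; split => //=; rewrite in_itv.
    by apply: filterS => s /=; rewrite in_itv/= => sa; apply: phi0; left.
  have : nbhs t `]b, +oo[%classic.
    by apply: open_nbhs_nbhs; split => //=; rewrite in_itv/= bt.
  by apply: filterS => s /=; rewrite in_itv/= andbT => sb; apply: phi0; right.
exists (Num.max C1 C2); split => t; rewrite le_max.
  by rewrite C1b.
by rewrite C2b orbT.
Qed.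

(** Fubini instead of almost everywhere differentiation: the inner integral of [phi'] over [t > s]
    is [phi T - phi s], and test functions vanish at [T]. *)
Lemma primitive_by_parts (q phi : R -> R) : test_fun T phi ->
  time_measure.-integrable setT (EFin \o q) ->
  \int[time_measure]_t (primitive time_measure q t * phi^`()%classic t) =
  - \int[time_measure]_t (q t * phi t).
Proof.
move=> tphi iq; have [dphi cdphi] := test_fun_derivable tphi.
have [C [Cphi Cdphi]] := test_fun_bounded tphi.
have mq : measurable_fun setT (q : RT -> R).
  by apply/measurable_EFinP; exact: measurable_int iq.
have mdphi : measurable_fun setT (phi^`()%classic : RT -> R).
  exact: continuous_measurable_fun.
have cphi : continuous phi.
  by move=> t; apply: differentiable_continuous; exact/derivable1_diffP.
have mphi : measurable_fun setT (phi : RT -> R) by exact: continuous_measurable_fun.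
pose h (t s : RT) := q s * (s < t)%R%:R * phi^`()%classic t.
have tauoo : (time_measure setT < +oo)%E by exact: finite_measure_lty.
have mh : measurable_fun setT (fun z : RT * RT => h z.1 z.2).
  apply: measurable_funM; last exact: measurableT_comp.
  by apply: measurable_funM; [exact: measurableT_comp|exact: measurable_ltb].
have ih : (time_measure \x time_measure)%E.-integrable setT
    (fun z : RT * RT => (h z.1 z.2)%:E).
  have iCq := integrableZl measurableT C iq.
  apply: (le_integrable measurableT _ _ (integrable_snd (f := fun s : RT => C * q s) tauoo iCq)).
    exact/measurable_EFinP.
  move=> z _ /=; rewrite lee_fin /h !normrM normr_nat mulrAC mulrC.
  rewrite (le_trans (_ : _ <= `|phi^`()%classic z.1| * `|q z.2|))//.
    by rewrite [leRHS]mulrC ler_piMl ?mulr_ge0//; case: (_ < _)%R.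
  by rewrite ler_wpM2r// (le_trans (Cdphi _))// ler_norm.
have -> : \int[time_measure]_t (primitive time_measure q t * phi^`()%classic t) =
    \int[time_measure]_t \int[time_measure]_s h t s.
  apply: eq_Rintegral => t _; rewrite -RintegralZr//; exact: integrable_primitive.
rewrite (Rintegral12 ih) -(Rintegral21 ih) -[RHS]mulN1r -RintegralZl//; last first.
  have iCq := integrableZl measurableT C iq.
  apply: (le_integrable measurableT _ _ iCq).
    by apply/measurable_EFinP; exact: measurable_funM.
  move=> t _ /=; rewrite lee_fin !normrM mulrC ler_wpM2r//.
  by rewrite (le_trans (Cphi _))// ler_norm.
apply: ae_eq_Rintegral.
- exact: measurable_Rintegral_fst mh.
- by apply: measurable_funM => //; exact: measurable_funM.
apply: ae_imply time_measure_supp => s /andP[s0 sT].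
have -> : \int[time_measure]_t h t s =
    \int[time_measure]_t (q s * ((s < t)%R%:R * phi^`()%classic t)).
  by apply: eq_Rintegral => t _; rewrite /h mulrA.
rewrite RintegralZl//; last first.
  apply: (@bounded_integrable _ _ _ _ _ C) => //.
    by apply: measurable_funM => //; exact: measurable_ltb.
  move=> t; apply: le_trans (Cdphi t).
  by rewrite normrM normr_nat; case: (_ < _)%R; rewrite ?mul1r ?mul0r.
rewrite time_FTC// ?(ltW s0)//.
have [_ [a [b [_ _ bT phi0]]]] := tphi.
by rewrite (phi0 T) ?sub0r ?mulrN ?mulN1r//; right.
Qed.

(** The derivative of the step rescaled to [[c, c + e]], of integral 1 when this interval lies
    inside []0, T[]. Its sign is not studied, hence the constant [C] rather than 1 in the bounds on
    its absolute value. The derivative of [smooth_plateau] is the difference of two such bumps. *)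
Definition mollifier (e c t : R) : R := (smooth_step^`()%classic (e^-1 * (t - c))) * e^-1.
Definition smooth_plateau (e a b t : R) : R :=
  smooth_step (e^-1 * (t - a)) - smooth_step (e^-1 * (t - b)).

Lemma derive1_smooth_plateau e a b :
  (smooth_plateau e a b)^`()%classic = (fun t => mollifier e a t - mollifier e b t).
Proof.
apply: derive1_is_derive => t.
by apply: is_deriveB; apply: is_derive_affine => s; exact: is_derive_smooth_step.
Qed.

Lemma test_smooth_plateau e a b : 0 < e -> 0 < a -> a < b -> b + e < T ->
  test_fun T (smooth_plateau e a b).
Proof.
move=> e0 a0 ab beT; split.
  move=> n t; apply: derivable_derive1n_Ck.
  have -> : smooth_plateau e a b = (fun t => smooth_step (e^-1 * (t - a)) +
      (fun=> -1) t * smooth_step (e^-1 * (t - b))).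
    by apply/funext => s; rewrite /smooth_plateau mulN1r.
  apply: CkD; first by apply: Ck_affine; exact: Ck_smooth_step.
  by apply: CkM; [exact: CkC|apply: Ck_affine; exact: Ck_smooth_step].
exists a, (b + e); split => //; first by move: ab e0; lra.
move=> t [ta|bt]; rewrite /smooth_plateau.
  rewrite !smooth_step_le0 ?subrr// pmulr_rle0 ?invr_gt0// subr_le0; last exact: ltW.
  by apply/ltW; exact: lt_trans ab.
by rewrite !smooth_step_ge1 ?subrr// mulrC ler_pdivlMr// mul1r; move: bt ab e0; lra.
Qed.

Lemma measurable_mollifier e c : measurable_fun setT (mollifier e c : RT -> R).
Proof.
apply: measurable_funM => //; apply: measurableT_comp.
  by apply: continuous_measurable_fun; exact: continuous_derive1_smooth_step.
by apply: measurable_funM => //; exact: measurable_funB.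
Qed.

Lemma mollifier_bounded : exists2 C, 0 <= C & forall e c t, 0 < e ->
  `|mollifier e c t| <= C / e * (c <= t <= c + e)%R%:R.
Proof.
have [C C0 Cb] := @derive1_smooth_step_bounded R.
exists C => // e c t e0; have ie : 0 < e^-1 by rewrite invr_gt0.
rewrite /mollifier normrM (gtr0_norm ie).
have RHS0 : 0 <= C / e * (c <= t <= c + e)%R%:R.
  by apply: mulr_ge0 => //; rewrite divr_ge0// ltW.
have [tc|] := boolP (t < c); last rewrite -leNgt => ct.
  rewrite derive1_smooth_step_out ?normr0 ?mul0r//; left.
  by rewrite pmulr_rlt0 ?invr_gt0// subr_lt0.
have [cet|] := boolP (c + e < t); last rewrite -leNgt => tce.
  rewrite derive1_smooth_step_out ?normr0 ?mul0r//; right.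
  by rewrite mulrC ltr_pdivlMr// mul1r; move: cet; lra.
by rewrite ct tce mulr1 ler_wpM2r// ltW.
Qed.

Lemma Rintegral_mollifier e c : 0 < e -> 0 < c -> c + e < T ->
  \int[time_measure]_t mollifier e c t = 1.
Proof.
move=> e0 c0 ceT.
have dF (t : R) : is_derive t 1 (fun t => smooth_step (e^-1 * (t - c))) (mollifier e c t).
  by apply: is_derive_affine => s; exact: is_derive_smooth_step.
have T0 : 0 < T by move: e0 c0 ceT; lra.
have F'E := derive1_is_derive dF.
have cF' : continuous ((fun t => smooth_step (e^-1 * (t - c)))^`()%classic : R -> R).
  rewrite F'E => t; apply: cvgM; last exact: cvg_cst.
  apply: (@continuous_comp _ _ _ (fun t => e^-1 * (t - c)) (smooth_step^`()%classic)).
    by apply: cvgM; [exact: cvg_cst|apply: cvgB; [exact: cvg_id|exact: cvg_cst]].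
  exact: continuous_derive1_smooth_step.
have := @time_FTC (fun t => smooth_step (e^-1 * (t - c))) 0 (lexx 0) T0
  (fun t => @ex_derive _ _ _ _ _ _ _ (dF t)) cF'.
rewrite F'E smooth_step_ge1; last first.
  by rewrite mulrC ler_pdivlMr// mul1r; move: ceT; lra.
rewrite smooth_step_le0 ?subr0 => [<-|]; last first.
  by rewrite pmulr_rle0 ?invr_gt0//; move: c0; lra.
apply: ae_eq_Rintegral; [exact: measurable_mollifier| |].
  apply: measurable_funM; first exact: measurable_ltb.
  exact: measurable_mollifier.
by apply: ae_imply time_measure_supp => t /andP[t0 _]; rewrite t0 mul1r.
Qed.

Section weakly_constant.
Context (d : measure_display) (X : measurableType d)
  (mu : {finite_measure set X -> \bar R}) (E : X -> R -> R).
Hypothesis iE : (mu \x time_measure)%E.-integrable setT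
  (fun z : X * RT => (E z.1 z.2)%:E).
Hypothesis iEt : forall t, 0 < t < T -> mu.-integrable setT (fun x => (E x t)%:E).
Hypothesis cE : forall t0, 0 < t0 < T -> forall e, 0 < e -> exists2 del, 0 < del &
  forall t, 0 < t < T -> `|t - t0| < del -> \int[mu]_x `|E x t0 - E x t| <= e.
Hypothesis wE : forall phi, test_fun T phi ->
  {ae mu, forall x, \int[time_measure]_t (E x t * phi^`()%classic t) = 0}.

Let mE : measurable_fun setT (fun z : X * RT => E z.1 z.2).
Proof. by apply/measurable_EFinP; exact: measurable_int iE. Qed.

Let tauoo : (time_measure setT < +oo)%E. Proof. exact: finite_measure_lty. Qed.

Let integrable_diff a : 0 < a < T -> (mu \x time_measure)%E.-integrable setT
  (fun z : X * RT => (E z.1 a - E z.1 z.2)%:E).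
Proof.
move=> aT; have i1 := integrable_fst (f := fun x => E x a) tauoo (iEt aT).
by apply: eq_integrable (integrableB measurableT i1 iE) => // z _.
Qed.

Let integrable_mollified eps a C : 0 < a < T -> (forall t, `|mollifier eps a t| <= C) ->
  (mu \x time_measure)%E.-integrable setT
  (fun z : X * RT => (`|mollifier eps a z.2| * `|E z.1 a - E z.1 z.2|)%:E).
Proof.
move=> aT mC; have iC := integrableZl measurableT C (integrable_diff aT).
apply: (le_integrable measurableT _ _ iC).
  apply/measurable_EFinP; apply: measurable_funM.
    do 2 apply: measurableT_comp => //; exact: measurable_mollifier.
  apply: measurableT_comp => //; apply/measurable_EFinP.
  exact: measurable_int (integrable_diff aT).
move=> z _ /=; rewrite lee_fin (normrM `|_|) !normr_id (normrM C) ler_wpM2r//.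
by rewrite (le_trans (mC _))// ler_norm.
Qed.

(** The du Bois-Reymond argument. A plateau as test function says that the means of [E] against the
    bumps at [a] and at [b] coincide, and continuity brings these means close to [E a] and [E b].
    The estimate is integrated over [x], where continuity is available; the exceptional set of [wE]
    depends on the test function, but each precision uses only one. *)
Lemma weakly_constant a b : 0 < a -> a < b -> b < T ->
  {ae mu, forall x, E x a = E x b}.
Proof.
move=> a0 ab bT.
have b0 : 0 < b by exact: lt_trans ab.
have aT : a < T by exact: lt_trans ab bT.
have [C C0 Cb] := mollifier_bounded.
have aI : 0 < a < T by rewrite a0.
have bI : 0 < b < T by rewrite b0.
have iab : mu.-integrable setT (EFin \o (fun x => E x a - E x b)).
  exact: (integrableB measurableT (iEt aI) (iEt bI)).
suff : \int[mu]_x `|E x a - E x b| <= 0.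
  move/(Rintegral_norm_eq0 iab); apply: ae_imply => x /eqP.
  by rewrite subr_eq0 => /eqP.
apply/ler_addgt0Pr => e' e'0; rewrite add0r.
(* Each end contributes at most [C * e], and [2 C e <= e']; the [+ 1] avoids a division by zero when
   [C = 0]. *)
pose e := e' / (2 * (C + 1)).
have C1 : 0 < C + 1 by rewrite ltr_wpDl.
have e0 : 0 < e by rewrite divr_gt0// mulr_gt0.
have [da da0 dae] := cE aI e0; have [db db0 dbe] := cE bI e0.
have [eps [eps0 epsa epsb epsT]] :
    exists eps : R, [/\ 0 < eps, eps < da, eps < db & b + eps < T].
  have min0 : 0 < Num.min (Num.min da db) (T - b) by rewrite !lt_min da0 db0 subr_gt0.
  exists (Num.min (Num.min da db) (T - b) / 2).
  have : Num.min (Num.min da db) (T - b) / 2 < Num.min (Num.min da db) (T - b).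
    by rewrite ltr_pdivrMr//; move: min0; lra.
  rewrite !lt_min.
  by move=> /andP[/andP[-> ->] h]; split => //; [rewrite divr_gt0|move: h; lra].
have mC c t : `|mollifier eps c t| <= C / eps.
  rewrite (le_trans (Cb _ c t eps0))// ler_piMr//; first by rewrite divr_ge0// ltW.
  by case: (_ <= _ <= _)%R.
have L1m c : \int[time_measure]_t `|mollifier eps c t| <= C.
  have ib : time_measure.-integrable setT
      (EFin \o (fun t : RT => (c <= t <= c + eps)%R%:R : R)).
    apply: (@bounded_integrable _ _ _ _ _ 1) => //.
      rewrite (_ : (fun t => _) = \1_(`[c, c + eps]%classic)).
        exact: measurable_indic.
      by apply/funext => t; rewrite indicE mem_setE in_itv.
    by move=> t; rewrite normr_nat; case: (_ <= _ <= _)%R.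
  apply: (@le_trans _ _ (\int[time_measure]_t (C / eps * (c <= t <= c + eps)%R%:R))).
    apply: le_Rintegral => //.
    - apply: (@bounded_integrable _ _ _ _ _ (C / eps)) => //.
        by apply: measurableT_comp => //; exact: measurable_mollifier.
      by move=> t; rewrite normr_id.
    - exact: (integrableZl measurableT (C / eps) ib).
    - by move=> t _; exact: Cb.
  rewrite RintegralZl// -[leRHS](@divfK _ eps) ?gt_eqF//.
  rewrite ler_wpM2l ?divr_ge0 ?(ltW eps0)//.
  rewrite [leRHS](_ : eps = (c + eps) - c); last by rewrite addrAC subrr add0r.
  apply: Rintegral_itv_le => //.
  - exact: time_measure_itv.
  - by rewrite lerDl ltW.
  - by apply/measurable_EFinP; exact: measurable_int ib.
  - by move=> t; rewrite ler0n/=; case: (c <= t <= c + eps)%R; rewrite ?ler01 ?lexx.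
  - by move=> t /negbTE ->.
(* With time as the outer variable, the bump vanishes off [[c, c + eps]], and on that interval the
   L^1 distance to time [c] is at most [e]. *)
have side c dc : 0 < c < T -> eps < dc ->
    (forall t, 0 < t < T -> `|t - c| < dc -> \int[mu]_x `|E x c - E x t| <= e) ->
    \int[mu]_x \int[time_measure]_t (`|mollifier eps c t| * `|E x c - E x t|) <= C * e.
  move=> cI epsc dce.
  pose H x (t : RT) := `|mollifier eps c t| * `|E x c - E x t|.
  have iH := integrable_mollified cI (mC c).
  rewrite (Rintegral12 (f := H) iH) -(Rintegral21 (f := H) iH).
  have im : time_measure.-integrable setT (EFin \o (fun t : RT => `|mollifier eps c t|)).
    apply: (@bounded_integrable _ _ _ _ _ (C / eps)) => //.
      by apply: measurableT_comp => //; exact: measurable_mollifier.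
    by move=> t; rewrite normr_id.
  apply: (@le_trans _ _ (\int[time_measure]_t (`|mollifier eps c t| * e))); last first.
    by rewrite RintegralZr// ler_wpM2r// ltW.
  apply: ae_le_Rintegral.
  - exact: (integrable_Rintegral_fst (f := H) iH).
  - exact: (integrableZr measurableT e im).
  apply: ae_imply time_measure_supp => t tI.
  rewrite /H RintegralZl//; last first.
    by apply: integrable_norm; exact: (integrableB measurableT (iEt cI) (iEt tI)).
  have [ct|nct] := boolP (c <= t <= c + eps).
    rewrite ler_wpM2l//; apply: dce => //; move/andP : ct => [ct tc].
    by rewrite ger0_norm ?subr_ge0//; move: tc epsc; lra.
  have -> : mollifier eps c t = 0.
    apply/eqP; rewrite -normr_le0; apply: le_trans (Cb eps c t eps0) _.
    by rewrite (negbTE nct) mulr0.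
  by rewrite normr0 !mul0r.
have step : {ae mu, forall x, `|E x a - E x b| <=
    \int[time_measure]_t (`|mollifier eps a t| * `|E x a - E x t|) +
    \int[time_measure]_t (`|mollifier eps b t| * `|E x b - E x t|)}.
  have tphi := test_smooth_plateau eps0 a0 ab epsT.
  apply: ae_imply2 (wE tphi) (ae_integrable_xsection (f := fun x (t : RT) => E x t) iE) => x.
  rewrite derive1_smooth_plateau => wx ix.
  have imE c : time_measure.-integrable setT (EFin \o (fun t : RT => mollifier eps c t * E x t)).
    have i1 := integrableZl measurableT (C / eps) ix.
    apply: (le_integrable measurableT _ _ i1).
      apply/measurable_EFinP; apply: measurable_funM; first exact: measurable_mollifier.
      by apply/measurable_EFinP; exact: measurable_int ix.
    move=> t _ /=; rewrite lee_fin (normrM (mollifier _ _ _)) (normrM (C / eps)) ler_wpM2r//.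
    by rewrite (le_trans (mC _ _))// ler_norm.
  have im c : time_measure.-integrable setT (EFin \o (fun t : RT => mollifier eps c t)).
    exact: (bounded_integrable tauoo (measurable_mollifier eps c) (mC c)).
  have imc c k : time_measure.-integrable setT (EFin \o (fun t : RT => mollifier eps c t * k)).
    exact: (integrableZr measurableT k (im c)).
  have dec c : 0 < c -> c + eps < T ->
      E x c - \int[time_measure]_t (mollifier eps c t * E x t) =
      \int[time_measure]_t (mollifier eps c t * (E x c - E x t)).
    move=> c0 ceT; rewrite -{1}[E x c]mul1r -(Rintegral_mollifier eps0 c0 ceT).
    rewrite -RintegralZr// -RintegralB//.
    by apply: eq_Rintegral => t _; rewrite mulrBr.
  have nle c : `|\int[time_measure]_t (mollifier eps c t * (E x c - E x t))| <=
      \int[time_measure]_t (`|mollifier eps c t| * `|E x c - E x t|).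
    have iN : time_measure.-integrable setT
        (EFin \o (fun t : RT => mollifier eps c t * (E x c - E x t))).
      apply: eq_integrable (integrableB measurableT (imc c (E x c)) (imE c)) => // t _.
      by rewrite /= -EFinB mulrBr.
    rewrite (le_trans (le_normr_Rintegral measurableT iN))//.
    rewrite le_eqVlt; apply/orP; left; apply/eqP.
    by apply: eq_Rintegral => t _; rewrite normrM.
  have eqE : E x a - E x b =
      \int[time_measure]_t (mollifier eps a t * (E x a - E x t)) -
      \int[time_measure]_t (mollifier eps b t * (E x b - E x t)).
    rewrite -(dec a) ?(lt_trans _ epsT) ?ltrD2r// -(dec b)//.
    have : \int[time_measure]_t (mollifier eps a t * E x t) -
        \int[time_measure]_t (mollifier eps b t * E x t) = 0.
      by rewrite -RintegralB// -[RHS]wx; apply: eq_Rintegral => t _; ring.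
    have cancel (p q r s : R) : r - s = 0 -> p - q = p - r - (q - s) by lra.
    exact: cancel.
  by rewrite eqE (le_trans (ler_normB _ _))// lerD.
have iside c : 0 < c < T -> mu.-integrable setT (EFin \o (fun x =>
    \int[time_measure]_t (`|mollifier eps c t| * `|E x c - E x t|))).
  move=> cI; exact: (integrable_Rintegral_snd
    (f := fun x (t : RT) => `|mollifier eps c t| * `|E x c - E x t|)
    (integrable_mollified cI (mC c))).
apply: (@le_trans _ _ (C * e + C * e)); last first.
  rewrite -mulr2n -mulr_natl /e.
  rewrite (_ : 2 * (C * (e' / (2 * (C + 1)))) = e' * (C / (C + 1))); last first.
    by field; rewrite gt_eqF.
  by rewrite ler_piMr ?(ltW e'0)// ler_pdivrMr// mul1r lerDl.
apply: le_trans (lerD (side _ _ aI epsa dae) (side _ _ bI epsb dbe)).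
rewrite -RintegralD//; [|exact: iside|exact: iside].
apply: ae_le_Rintegral => //; first exact: integrable_norm iab.
by apply: eq_integrable (integrableD measurableT (iside _ aI) (iside _ bI)) => // x _.
Qed.

End weakly_constant.

End time_measure.

(** * Uniqueness *)

Section contraction.
Context (R : realType) (d : measure_display) (X : measurableType d).
Local Notation RT := (measurableTypeR R).
Variables (mu : {finite_measure set X -> \bar R}) (K : X -> X -> R) (M : R).
Hypothesis mK : measurable_fun setT (fun z : X * X => K z.1 z.2).
Hypothesis K0 : forall x y, 0 <= K x y.
Hypothesis Ksym : forall x y, K x y = K y x.
Hypothesis KM : forall x, (\int[mu]_y (K x y)%:E <= M%:E)%E.
Variables (T : R) (T0 : 0 < T).
Local Notation tau := (time_measure T).
Variables D D' v : X -> R -> R.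
(* [D'] is a jointly measurable version of [D] on the open time interval. *)
Hypothesis D'E : forall x t, 0 < t < T -> D' x t = D x t.
Hypothesis iD : (mu \x tau)%E.-integrable setT (fun z : X * RT => (D' z.1 z.2)%:E).
Hypothesis iDt : forall t, 0 <= t <= T -> mu.-integrable setT (fun x => (D x t)%:E).
Hypothesis cD : forall t0, 0 <= t0 <= T -> forall e, 0 < e -> exists2 del, 0 < del &
  forall t, 0 <= t <= T -> `|t - t0| < del -> \int[mu]_x `|D x t0 - D x t| <= e.
Hypothesis D0 : {ae mu, forall x, D x 0 = 0}.
Hypothesis mv : measurable_fun setT (fun z : X * RT => v z.1 z.2).
Hypothesis wD : forall phi, test_fun T phi -> {ae mu, forall x,
  \int[tau]_t (D' x t * phi^`()%classic t) = - \int[tau]_t (v x t * phi t)}.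
Hypothesis vw : {ae tau, forall s, exists w : X -> X -> R,
  [/\ measurable_fun setT (fun z : X * X => w z.1 z.2),
      forall x y, `|w x y| <= 2,
      {ae (mu \x mu)%E, forall z, w z.1 z.2 = - w z.2 z.1},
      {ae (mu \x mu)%E, forall z, 0 <= w z.1 z.2 * (D z.2 s - D z.1 s)} &
      {ae mu, forall x, v x s = \int[mu]_y (K x y * w x y)}]}.

Let c := `|2 * M|.
(** The truncation level bounds the [K]-average of any field bounded by 2, so [q] equals [v] almost
    everywhere, while being bounded at every point as [energy_le] and [primitive_lipschitz]
    require. *)
Let q x (s : R) := if `|v x s| <= c then v x s else 0.
Let E x t := D x t - primitive tau (q x) t.
Let E' x t := D' x t - primitive tau (q x) t.

Let muoo : (mu setT < +oo)%E. Proof. exact: finite_measure_lty. Qed.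
Let tauoo : (tau setT < +oo)%E. Proof. exact: finite_measure_lty. Qed.

Let mq : measurable_fun setT (fun z : X * RT => q z.1 z.2).
Proof.
apply: measurable_fun_ifT => //.
by apply: measurable_fun_ler => //; exact: measurableT_comp.
Qed.

Let mqx x : measurable_fun setT (q x : RT -> R).
Proof. exact: (measurableT_comp mq (pair1_measurable x)). Qed.

Let c0 : 0 <= c. Proof. exact: normr_ge0. Qed.

Let qc x s : `|q x s| <= c.
Proof. by rewrite /q; case: ifPn => // _; rewrite normr0; exact: c0. Qed.

Let mA : measurable [set z : X * RT | q z.1 z.2 = v z.1 z.2].
Proof.
have -> : [set z : X * RT | q z.1 z.2 = v z.1 z.2] =
    (fun z : X * RT => q z.1 z.2 - v z.1 z.2) @^-1` [set 0].
  by apply/seteqP; split=> z /= /eqP; rewrite ?subr_eq0 => /eqP h; apply/eqP; rewrite ?subr_eq0; apply/eqP.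
rewrite -[X in measurable X]setTI.
by apply: (measurable_funB mq mv) => //; exact: measurable_set1.
Qed.

(** The hypothesis [vw] gives equality on almost every time slice; the measurability of the set
    where [q] and [v] agree promotes it to the product. *)
Let q_ae : {ae (mu \x tau)%E, forall z : X * RT, q z.1 z.2 = v z.1 z.2}.
Proof.
apply: (ysection_ae_prod mA); apply: ae_imply vw => s [w [mw w2 _ _ vs]].
apply: ae_imply vs => x /= vx; rewrite /q ifT// vx /c.
apply: le_trans (ler_norm _).
apply: (le_norm_Rintegral_kernelM mK K0 KM); last exact: w2.
exact: (measurableT_comp mw (pair1_measurable x)).
Qed.

Let lip x s t : `|primitive tau (q x) s - primitive tau (q x) t| <= c * `|s - t|.
Proof.
wlog ts : s t / t <= s.
  move=> H; have [/H//|/ltW/H] := leP t s.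
  by rewrite distrC (distrC s).
have := @primitive_lipschitz _ tau (@time_measure_itv _ T) (q x) (s - t) s c.
rewrite subr_ge0 subKr (ger0_norm (_ : 0 <= s - t)) ?subr_ge0//.
by apply => //; exact: qc.
Qed.

Let primc x t : `|primitive tau (q x) t| <= c * fine (tau setT).
Proof. exact: (@le_norm_primitive _ tau (q x) t c (mqx x) (qc x)). Qed.

Let mprim t : measurable_fun setT (fun x => primitive tau (q x) t).
Proof. exact: (measurableT_comp (measurable_primitive tau mq) (pair2_measurable (t : RT))). Qed.

Let iprim t : mu.-integrable setT (EFin \o (fun x => primitive tau (q x) t)).
Proof. exact: (bounded_integrable muoo (mprim t) (fun x => primc x t)). Qed.

Let iEt t : 0 <= t <= T -> mu.-integrable setT (EFin \o (fun x => E x t)).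
Proof. by move=> tT; exact: (integrableB measurableT (iDt tT) (iprim t)). Qed.

Let cE t0 : 0 <= t0 <= T -> forall e, 0 < e -> exists2 del, 0 < del &
  forall t, 0 <= t <= T -> `|t - t0| < del -> \int[mu]_x `|E x t0 - E x t| <= e.
Proof.
move=> t0T e e0; have e20 : 0 < e / 2 by rewrite divr_gt0.
have [del del0 Hdel] := cD t0T e20.
pose C := c * fine (mu setT) + 1.
have mu0 : 0 <= fine (mu setT) by exact: fine_ge0.
have C0 : 0 < C by rewrite ltr_wpDl// mulr_ge0.
exists (Num.min del (e / 2 / C)); first by rewrite lt_min del0 divr_gt0.
move=> t tT; rewrite lt_min => /andP[tdel tC].
have i1 : mu.-integrable setT (EFin \o (fun x => `|D x t0 - D x t|)).
  by apply: integrable_norm; exact: (integrableB measurableT (iDt t0T) (iDt tT)).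
have i2 : mu.-integrable setT (EFin \o cst (c * `|t - t0|)).
  exact: finite_measure_integrable_cst.
apply: (@le_trans _ _ (\int[mu]_x (`|D x t0 - D x t| + cst (c * `|t - t0|) x))).
  apply: le_Rintegral => //.
  - by apply: integrable_norm; exact: (integrableB measurableT (iEt t0T) (iEt tT)).
  - exact: (integrableD measurableT i1 i2).
  move=> x _; rewrite /E.
  have -> : D x t0 - primitive tau (q x) t0 - (D x t - primitive tau (q x) t) =
      (D x t0 - D x t) + (primitive tau (q x) t - primitive tau (q x) t0).
    have swap (a1 a2 a3 a4 : R) : a1 - a2 - (a3 - a4) = a1 - a3 + (a4 - a2) by ring.
    exact: swap.
  by rewrite (le_trans (ler_normD _ _))// lerD2l; exact: lip.
rewrite RintegralD// Rintegral_cst// [leRHS](splitr e) lerD//; first exact: Hdel.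
move: tC; rewrite ltr_pdivlMr// => /ltW; apply: le_trans.
rewrite mulrAC mulrC ler_wpM2l//.
by rewrite /C lerDl.
Qed.

Let E0 : {ae mu, forall x, E x 0 = 0}.
Proof.
apply: ae_imply D0 => x Dx; rewrite /E Dx sub0r; apply/eqP; rewrite oppr_eq0; apply/eqP.
rewrite /primitive -[RHS](mul0r (fine (tau setT))) -Rintegral_cst//.
apply: ae_eq_Rintegral => //.
  apply: measurable_funM => //; exact: measurable_ltb.
by apply: ae_imply (time_measure_supp T) => s /andP[s0 _]; rewrite ltNge (ltW s0) mulr0.
Qed.

Let iE : (mu \x tau)%E.-integrable setT (fun z : X * RT => (E' z.1 z.2)%:E).
Proof.
have ip : (mu \x tau)%E.-integrable setT
    (EFin \o (fun z : X * RT => primitive tau (q z.1) z.2)).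
  apply: (@bounded_integrable _ _ _ _ _ (c * fine (tau setT))).
  - exact: product_measure_lty.
  - exact: measurable_primitive.
  - by move=> z; exact: primc.
by apply: eq_integrable (integrableB measurableT iD ip) => // z _.
Qed.

Let wE phi : test_fun T phi ->
  {ae mu, forall x, \int[tau]_t (E' x t * phi^`()%classic t) = 0}.
Proof.
move=> tphi; have [C [Cphi Cdphi]] := test_fun_bounded tphi.
have [dphi cdphi] := test_fun_derivable tphi.
have mdphi : measurable_fun setT (phi^`()%classic : RT -> R).
  exact: continuous_measurable_fun.
have mphi : measurable_fun setT (phi : RT -> R).
  by apply: continuous_measurable_fun => t; apply: differentiable_continuous; exact/derivable1_diffP.
apply: ae_imply2 (ae_imply2 (fun x a b => conj a b) (wD tphi)
   (ae_integrable_xsection (f := fun x (t : RT) => D' x t) iD))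
  (ae_prod_xsection (P := fun x (t : RT) => q x t = v x t) q_ae) => x [wx ix] qx.
have mprimx : measurable_fun setT (primitive tau (q x) : RT -> R).
  exact: (measurableT_comp (measurable_primitive tau mq) (pair1_measurable x)).
have iDp : tau.-integrable setT (EFin \o (fun t : RT => D' x t * phi^`()%classic t)).
  have i1 := integrableZl measurableT C ix.
  apply: (le_integrable measurableT _ _ i1).
    apply/measurable_EFinP; apply: measurable_funM => //.
    by apply/measurable_EFinP; exact: measurable_int ix.
  move=> t _ /=; rewrite lee_fin normrM (normrM C) mulrC ler_wpM2r//.
  by rewrite (le_trans (Cdphi _))// ler_norm.
have iqp : tau.-integrable setT
    (EFin \o (fun t : RT => primitive tau (q x) t * phi^`()%classic t)).
  apply: (@bounded_integrable _ _ _ _ _ (c * fine (tau setT) * C)) => //.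
    exact: measurable_funM.
  by move=> t; rewrite normrM ler_pM//; exact: primc.
have -> : \int[tau]_t (E' x t * phi^`()%classic t) =
    \int[tau]_t (D' x t * phi^`()%classic t - primitive tau (q x) t * phi^`()%classic t).
  by apply: eq_Rintegral => t _; rewrite mulrBl.
rewrite RintegralB// wx primitive_by_parts//; last exact: (bounded_integrable tauoo (mqx x) (qc x)).
rewrite opprK addrC; apply/eqP; rewrite subr_eq0; apply/eqP.
have mvx : measurable_fun setT (v x : RT -> R).
  exact: (measurableT_comp mv (pair1_measurable x)).
apply: ae_eq_Rintegral; [exact: measurable_funM|exact: measurable_funM|].
by apply: ae_imply qx => t ->.
Qed.

Let E_eq0_of_small t : 0 <= t <= T -> (forall e, 0 < e -> \int[mu]_x `|E x t| <= e) ->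
  {ae mu, forall x, E x t = 0}.
Proof.
move=> tT H; apply: Rintegral_norm_eq0; first exact: iEt.
by apply/ler_addgt0Pr => e e0; rewrite add0r; exact: H.
Qed.

(** Weak constancy compares interior times only. The initial time is reached through a small [a], by
    continuity at 0. *)
Let E_eq0_inner t : 0 < t < T -> {ae mu, forall x, E x t = 0}.
Proof.
move=> /andP[t0 tT]; apply: E_eq0_of_small; first by rewrite !ltW.
move=> e e0; have zT : 0 <= (0 : R) <= T by rewrite lexx ltW.
have [del del0 Hdel] := cE zT e0.
pose a := Num.min del t / 2.
have m0 : 0 < Num.min del t by rewrite lt_min del0.
have [a0 [adel at']] : 0 < a /\ a < del /\ a < t.
  split; first by rewrite divr_gt0.
  by apply/andP; rewrite -lt_min /a; lra.
have aT : 0 <= a <= T by rewrite !ltW// (lt_trans at').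
have E'E x s : 0 < s < T -> E' x s = E x s by move=> sI; rewrite /E' D'E.
have aI : 0 < a < T by rewrite a0 (lt_trans at').
have tI : 0 < t < T by rewrite t0.
have wc : {ae mu, forall x, E x a = E x t}.
  suff : {ae mu, forall x, E' x a = E' x t} by apply: ae_imply => x; rewrite !E'E.
  apply: (@weakly_constant _ T _ _ mu E' iE _ _ wE a t a0 at' tT).
  - move=> s sI; under eq_fun do rewrite E'E//.
    by apply: iEt; move/andP : sI => [? ?]; rewrite !ltW.
  - move=> s /[dup] sI /andP[s0 sT] e1 e10; have sI' : 0 <= s <= T by rewrite !ltW.
    have [dl dl0 Hdl] := cE sI' e10; exists dl => // r /[dup] rI /andP[r0 rT] rs.
    under eq_Rintegral do rewrite !E'E//.
    by apply: Hdl => //; rewrite !ltW.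
have tT' : 0 <= t <= T by rewrite !ltW.
have mEt s : 0 <= s <= T -> measurable_fun setT (fun x => E x s).
  by move=> sI; apply/measurable_EFinP; exact: measurable_int (iEt sI).
rewrite (_ : \int[mu]_x `|E x t| = \int[mu]_x `|E x 0 - E x a|).
  by apply: Hdel => //; rewrite subr0 gtr0_norm.
apply: ae_eq_Rintegral.
- by apply: measurableT_comp => //; exact: mEt.
- by apply: measurableT_comp => //; apply: measurable_funB; exact: mEt.
- by apply: ae_imply2 wc E0 => x -> ->; rewrite sub0r normrN.
Qed.

(** The final time [T] is reached from interior times by continuity from the left. *)
Let E_eq0 t : 0 <= t <= T -> {ae mu, forall x, E x t = 0}.
Proof.
move=> /[dup] tT /andP[]; rewrite le_eqVlt => /predU1P[<- _|t0]; first exact: E0.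
rewrite le_eqVlt => /predU1P[tE|tT']; last by apply: E_eq0_inner; rewrite t0.
apply: E_eq0_of_small => // e e0; have [del del0 Hdel] := cE tT e0.
pose a := t - Num.min del t / 2.
have m0 : 0 < Num.min del t by rewrite lt_min del0.
have [adel at'] : Num.min del t / 2 < del /\ Num.min del t / 2 < t.
  by apply/andP; rewrite -lt_min; lra.
have aI : 0 < a < T by apply/andP; split; rewrite /a; move: at' m0 tE; lra.
have aT : 0 <= a <= T by move/andP : aI => [? ?]; rewrite !ltW.
have mEt s : 0 <= s <= T -> measurable_fun setT (fun x => E x s).
  by move=> sI; apply/measurable_EFinP; exact: measurable_int (iEt sI).
rewrite (_ : \int[mu]_x `|E x t| = \int[mu]_x `|E x t - E x a|).
  by apply: Hdel => //; rewrite /a addrAC subrr sub0r normrN gtr0_norm// divr_gt0.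
apply: ae_eq_Rintegral.
- by apply: measurableT_comp => //; exact: mEt.
- by apply: measurableT_comp => //; apply: measurable_funB; exact: mEt.
- by apply: ae_imply (E_eq0_inner aI) => x ->; rewrite subr0.
Qed.

Lemma contraction_eq0 t : 0 <= t <= T -> {ae mu, forall x, D x t = 0}.
Proof.
(* At every time [D] agrees almost everywhere with the primitive of [q], so the monotonicity in [vw]
   holds for that primitive. The pairing estimate then applies with zero defect. *)
move=> tT; have energy : \int[mu]_x (primitive tau (q x) t ^+ 2) <= 0.
  apply: le_trans (_ : _ <= 2 * \int[tau]_s (cst 0 s)) _; last first.
    by rewrite Rintegral_cst// mul0r mulr0.
  apply: (@energy_le _ tau (@time_measure_set1 _ T) _ _ mu q (cst 0) c t mq qc) => //.
    exact: finite_measure_integrable_cst.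
  have qv := ae_prod_ysection (P := fun x (t : RT) => q x t = v x t) q_ae.
  apply: ae_imply2 (ae_imply2 (fun x a b => conj a b) vw qv) (time_measure_supp T) => s
    [[w [mw w2 wanti wmono vs]] qs] /andP[s0 sT].
  have sI : 0 <= s <= T by rewrite !ltW.
  have i0 : mu.-integrable setT (EFin \o (cst 0 : X -> R)).
    exact: finite_measure_integrable_cst.
  have := antisymmetric_pairing_le mK K0 Ksym KM mw w2 (mprim s)
    (fun x => primc x s) i0 (fun=> lexx 0) wanti.
  rewrite Rintegral_cst// mul0r mulr0 => H.
  rewrite (_ : \int[mu]_x _ =
      \int[mu]_x ((\int[mu]_y (K x y * w x y)) * primitive tau (q x) s)).
    apply: H; have Es := E_eq0 sI.
    apply: ae_imply2 (ae_imply2 (fun x a b => conj a b) (ae_fst mu Es) (ae_snd mu Es)) wmono.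
    move=> z [] /eqP; rewrite subr_eq0 => /eqP <- /eqP; rewrite subr_eq0 => /eqP <-.
    by rewrite addr0 mulr0 oppr0.
  apply: ae_eq_Rintegral.
  - apply: measurable_funM; last exact: mprim.
    exact: (measurableT_comp mq (pair2_measurable (s : RT))).
  - apply: measurable_funM; last exact: mprim.
    by apply: measurable_Rintegral_snd; exact: measurable_funM.
  - by apply: ae_imply2 qs vs => x -> ->.
have prim0 : {ae mu, forall x, primitive tau (q x) t = 0}.
  have isq : mu.-integrable setT (EFin \o (fun x => primitive tau (q x) t ^+ 2)).
    apply: (@bounded_integrable _ _ _ _ _ ((c * fine (tau setT)) ^+ 2)) => //.
      exact: measurable_funX.
    by move=> x; rewrite normrX lerXn2r ?nnegrE// ?(le_trans _ (primc x t)).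
  have : {ae mu, forall x, primitive tau (q x) t ^+ 2 = 0}.
    apply: Rintegral_norm_eq0 => //; apply: le_trans energy.
    by rewrite le_eqVlt; apply/orP; left; apply/eqP; apply: eq_Rintegral => x _; rewrite ger0_norm// sqr_ge0.
  by apply: ae_imply => x /eqP; rewrite sqrf_eq0 => /eqP.
apply: ae_imply2 (E_eq0 tT) prim0 => x /eqP; rewrite /E subr_eq0 => /eqP ->.
by move=> ->.
Qed.

End contraction.

(** * Lebesgue measure on the cube *)

Section box.
Context {R : realType}.
Local Notation RT := (measurableTypeR R).

Definition box (n : nat) (a b : R) : set (n.-tuple R) :=
  [set x | forall i : 'I_n, a <= tnth x i <= b].

Lemma measurable_box n a b : measurable (box (n := n) a b).
Proof.
have -> : box (n := n) a b =
    \bigcap_(i in [set: 'I_n]) ((fun x : n.-tuple R => tnth x i) @^-1` `[a, b]%classic).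
  apply/seteqP; split=> x /= h i; first by move=> _ /=; rewrite in_itv; exact: h.
  by have := h i Logic.I; rewrite /= in_itv.
apply: fin_bigcap_measurable => // i _; rewrite -[X in measurable X]setTI.
by apply: (measurable_tnth i) => //; exact: measurable_itv.
Qed.

(** The measure axioms for a bare set function, with finiteness on boxes added so that the induction
    over dimensions also provides the sigma-finiteness needed to form the next product measure. *)
Definition box_finite_measure (n : nat) (m : set (n.-tuple R) -> \bar R) :=
  [/\ m set0 = 0%E, forall A, (0 <= m A)%E, semi_sigma_additive m &
      forall a b, (m (box a b) < +oo)%E].

(* A head symbol carrying the proof, so that the measure structures below can
   be attached to an arbitrary set function. *)
Definition tuple_measure (n : nat) (m : set (n.-tuple R) -> \bar R)
  (mP : box_finite_measure m) : set (n.-tuple R) -> \bar R := m.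

Section tuple_measure.
Context (n : nat) (m : set (n.-tuple R) -> \bar R) (mP : box_finite_measure m).

Let m0 : tuple_measure mP set0 = 0%E. Proof. by case: mP. Qed.
Let m_ge0 A : (0 <= tuple_measure mP A)%E. Proof. by case: mP. Qed.
Let m_sigma : semi_sigma_additive (tuple_measure mP). Proof. by case: mP. Qed.

HB.instance Definition _ := isMeasure.Build _ _ _ (tuple_measure mP) m0 m_ge0 m_sigma.

Let m_sigma_finite : sigma_finite setT (tuple_measure mP).
Proof.
exists (fun k => box (- k%:R) k%:R); last first.
  by move=> k; split; [exact: measurable_box|case: mP].
apply/seteqP; split=> x // _.
pose B := \sum_(i < n) `|tnth x i|.
exists (Num.truncn B).+1 => // i.
rewrite -ler_norml; apply: le_trans (ltW (truncnS_gt _)).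
rewrite /B (bigD1 i)//= lerDl; exact: sumr_ge0.
Qed.

HB.instance Definition _ :=
  Measure_isSigmaFinite.Build _ _ _ (tuple_measure mP) m_sigma_finite.

Definition cons_pair (z : RT * n.-tuple R) : n.+1.-tuple R := cons_tuple z.1 z.2.

Lemma measurable_cons_pair : measurable_fun setT cons_pair.
Proof.
apply: (@measurable_cons _ _ (RT * n.-tuple R)%type R fst n snd).
- exact: measurable_fst.
- exact: measurable_snd.
Qed.

HB.instance Definition _ := isMeasurableFun.Build _ _ _ _ cons_pair measurable_cons_pair.

(** The recursive formula is the pushforward by [cons_pair] of the product of the one-dimensional
    Lebesgue measure with [m], from which it inherits the axioms; the preimage of a box is an
    interval times a box. *)
Lemma box_finite_measure_cons : box_finite_measure
  (fun A : set (n.+1.-tuple R) =>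
    \int[@lebesgue_measure R]_x m [set t | A (cons_tuple x t)])%E.
Proof.
pose P := pushforward (@lebesgue_measure R \x tuple_measure mP)%E cons_pair.
have PE : (fun A : set (n.+1.-tuple R) =>
    \int[@lebesgue_measure R]_x m [set t | A (cons_tuple x t)])%E = P.
  apply/funext => A; apply: eq_integral => x _ /=.
  by congr m; rewrite xsectionE.
rewrite PE; split.
- exact: measure0.
- by move=> A; exact: measure_ge0.
- exact: measure_semi_sigma_additive.
- move=> a b; rewrite /P /pushforward.
  have -> : cons_pair @^-1` box a b = `[a, b]%classic `*` box (n := n) a b.
    apply/seteqP; split=> [[x t] /= h|[x t] /= [xab tab]].
      split => [|i] /=.
        by have := h ord0; rewrite tnth0 in_itv.
      by have := h (lift ord0 i); rewrite tnthS.
    move=> i; case: (unliftP ord0 i) => [j ->|->]; rewrite ?tnthS ?tnth0//.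
  rewrite product_measure1E//; last exact: measurable_box.
  apply: lte_mul_pinfty => //; last by case: mP.
  change (@lebesgue_measure R `[a, b]%classic \is a fin_num).
  by rewrite lebesgue_measure_itv/=; case: ifP.
Qed.

End tuple_measure.

Lemma box_finite_lebn n : box_finite_measure (@lebn R n).
Proof.
elim: n => [|n IH]; last exact: (box_finite_measure_cons IH).
have -> : @lebn R 0 = dirac [tuple] by [].
split; [exact: measure0|by move=> A; exact: measure_ge0|
  exact: measure_semi_sigma_additive|].
by move=> a b; rewrite diracE ltry.
Qed.

End box.

Section cube.
Context {R : realType} (d : nat).
Local Notation RT := (measurableTypeR R).

HB.instance Definition _ := Measure.copy (@lebn R d) (tuple_measure (box_finite_lebn d)).
HB.instance Definition _ := SigmaFiniteMeasure.copy (@lebn R d) (tuple_measure (box_finite_lebn d)).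

Lemma measurable_Omega : measurable (@Omega R d).
Proof. exact: measurable_box. Qed.

Definition cube_measure : set (d.-tuple R) -> \bar R := mrestr (@lebn R d) measurable_Omega.

HB.instance Definition _ := Measure.on cube_measure.

Let cube_measure_fin : fin_num_fun cube_measure.
Proof.
apply: lty_fin_num_fun.
rewrite -[X in (X < _)%E]/(@lebn R d (setT `&` Omega d)) setTI.
by have [_ _ _] := @box_finite_lebn R d; exact.
Qed.

HB.instance Definition _ := Measure_isFinite.Build _ _ _ cube_measure cube_measure_fin.

End cube.

Section equal_measures.
Context (d : measure_display) (T : measurableType d) (R : realType).
Variables (m m' : {measure set T -> \bar R}).
Hypothesis mE : forall A, measurable A -> m A = m' A.

(** Serves to move between a product of restricted measures and the restriction of the product
    measure: [product_mrestr] compares them on measurable sets, so properties are transported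
    instead of rewriting an equality of functions. *)
Lemma eq_measure_ae (P : T -> Prop) :
  {ae m, forall x, P x} <-> {ae m', forall x, P x}.
Proof.
split=> -[N [mN N0 PN]]; exists N; split => //.
  by rewrite -mE.
by rewrite mE.
Qed.

Lemma eq_measure_integrable (f : T -> \bar R) :
  m.-integrable setT f <-> m'.-integrable setT f.
Proof.
have E : (\int[m]_x `|f x| = \int[m']_x `|f x|)%E.
  by apply: eq_measure_integral => A mA _; exact: mE.
by split=> /integrableP[mf ioo]; apply/integrableP; split => //; rewrite ?E// -E.
Qed.

End equal_measures.

Section product_mrestr.
Context (d1 d2 : measure_display) (T1 : measurableType d1)
  (T2 : measurableType d2) (R : realType).
Variables (m1 : {sigma_finite_measure set T1 -> \bar R})
  (m2 : {sigma_finite_measure set T2 -> \bar R}).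
Variables (D1 : set T1) (D2 : set T2) (mD1 : measurable D1) (mD2 : measurable D2).

Lemma product_mrestr (A : set (T1 * T2)%type) : measurable A ->
  (mrestr m1 mD1 \x mrestr m2 mD2)%E A = mrestr (m1 \x m2)%E (measurableX mD1 mD2) A.
Proof.
move=> mA.
have mA2 : measurable (A `&` setT `*` D2).
  by apply: measurableI => //; exact: measurableX.
have xE x : xsection (A `&` setT `*` D2) x = xsection A x `&` D2.
  by rewrite !xsectionE; apply/seteqP; split=> y /=; [case=> ? []|case].
rewrite /product_measure1 /= integral_mrestr; last first.
  have -> : (fun x => mrestr m2 mD2 (xsection A x)) = m2 \o xsection (A `&` setT `*` D2).
    by apply/funext => x /=; rewrite xE.
  exact: measurable_fun_xsection.
rewrite /mrestr integral_mkcond; apply: eq_integral => x _; rewrite patchE /=.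
case: ifPn; rewrite ?inE ?notin_setE => D1x.
  by congr (m2 _); rewrite !xsectionE; apply/seteqP; split=> y /=; [case|case=> ? []].
rewrite (_ : xsection _ x = set0) ?measure0//.
by rewrite xsectionE; apply/seteqP; split=> y //= -[_ [/D1x]].
Qed.

End product_mrestr.

(** * Translation between the cube, the cylinder and finite measures on whole spaces *)

Section cylinder.
Context {R : realType} (d : nat) (T : R).
Local Notation RT := (measurableTypeR R).
Local Notation X := (d.-tuple R).
Local Notation mu := (@cube_measure R d).
Local Notation tau := (time_measure T).

Lemma cube_aeP (P : X -> Prop) :
  {ae mu, forall x, P x} <-> {ae @lebn R d, forall x, Omega d x -> P x}.
Proof. exact: mrestr_ae. Qed.

Lemma time_aeP (P : R -> Prop) :
  {ae tau, forall t, P t} <-> {ae @lebesgue_measure R, forall t, 0 < t < T -> P t}.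
Proof.
rewrite (mrestr_ae (@lebesgue_measure R) (measurable_I0T T)).
by split; apply: ae_imply => t; rewrite /I0T /= in_itv.
Qed.

Lemma cube_prod_aeP (P : X * X -> Prop) :
  {ae (mu \x mu)%E, forall z, P z} <->
  {ae mOO d, forall z, (Omega d `*` Omega d) z -> P z}.
Proof.
have mO := @measurable_Omega R d.
rewrite -(mrestr_ae (@lebn R d \x @lebn R d)%E (measurableX mO mO)).
apply: eq_measure_ae => A mA; exact: product_mrestr.
Qed.

Lemma cylinder_aeP (P : X * RT -> Prop) :
  {ae (mu \x tau)%E, forall z, P z} <-> {ae mOT d, forall z, QT d T z -> P z}.
Proof.
have mO := @measurable_Omega R d; have mI := @measurable_I0T R T.
rewrite -(mrestr_ae (@lebn R d \x @lebesgue_measure R)%E (measurableX mO mI)).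
apply: eq_measure_ae => A mA; exact: product_mrestr.
Qed.

Lemma cube_integrableP (f : X -> R) :
  (@lebn R d).-integrable (Omega d) (EFin \o f) <->
  mu.-integrable setT (EFin \o (f \_ (Omega d))).
Proof. exact: integrable_mrestr_patch. Qed.

Lemma cube_integrableT (f : X -> R) : mu.-integrable setT (EFin \o f) ->
  (@lebn R d).-integrable (Omega d) (EFin \o f).
Proof.
move=> intf; apply/cube_integrableP; apply: (le_integrable measurableT _ _ intf).
  apply/measurable_EFinP/(measurable_restrictT _ (@measurable_Omega R d)).
  by apply: measurable_funTS; apply/measurable_EFinP; exact: measurable_int intf.
by move=> x _; rewrite /= lee_fin patchE; case: ifP => //; rewrite normr0.
Qed.

Lemma cylinder_integrableP (f : X * RT -> R) :
  (mOT d).-integrable (QT d T) (EFin \o f) <->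
  (mu \x tau)%E.-integrable setT (EFin \o (f \_ (QT d T))).
Proof.
have mO := @measurable_Omega R d; have mI := @measurable_I0T R T.
rewrite (integrable_mrestr_patch (@lebn R d \x @lebesgue_measure R)%E (measurableX mO mI)).
symmetry; apply: eq_measure_integrable => A mA; exact: product_mrestr.
Qed.

End cylinder.

(** * Regularity of integrated flows *)

Lemma norm_mulb_le (R : realType) (a : R) (b : bool) : `| `|a| * b%:R| <= `|a|.
Proof. by case: b; rewrite ?mulr1 ?mulr0 ?normr_id ?normr0. Qed.

Lemma measurable_dist_le (d : measure_display) (T : measurableType d) (R : realType)
    (f : T -> R) (c h : R) : measurable_fun setT f ->
  measurable_fun setT (fun x => (`|f x - c| <= h)%R%:R : R).
Proof.
move=> mf; rewrite (_ : (fun x => _) = (fun x => if `|f x - c| <= h then 1 else 0 : R)).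
  apply: measurable_fun_ifT => //; apply: measurable_fun_ler => //.
  by apply: measurableT_comp => //; exact: measurable_funB.
by apply/funext => x; case: ifP.
Qed.

(** The points [x] whose section is not integrable form a null set; multiplying by the indicator of
    the others gives a representative whose time primitives make sense at every [x]. *)
Lemma integrable_prod_sections (d1 d2 : measure_display) (T1 : measurableType d1)
    (T2 : measurableType d2) (R : realType)
    (m1 : {sigma_finite_measure set T1 -> \bar R})
    (m2 : {sigma_finite_measure set T2 -> \bar R}) (f : T1 -> T2 -> R) :
  (m1 \x m2)%E.-integrable setT (fun z => (f z.1 z.2)%:E) ->
  exists f' : T1 -> T2 -> R,
    [/\ (m1 \x m2)%E.-integrable setT (fun z => (f' z.1 z.2)%:E),
        forall x, m2.-integrable setT (EFin \o f' x) &
        {ae (m1 \x m2)%E, forall z, f' z.1 z.2 = f z.1 z.2}].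
Proof.
move=> intf.
have mf : measurable_fun setT (fun z : T1 * T2 => f z.1 z.2).
  by apply/measurable_EFinP; exact: measurable_int intf.
have mfx x : measurable_fun setT (f x) by exact: (measurableT_comp mf (pair1_measurable x)).
pose G x := (\int[m2]_y `|(f x y)%:E|)%E.
have mG : measurable_fun setT G.
  apply: (@measurable_fun_fubini_tonelli_F _ _ _ _ _ m2 (fun z : T1 * T2 => `|(f z.1 z.2)%:E|%E)) => //.
  by apply: measurableT_comp => //; exact/measurable_EFinP.
pose A := [set x | (G x < +oo)%E].
have mA : measurable A.
  by have := emeasurable_fun_infty_o measurableT mG +oo%E; rewrite setTI.
have m1A : measurable_fun setT (\1_A : T1 -> R) by exact: measurable_indic.
exists (fun x y => f x y * \1_A x); split.
- apply: (le_integrable measurableT _ _ intf).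
    apply/measurable_EFinP; apply: measurable_funM => //; exact: measurableT_comp.
  move=> z _ /=; rewrite lee_fin normrM indicE normr_nat ler_piMr//.
  by case: (_ \in _).
- move=> x; apply/integrableP; split.
    by apply/measurable_EFinP; exact: measurable_funM.
  have [Ax|nAx] := pselect (A x).
    rewrite (_ : (\int[m2]_y _)%E = G x)//.
    by apply: eq_integral => y _; rewrite /= indicE mem_set// mulr1.
  under eq_integral do rewrite /= indicE memNset// mulr0 normr0.
  by rewrite integral0 ltry.
- have := ae_fst m2 (ae_integrable_xsection intf).
  apply: ae_imply => z /integrableP[_ fz].
  by rewrite indicE mem_set ?mulr1.
Qed.

Section absolutely_continuous.
Context (R : realType) (T : R) (d : measure_display) (X : measurableType d).
Local Notation RT := (measurableTypeR R).
Local Notation tau := (time_measure T).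
Variables (mu : {finite_measure set X -> \bar R}) (g : X -> R) (q : X -> R -> R).
Hypothesis ig : mu.-integrable setT (EFin \o g).
Hypothesis iq : (mu \x tau)%E.-integrable setT (fun z : X * RT => (q z.1 z.2)%:E).
Hypothesis iqx : forall x, tau.-integrable setT (EFin \o q x).

Definition evolve x t : R := g x + primitive tau (q x) t.

Let muoo : (mu setT < +oo)%E. Proof. exact: finite_measure_lty. Qed.
Let tauoo : (tau setT < +oo)%E. Proof. exact: finite_measure_lty. Qed.

Let mq : measurable_fun setT (fun z : X * RT => q z.1 z.2).
Proof. by apply/measurable_EFinP; exact: measurable_int iq. Qed.

Let mg : measurable_fun setT g.
Proof. by apply/measurable_EFinP; exact: measurable_int ig. Qed.

Let G x := \int[tau]_s `|q x s|.

Let iG : mu.-integrable setT (EFin \o G).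
Proof.
apply: (integrable_Rintegral_snd (f := fun x (s : RT) => `|q x s|)).
exact: integrable_norm iq.
Qed.

Let le_primitive x t : `|primitive tau (q x) t| <= G x.
Proof.
rewrite (le_trans (le_normr_Rintegral measurableT (integrable_primitive t (iqx x))))//.
apply: le_Rintegral => //.
- by apply: integrable_norm; exact: integrable_primitive (iqx x).
- exact: integrable_norm (iqx x).
- by move=> s _; rewrite normrM normr_nat ler_piMr//; case: (_ < _)%R.
Qed.

Lemma measurable_evolve : measurable_fun setT (fun z : X * RT => evolve z.1 z.2).
Proof. by apply: measurable_funD; [exact: measurableT_comp|exact: measurable_primitive]. Qed.

Lemma integrable_evolve_fst t : mu.-integrable setT (EFin \o (fun x => evolve x t)).
Proof.
have i1 : mu.-integrable setT (EFin \o (fun x => primitive tau (q x) t)).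
  apply: (le_integrable measurableT _ _ iG).
    apply/measurable_EFinP.
    exact: (measurableT_comp (measurable_primitive tau mq) (pair2_measurable (t : RT))).
  by move=> x _ /=; rewrite lee_fin (le_trans (le_primitive x t))// ler_norm.
exact: (integrableD measurableT ig i1).
Qed.

Lemma integrable_evolve :
  (mu \x tau)%E.-integrable setT (fun z : X * RT => (evolve z.1 z.2)%:E).
Proof.
have i1 := integrable_fst tauoo (integrable_norm ig).
have i2 := integrable_fst tauoo iG.
apply: (le_integrable measurableT _ _ (integrableD measurableT i1 i2)).
  by apply/measurable_EFinP; exact: measurable_evolve.
move=> z _ /=; rewrite lee_fin (le_trans (ler_normD _ _))//.
by apply: le_trans (ler_norm _); rewrite lerD2l; exact: le_primitive.
Qed.

(** The cut-offs at [t0] and at [t] differ only for [s] between the two times, hence within [h] of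
    [t0]. The right-hand side is the same for all such [t]. *)
Let le_evolveB x t t0 h : `|t - t0| <= h ->
  `|evolve x t0 - evolve x t| <= \int[tau]_s (`|q x s| * (`|s - t0| <= h)%R%:R).
Proof.
move=> th.
have -> : evolve x t0 - evolve x t =
    \int[tau]_s (q x s * (s < t0)%R%:R - q x s * (s < t)%R%:R).
  have cancel (a b c : R) : a + b - (a + c) = b - c by ring.
  by rewrite /evolve cancel /primitive -RintegralB//; exact: integrable_primitive (iqx x).
have mqx : measurable_fun setT (q x : RT -> R).
  by apply/measurable_EFinP; exact: measurable_int (iqx x).
have i1 : tau.-integrable setT
    (EFin \o (fun s => q x s * (s < t0)%R%:R - q x s * (s < t)%R%:R)).
  exact: (integrableB measurableT (integrable_primitive t0 (iqx x))
    (integrable_primitive t (iqx x))).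
rewrite (le_trans (le_normr_Rintegral measurableT i1))//.
apply: le_Rintegral => //; first exact: integrable_norm i1.
  apply: (le_integrable measurableT _ _ (iqx x)).
    apply/measurable_EFinP; apply: measurable_funM; first exact: measurableT_comp.
    exact: measurable_dist_le.
  by move=> s _; rewrite lee_fin; exact: norm_mulb_le.
move=> s _; rewrite -mulrBr normrM ler_wpM2l//.
have near_t0 (r : R) : (r < t0) != (r < t) -> `|r - t0| <= h.
  by move: th; rewrite !ler_norml; case: (ltP r t0) => ?; case: (ltP r t) => ? //= /andP[]; lra.
have := near_t0 s; case: (s < t0); case: (s < t) => //= nt;
  by rewrite ?subrr ?sub0r ?subr0 ?normrN ?normr0 ?normr1 ?ler0n// nt.
Qed.

(** Dominated convergence: every [s] other than [t0] eventually leaves the shrinking neighbourhood,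
    and [t0] itself is null for the time measure. *)
Let cvg_short_time t0 :
  \int[(mu \x tau)%E]_z (`|q z.1 z.2| * (`|z.2 - t0| <= n.+1%:R^-1)%R%:R)
    @[n --> \oo] --> 0.
Proof.
rewrite -[X in _ --> X](mul0r (fine ((mu \x tau)%E setT))) -Rintegral_cst//.
have mB n : measurable_fun setT
    (fun z : X * RT => (`|z.2 - t0| <= n.+1%:R^-1)%R%:R : R).
  exact: measurable_dist_le.
apply: (Rintegral_dominated (g := fun z : X * RT => `|q z.1 z.2|)).
- by move=> n; apply: measurable_funM => //; exact: measurableT_comp.
- exact: measurable_cst.
- exact: integrable_norm iq.
- have : {ae tau, forall s, s <> t0}.
    exists [set t0]; split; [exact: measurable_set1|exact: time_measure_set1|].
    by move=> s /= /contrapT.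
  move/(ae_snd mu); apply: ae_imply => z zt0.
  apply: cvg_near_cst.
  have e0 : 0 < `|z.2 - t0| by rewrite normr_gt0 subr_eq0; apply/eqP.
  near=> n; rewrite leNgt (_ : _ < _) ?mulr0//.
  near: n; exact: (near_infty_natSinv_lt (PosNum e0)).
- by move=> n z; exact: norm_mulb_le.
Unshelve. all: by end_near. Qed.

Lemma evolve_L1_continuous t0 e : 0 < e -> exists2 del, 0 < del &
  forall t, `|t - t0| < del -> \int[mu]_x `|evolve x t0 - evolve x t| <= e.
Proof.
move=> e0; have /cvgrPdist_le/(_ e e0)[n _ /(_ n (leqnn _))] := cvg_short_time t0.
rewrite sub0r normrN => ne.
exists n.+1%:R^-1; first by rewrite invr_gt0.
move=> t /ltW th; apply: le_trans (le_trans (ler_norm _) ne).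
have iH : (mu \x tau)%E.-integrable setT
    (fun z : X * RT => (`|q z.1 z.2| * (`|z.2 - t0| <= n.+1%:R^-1)%R%:R)%:E).
  apply: (le_integrable measurableT _ _ iq).
    apply/measurable_EFinP; apply: measurable_funM; first exact: measurableT_comp.
    exact: measurable_dist_le.
  by move=> z _; rewrite lee_fin; exact: norm_mulb_le.
pose H x (s : RT) := `|q x s| * (`|s - t0| <= n.+1%:R^-1)%R%:R.
rewrite -(Rintegral12 (f := H) iH); apply: le_Rintegral => //.
- apply: integrable_norm.
  exact: (integrableB measurableT (integrable_evolve_fst t0) (integrable_evolve_fst t)).
- exact: (integrable_Rintegral_snd (f := H) iH).
- by move=> x _; exact: le_evolveB.
Qed.

Lemma integrable_test (p : R -> R) (psi : R -> R) C : tau.-integrable setT (EFin \o p) ->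
  measurable_fun setT (psi : RT -> R) -> (forall t, `|psi t| <= C) ->
  tau.-integrable setT (EFin \o (fun t : RT => p t * psi t)).
Proof.
move=> ip mpsi psiC; have iC := integrableZl measurableT C ip.
apply: (le_integrable measurableT _ _ iC).
  apply/measurable_EFinP; apply: measurable_funM => //.
  by apply/measurable_EFinP; exact: measurable_int ip.
move=> t _ /=; rewrite lee_fin normrM (normrM C) mulrC ler_wpM2r//.
by rewrite (le_trans (psiC _))// ler_norm.
Qed.

Lemma integrable_evolve_snd x : tau.-integrable setT (EFin \o evolve x).
Proof.
have m1 : measurable_fun setT (evolve x : RT -> R).
  exact: (measurableT_comp measurable_evolve (pair1_measurable x)).
apply: (bounded_integrable (c := `|g x| + G x) tauoo m1) => t.
by rewrite (le_trans (ler_normD _ _))// lerD2l.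
Qed.

(** The initial value contributes [g x] times the integral of [phi'], which is
    [phi T - phi 0 = 0]. *)
Lemma evolve_by_parts x phi : 0 < T -> test_fun T phi ->
  \int[tau]_t (evolve x t * phi^`()%classic t) = - \int[tau]_t (q x t * phi t).
Proof.
move=> T0 tphi; have [C [Cphi Cdphi]] := test_fun_bounded tphi.
have [dphi cdphi] := test_fun_derivable tphi.
have mdphi : measurable_fun setT (phi^`()%classic : RT -> R).
  exact: continuous_measurable_fun.
have igp : tau.-integrable setT (EFin \o (fun t : RT => g x * phi^`()%classic t)).
  apply: (integrable_test (p := fun=> g x) _ mdphi Cdphi).
  exact: finite_measure_integrable_cst.
have mprim : measurable_fun setT (primitive tau (q x) : RT -> R).
  exact: (measurableT_comp (measurable_primitive tau mq) (pair1_measurable x)).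
have iprim : tau.-integrable setT (EFin \o primitive tau (q x)).
  exact: (bounded_integrable tauoo mprim (le_primitive x)).
have ip := integrable_test iprim mdphi Cdphi.
have -> : \int[tau]_t (evolve x t * phi^`()%classic t) = \int[tau]_t
    (g x * phi^`()%classic t + primitive tau (q x) t * phi^`()%classic t).
  by apply: eq_Rintegral => t _; rewrite mulrDl.
rewrite RintegralD// primitive_by_parts//.
have i1 : tau.-integrable setT (EFin \o (phi^`()%classic : RT -> R)).
  exact: (bounded_integrable tauoo mdphi Cdphi).
rewrite RintegralZl//.
have [_ [a [b [a0 _ bT phi0]]]] := tphi.
have := time_FTC (lexx 0) T0 dphi cdphi.
rewrite (phi0 T) ?(phi0 0) ?subrr; [|by left|by right].
rewrite (@ae_eq_Rintegral _ _ _ tau _ (phi^`()%classic)) => [->||//|].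
- by rewrite mulr0 add0r.
- by apply: measurable_funM => //; exact: measurable_ltb.
- by apply: ae_imply (time_measure_supp T) => t /andP[t0 _]; rewrite t0 mul1r.
Qed.

End absolutely_continuous.

(** * The concrete problem *)

Section cube_kernel.
Context {R : realType} (d : nat) (K : d.-tuple R -> d.-tuple R -> R) (M : R).
Local Notation X := (d.-tuple R).
Local Notation mu := (@cube_measure R d).
Hypothesis K1 : H1 d K.
Hypothesis K2 : H2 d K.
Hypothesis K3 : forall x, Omega d x -> (\int[@lebn R d]_(y in Omega d) (K x y)%:E <= M%:E)%E.

(** Extension by zero, so that nonnegativity, symmetry and the bound on the [K]-mass hold at all
    points of the ambient space. *)
Definition cube_kernel (x y : X) : R :=
  ((fun p : X * X => K p.1 p.2) \_ (Omega d `*` Omega d)) (x, y).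

Lemma cube_kernelE x y : Omega d x -> Omega d y -> cube_kernel x y = K x y.
Proof. by move=> Ox Oy; rewrite /cube_kernel patchE mem_set. Qed.

Lemma cube_kernel_out x y : ~ (Omega d x /\ Omega d y) -> cube_kernel x y = 0.
Proof. by move=> nO; rewrite /cube_kernel patchE memNset. Qed.

Lemma measurable_patch_pair (a : X * X -> R) :
  measurable_fun (Omega d `*` Omega d) a ->
  measurable_fun setT (fun z : X * X => (a \_ (Omega d `*` Omega d)) (z.1, z.2)).
Proof.
move=> ma; have -> : (fun z : X * X => (a \_ (Omega d `*` Omega d)) (z.1, z.2)) =
    a \_ (Omega d `*` Omega d) by apply/funext => -[].
have mOO : measurable (Omega d `*` Omega d : set (X * X)).
  by apply: measurableX; exact: measurable_Omega.
exact/(measurable_restrictT _ mOO).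
Qed.

Lemma measurable_cube_kernel : measurable_fun setT (fun z : X * X => cube_kernel z.1 z.2).
Proof. by apply: measurable_patch_pair; case: K1. Qed.

Lemma cube_kernel_ge0 x y : 0 <= cube_kernel x y.
Proof.
have [[Ox Oy]|nO] := pselect (Omega d x /\ Omega d y).
  by rewrite cube_kernelE//; case: K1 => + _; exact.
by rewrite cube_kernel_out.
Qed.

Lemma cube_kernel_sym x y : cube_kernel x y = cube_kernel y x.
Proof.
have [[Ox Oy]|nO] := pselect (Omega d x /\ Omega d y); first by rewrite !cube_kernelE// K2.
by rewrite !cube_kernel_out// => -[? ?]; apply: nO.
Qed.

Lemma integral_cube_kernel x (a : X -> R) : Omega d x ->
  (\int[mu]_y (cube_kernel x y * a y)%:E =
   \int[@lebn R d]_(y in Omega d) (K x y * a y)%:E)%E.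
Proof.
move=> Ox; rewrite -(integral_mrestr_patch (@lebn R d) (@measurable_Omega R d)).
apply: eq_integral => y _; rewrite patchE; case: ifPn; rewrite ?inE ?notin_setE => Oy.
  by rewrite cube_kernelE.
by rewrite cube_kernel_out ?mul0r// => -[].
Qed.

(** The absolute value makes the bound immediate outside the cube too, where the integral is 0. *)
Lemma cube_kernel_le x : (\int[mu]_y (cube_kernel x y)%:E <= `|M|%:E)%E.
Proof.
have [Ox|nO] := pselect (Omega d x).
  have -> : (\int[mu]_y (cube_kernel x y)%:E = \int[mu]_y (cube_kernel x y * cst 1 y)%:E)%E.
    by apply: eq_integral => y _; rewrite mulr1.
  rewrite integral_cube_kernel//; under eq_integral do rewrite mulr1.
  by apply: le_trans (K3 Ox) _; rewrite lee_fin ler_norm.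
rewrite (_ : (\int[mu]_y _ = 0)%E) ?lee_fin//.
by apply: integral0_eq => y _; rewrite cube_kernel_out// => -[].
Qed.

(** The field of [Delta1] is controlled only on the cube and up to null sets. It is extended by zero
    and set to 0 where it exceeds 1 in absolute value, which changes neither the relations nor, for
    almost every [x], the integral. *)
Lemma Delta1_cube (u eta : X -> R) : Delta1 d K u eta ->
  exists w : X -> X -> R,
    [/\ measurable_fun setT (fun z : X * X => w z.1 z.2),
        forall x y, `|w x y| <= 1,
        {ae (mu \x mu)%E, forall z, w z.1 z.2 = - w z.2 z.1},
        {ae (mu \x mu)%E, forall z, subdiff_abs (u z.2 - u z.1) (w z.1 z.2)} &
        {ae mu, forall x, eta x = - \int[mu]_y (cube_kernel x y * w x y)}].
Proof.
move=> [_ [_ [w0 [mw0 /cube_prod_aeP w01 /cube_prod_aeP wanti /cube_prod_aeP wsub /cube_aeP etaE]]]].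
pose wz x y := ((fun p : X * X => w0 p.1 p.2) \_ (Omega d `*` Omega d)) (x, y).
have mwz : measurable_fun setT (fun z : X * X => wz z.1 z.2) by exact: measurable_patch_pair.
pose w x y := if `|wz x y| <= 1 then wz x y else 0.
have wzE x y : Omega d x -> Omega d y -> wz x y = w0 x y.
  by move=> Ox Oy; rewrite /wz patchE mem_set.
have Oae : {ae (mu \x mu)%E, forall z, Omega d z.1 /\ Omega d z.2}.
  by apply/cube_prod_aeP; exact: aeW.
have wE x y : Omega d x -> Omega d y -> `|w0 x y| <= 1 -> w x y = w0 x y.
  by move=> Ox Oy w1; rewrite /w wzE// w1.
have {}w01 : {ae (mu \x mu)%E, forall z, [/\ Omega d z.1, Omega d z.2 & `|w0 z.1 z.2| <= 1]}.
  by apply: ae_imply2 w01 Oae => z ? [].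
have mw : measurable_fun setT (fun z : X * X => w z.1 z.2).
  apply: measurable_fun_ifT => //.
  by apply: measurable_fun_ler => //; exact: measurableT_comp.
exists w; split => //.
- by move=> x y; rewrite /w; case: ifPn => // _; rewrite normr0.
- apply: ae_imply2 wanti w01 => z za [zO1 zO2 z1].
  (* The bound at the mirrored point [(y, x)] is deduced from the one at [(x, y)] by
     antisymmetry. *)
  rewrite !wE//; by rewrite -[w0 z.2 z.1]opprK -za normrN.
- by apply: ae_imply2 wsub w01 => z zs [zO1 zO2 z1]; rewrite wE.
- have w01x := ae_prod_xsection (P := fun x y => [/\ Omega d x, Omega d y & `|w0 x y| <= 1]) w01.
  have Ox : {ae mu, forall x, Omega d x} by exact: mrestr_supp.
  apply: ae_imply2 (ae_imply2 (fun x a b => conj a b) etaE w01x) Ox => x [-> w01y] {}Ox.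
  congr (- _); rewrite -integral_cube_kernel//.
  have -> : fine (\int[mu]_y (cube_kernel x y * w0 x y)%:E)%E =
      \int[mu]_y (cube_kernel x y * wz x y).
    apply: eq_Rintegral => y _.
    have [Oy|nO] := pselect (Omega d y); first by rewrite wzE.
    by rewrite cube_kernel_out ?mul0r// => -[].
  have mKx : measurable_fun setT (cube_kernel x).
    exact: (measurableT_comp measurable_cube_kernel (pair1_measurable x)).
  apply: ae_eq_Rintegral.
  + apply: measurable_funM => //.
    exact: (measurableT_comp mwz (pair1_measurable x)).
  + apply: measurable_funM => //.
    exact: (measurableT_comp mw (pair1_measurable x)).
  + by apply: ae_imply w01y => y [_ Oy y1]; rewrite wE// wzE.
Qed.

Lemma cube_Delta1 (u eta : X -> R) (w : X -> X -> R) :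
  mu.-integrable setT (EFin \o u) -> mu.-integrable setT (EFin \o eta) ->
  measurable_fun setT (fun z : X * X => w z.1 z.2) ->
  (forall x y, `|w x y| <= 1) ->
  {ae (mu \x mu)%E, forall z, w z.1 z.2 = - w z.2 z.1} ->
  {ae (mu \x mu)%E, forall z, subdiff_abs (u z.2 - u z.1) (w z.1 z.2)} ->
  (forall x, eta x = - \int[mu]_y (cube_kernel x y * w x y)) ->
  Delta1 d K u eta.
Proof.
move=> iu ieta mw w1 wanti wsub etaE.
split; first exact: cube_integrableT.
split; first exact: cube_integrableT.
exists w; split.
- exact: measurable_funTS.
- by apply: aeW => p _; exact: w1.
- exact/cube_prod_aeP.
- exact/cube_prod_aeP.
- by apply: aeW => x Ox; rewrite etaE -integral_cube_kernel.
Qed.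

End cube_kernel.

Section cylinder_extension.
Context {R : realType} (d : nat) (T : R) (T0 : 0 < T).
Local Notation RT := (measurableTypeR R).
Local Notation X := (d.-tuple R).
Local Notation mu := (@cube_measure R d).
Local Notation tau := (time_measure T).
Implicit Types u v : X -> R -> R.

(** Two extensions by zero of the same function: [cyl] fits integrals over the open cylinder and
    loses the endpoints in time, while [slice] keeps each time, endpoints included, as needed for
    continuity and the initial condition. They agree on []0, T[]. *)
Definition cyl u (x : X) (t : R) : R := ((fun p : X * RT => u p.1 p.2) \_ (QT d T)) (x, t).
Definition slice u (x : X) (t : R) : R := ((fun x => u x t) \_ (Omega d)) x.

Lemma cylE u x t : 0 < t < T -> cyl u x t = slice u x t.
Proof.
move=> tT; rewrite /cyl /slice !patchE.
have [Ox|nO] := pselect (Omega d x).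
  by rewrite !mem_set//; split => //=; rewrite /I0T /= in_itv.
by rewrite !memNset// => -[].
Qed.

Lemma cyl_out u x t : ~ (0 < t < T) -> cyl u x t = 0.
Proof.
by move=> nt; rewrite /cyl patchE memNset// => -[_] /=; rewrite /I0T /= in_itv.
Qed.

Lemma sliceE u x t : Omega d x -> slice u x t = u x t.
Proof. by move=> Ox; rewrite /slice patchE mem_set. Qed.

Lemma integrable_cyl u :
  (mOT d).-integrable (QT d T) (fun p => (u p.1 p.2)%:E) <->
  (mu \x tau)%E.-integrable setT (fun z : X * RT => (cyl u z.1 z.2)%:E).
Proof.
rewrite (_ : (fun z : X * RT => (cyl u z.1 z.2)%:E) =
    EFin \o ((fun p : X * RT => u p.1 p.2) \_ (QT d T))).
  exact: cylinder_integrableP.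
by apply/funext => -[].
Qed.

Lemma integrable_cylT u :
  (mu \x tau)%E.-integrable setT (fun z : X * RT => (u z.1 z.2)%:E) ->
  (mOT d).-integrable (QT d T) (fun p => (u p.1 p.2)%:E).
Proof.
move=> iu; apply/cylinder_integrableP.
have mQ : measurable (QT d T : set (X * RT)).
  by apply: measurableX; [exact: measurable_Omega|exact: measurable_I0T].
apply: (le_integrable measurableT _ _ iu).
  apply/measurable_EFinP/(measurable_restrictT _ mQ).
  by apply: measurable_funTS; apply/measurable_EFinP; exact: measurable_int iu.
by move=> z _; rewrite /= lee_fin patchE; case: ifP => //; rewrite normr0.
Qed.

Lemma Rintegral_cyl u x (h : R -> R) : Omega d x ->
  \int[tau]_t (cyl u x t * h t) =
  fine (\int[@lebesgue_measure R]_(t in I0T T) (u x t * h t)%:E)%E.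
Proof.
move=> Ox; rewrite -(integral_mrestr_patch (@lebesgue_measure R) (measurable_I0T T)).
congr fine; apply: eq_integral => t _; rewrite patchE; case: ifPn;
  rewrite ?inE ?notin_setE /I0T /= in_itv /= => tT.
  by rewrite cylE// sliceE.
by rewrite cyl_out ?mul0r//; exact/negP.
Qed.

Lemma weak_time_deriv_cyl u v phi : weak_time_deriv d T u v -> test_fun T phi ->
  {ae mu, forall x,
    \int[tau]_t (cyl u x t * phi^`()%classic t) = - \int[tau]_t (cyl v x t * phi t)}.
Proof.
move=> [_ [_ H]] /H /cube_aeP uv.
have Ox : {ae mu, forall x, Omega d x} by exact: mrestr_supp.
by apply: ae_imply2 uv Ox => x uvx {}Ox; rewrite !Rintegral_cyl// uvx fineN.
Qed.

Lemma C_L1_slice u : C_L1 d T u ->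
  (forall t, 0 <= t <= T -> mu.-integrable setT (fun x => (slice u x t)%:E)) /\
  (forall t0, 0 <= t0 <= T -> forall e, 0 < e -> exists2 del, 0 < del &
    forall t, 0 <= t <= T -> `|t - t0| < del ->
    \int[mu]_x `|slice u x t0 - slice u x t| <= e).
Proof.
move=> [iu cu]; split=> [t tT|t0 t0T e e0].
  by apply/(cube_integrableP (fun x => u x t)); exact: iu.
have [_ /cvgrPdist_le/(_ e e0)] := (fine_cvgP _ _).1 (cu t0 t0T).
move=> /nbhs_ballP[del /= del0 ballP].
exists del => // t tT tdel.
have := ballP t _ tT; rewrite /ball /= distrC => /(_ tdel).
rewrite sub0r normrN /= => le_e.
apply: le_trans (le_trans (ler_norm _) le_e).
rewrite -(integral_mrestr_patch (@lebn R d) (@measurable_Omega R d)).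
rewrite le_eqVlt; apply/orP; left; apply/eqP; congr fine.
apply: eq_integral => x _; rewrite patchE /slice !patchE.
by case: ifP => _; rewrite ?subrr ?normr0// distrC.
Qed.

End cylinder_extension.

Lemma subdiff_abs_monotone (R : realType) (a b p q : R) :
  subdiff_abs a p -> subdiff_abs b q -> 0 <= (p - q) * (a - b).
Proof.
rewrite /subdiff_abs; case: (ltgtP 0 a) => [a0 ->|a0 ->|<- /= /andP[p1 p2]];
  case: (ltgtP 0 b) => [b0 ->|b0 ->|<- /= /andP[q1 q2]]; nra.
Qed.

Section problem.
Context {R : realType} (d : nat) (T : R) (T0 : 0 < T).
Variables (K : d.-tuple R -> d.-tuple R -> R) (M : R).
Local Notation RT := (measurableTypeR R).
Local Notation X := (d.-tuple R).
Local Notation mu := (@cube_measure R d).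
Local Notation tau := (time_measure T).
Hypothesis K1 : H1 d K.
Hypothesis K2 : H2 d K.
Hypothesis K3 : forall x, Omega d x -> (\int[@lebn R d]_(y in Omega d) (K x y)%:E <= M%:E)%E.
Variables (g : X -> R) (f : X -> R -> R).

Let mK := measurable_cube_kernel K1.
Let K0 := cube_kernel_ge0 K1.
Let Ksym := cube_kernel_sym K2.
Let KM := cube_kernel_le K3.

Lemma solution_unique u1 u2 : solution d K f g T u1 -> solution d K f g T u2 ->
  forall t, 0 <= t <= T -> {ae @lebn R d, forall x, Omega d x -> u1 x t = u2 x t}.
Proof.
move=> [/C_L1_slice[iu1 cu1] [v1 [eta1 [wtd1 ug1 ve1 Del1]]]].
have {}ug1 := (cube_aeP (fun x => u1 x 0 = g x)).2 ug1.
have {}ve1 := (cylinder_aeP T (fun p => v1 p.1 p.2 = - eta1 p.1 p.2 + f p.1 p.2)).2 ve1.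
have {}Del1 := (time_aeP T (fun t => Delta1 d K (fun x => u1 x t) (fun x => eta1 x t))).2 Del1.
move=> [/C_L1_slice[iu2 cu2] [v2 [eta2 [wtd2 ug2 ve2 Del2]]]].
have {}ug2 := (cube_aeP (fun x => u2 x 0 = g x)).2 ug2.
have {}ve2 := (cylinder_aeP T (fun p => v2 p.1 p.2 = - eta2 p.1 p.2 + f p.1 p.2)).2 ve2.
have {}Del2 := (time_aeP T (fun t => Delta1 d K (fun x => u2 x t) (fun x => eta2 x t))).2 Del2.
move=> t tT; apply/cube_aeP.
have iU1 := (integrable_cyl T u1).1 wtd1.1; have iU2 := (integrable_cyl T u2).1 wtd2.1.
have iV1 := (integrable_cyl T v1).1 wtd1.2.1; have iV2 := (integrable_cyl T v2).1 wtd2.2.1.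
have mV v : (mu \x tau)%E.-integrable setT (fun z : X * RT => (cyl T v z.1 z.2)%:E) ->
    measurable_fun setT (fun z : X * RT => cyl T v z.1 z.2).
  by move=> iv; apply/measurable_EFinP; exact: measurable_int iv.
have Ox : {ae mu, forall x, Omega d x} by exact: mrestr_supp.
pose D x t := slice u1 x t - slice u2 x t.
suff : {ae mu, forall x, D x t = 0}.
  move=> D0; apply: ae_imply2 D0 Ox => x + {}Ox.
  by rewrite /D !sliceE// => /eqP; rewrite subr_eq0 => /eqP.
(* The difference of slices carries continuity and the initial value; the difference of the cylinder
   extensions is its jointly measurable version. *)
apply: (@contraction_eq0 R _ X mu (cube_kernel K) `|M| mK K0 Ksym KM T T0 D
  (fun x t => cyl T u1 x t - cyl T u2 x t) (fun x t => cyl T v1 x t - cyl T v2 x t)) => //.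
- by move=> x s sT; rewrite /D !cylE.
- by apply: eq_integrable (integrableB measurableT iU1 iU2) => // z _.
- by move=> s sT; apply: eq_integrable (integrableB measurableT (iu1 s sT) (iu2 s sT)) => // x _.
- move=> t0 t0T e e0; have e20 : 0 < e / 2 by rewrite divr_gt0.
  have [d1 d10 Hd1] := cu1 t0 t0T _ e20; have [d2 d20 Hd2] := cu2 t0 t0T _ e20.
  exists (Num.min d1 d2); first by rewrite lt_min d10.
  move=> s sT; rewrite lt_min => /andP[sd1 sd2].
  have i1 : mu.-integrable setT (EFin \o (fun x => `|slice u1 x t0 - slice u1 x s|)).
    by apply: integrable_norm; exact: (integrableB measurableT (iu1 _ t0T) (iu1 _ sT)).
  have i2 : mu.-integrable setT (EFin \o (fun x => `|slice u2 x t0 - slice u2 x s|)).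
    by apply: integrable_norm; exact: (integrableB measurableT (iu2 _ t0T) (iu2 _ sT)).
  apply: (@le_trans _ _ (\int[mu]_x (`|slice u1 x t0 - slice u1 x s| +
      `|slice u2 x t0 - slice u2 x s|))); last first.
    by rewrite RintegralD// [leRHS](splitr e) lerD//; [exact: Hd1|exact: Hd2].
  have iD r : 0 <= r <= T -> mu.-integrable setT (EFin \o D ^~ r).
    move=> rT; exact: (integrableB measurableT (iu1 _ rT) (iu2 _ rT)).
  apply: le_Rintegral => //.
  + by apply: integrable_norm; exact: (integrableB measurableT (iD _ t0T) (iD _ sT)).
  + exact: (integrableD measurableT i1 i2).
  + move=> x _; rewrite /D.
    have swap (a b c p : R) : a - b - (c - p) = a - c - (b - p) by ring.
    by rewrite swap ler_normB.
- apply: ae_imply2 (ae_imply2 (fun x a b => conj a b) ug1 ug2) Ox => x [u1x u2x] {}Ox.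
  by rewrite /D !sliceE// u1x u2x subrr.
- by apply: measurable_funB; exact: mV.
- move=> phi tphi; have [C [Cphi Cdphi]] := test_fun_bounded tphi.
  have [dphi cdphi] := test_fun_derivable tphi.
  have mdphi : measurable_fun setT (phi^`()%classic : RT -> R).
    exact: continuous_measurable_fun.
  have mphi : measurable_fun setT (phi : RT -> R).
    by apply: continuous_measurable_fun => s; apply: differentiable_continuous;
      exact/derivable1_diffP.
  have ae_sec v : (mu \x tau)%E.-integrable setT (fun z : X * RT => (cyl T v z.1 z.2)%:E) ->
      {ae mu, forall x, tau.-integrable setT (EFin \o cyl T v x)}.
    exact: (ae_integrable_xsection (f := fun x (t : RT) => cyl T v x t)).
  have w1 := ae_imply2 (fun x a b => conj a b) (weak_time_deriv_cyl wtd1 tphi)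
    (ae_imply2 (fun x a b => conj a b) (ae_sec _ iU1) (ae_sec _ iV1)).
  have w2 := ae_imply2 (fun x a b => conj a b) (weak_time_deriv_cyl wtd2 tphi)
    (ae_imply2 (fun x a b => conj a b) (ae_sec _ iU2) (ae_sec _ iV2)).
  apply: ae_imply2 w1 w2 => x [e1 [iu1x iv1x]] [e2 [iu2x iv2x]].
  under eq_Rintegral do rewrite mulrBl.
  under [in RHS]eq_Rintegral do rewrite mulrBl.
  rewrite !RintegralB//.
  + by rewrite e1 e2 opprB opprK addrC.
  + exact: (integrable_test iv1x mphi Cphi).
  + exact: (integrable_test iv2x mphi Cphi).
  + exact: (integrable_test iu1x mdphi Cdphi).
  + exact: (integrable_test iu2x mdphi Cdphi).
- have ve1s := ae_prod_ysection (P := fun x (s : RT) => v1 x s = - eta1 x s + f x s) ve1.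
  have ve2s := ae_prod_ysection (P := fun x (s : RT) => v2 x s = - eta2 x s + f x s) ve2.
  apply: ae_imply2 (ae_imply2 (fun x a b => conj a b) Del1 Del2)
    (ae_imply2 (fun x a b => conj a b) (time_measure_supp T)
      (ae_imply2 (fun x a b => conj a b) ve1s ve2s)).
  move=> s [/(Delta1_cube K1) [w1 [mw1 w11 w1a w1s e1]]
    /(Delta1_cube K1) [w2 [mw2 w21 w2a w2s e2]]] [sT [{}ve1s {}ve2s]].
  have OO : {ae (mu \x mu)%E, forall z, Omega d z.1 /\ Omega d z.2}.
    by apply/cube_prod_aeP; exact: aeW.
  exists (fun x y => w1 x y - w2 x y); split.
  + exact: measurable_funB.
  + by move=> x y; rewrite (le_trans (ler_normB _ _))//; have := w11 x y; have := w21 x y; lra.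
  + by apply: ae_imply2 w1a w2a => z -> ->; rewrite opprB opprK addrC.
  + apply: ae_imply2 (ae_imply2 (fun x a b => conj a b) w1s w2s) OO => z [z1 z2] [zO1 zO2].
    have := subdiff_abs_monotone z1 z2; rewrite /D !sliceE//.
    have swap (a b c p : R) : a - b - (c - p) = a - c - (b - p) by ring.
    by rewrite swap.
  + have iKw x (w : X -> X -> R) : measurable_fun setT (fun z : X * X => w z.1 z.2) ->
        (forall x y, `|w x y| <= 1) ->
        mu.-integrable setT (EFin \o (fun y => cube_kernel K x y * w x y)).
      move=> mw w_1; have mwx : measurable_fun setT (w x).
        exact: (measurableT_comp mw (pair1_measurable x)).
      exact: (@integrable_kernelM _ _ _ mu (cube_kernel K) `|M| mK K0 KM x (w x) 1 mwx (w_1 x)).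
    apply: ae_imply2 (ae_imply2 (fun x a b => conj a b) e1 e2)
      (ae_imply2 (fun x a b => conj a b) Ox
        (ae_imply2 (fun x a b => conj a b) ve1s ve2s)) => x [e1x e2x] [{}Ox [v1x v2x]].
    rewrite !cylE// !sliceE// v1x v2x e1x e2x !opprK.
    under [in RHS]eq_Rintegral do rewrite mulrBr.
    rewrite RintegralB//; [|exact: iKw|exact: iKw].
    have cancel (a b c : R) : a + c - (b + c) = a - b by ring.
    exact: cancel.
Qed.

Hypothesis ig : (@lebn R d).-integrable (Omega d) (fun x => (g x)%:E).
Hypothesis intf : (mOT d).-integrable (QT d T) (fun p => (f p.1 p.2)%:E).

Lemma exists_solution : exists u, solution d K f g T u.
Proof.
pose g' := g \_ (Omega d).
have ig' : mu.-integrable setT (EFin \o g') by exact/cube_integrableP.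
have mg' : measurable_fun setT g' by apply/measurable_EFinP; exact: measurable_int ig'.
have [f' [if' ifx' f'E]] := integrable_prod_sections ((integrable_cyl T f).1 intf).
have [w [mw w1 wa ws]] := exists_evolution mK K0 Ksym KM T0 (@time_measure_set1 _ T)
  (@time_measure_itv _ T) (time_measure_supp T) mg' if' ifx'.
pose dr := drift mu (cube_kernel K) w.
pose q x (t : R) := f' x t + dr x t.
have mdr : measurable_fun setT (fun z : X * RT => dr z.1 z.2) by exact: measurable_drift.
have drM x s : `|dr x s| <= 1 * `|M| by exact: (le_norm_drift mK K0 KM mw w1).
have idr : (mu \x tau)%E.-integrable setT (fun z : X * RT => (dr z.1 z.2)%:E).
  apply: (bounded_integrable (c := 1 * `|M|) _ mdr) => //.
  by apply: product_measure_lty; exact: finite_measure_lty.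
have tauoo : (tau setT < +oo)%E by exact: finite_measure_lty.
have idrx x : tau.-integrable setT (EFin \o dr x).
  by apply: (bounded_integrable (c := 1 * `|M|) tauoo) => //;
    exact: (measurableT_comp mdr (pair1_measurable x)).
have iq : (mu \x tau)%E.-integrable setT (fun z : X * RT => (q z.1 z.2)%:E).
  by apply: eq_integrable (integrableD measurableT if' idr) => // z _.
have iqx x : tau.-integrable setT (EFin \o q x).
  exact: (integrableD measurableT (ifx' x) (idrx x)).
(* The same function is seen in two ways: as [evolve] it has the regularity in time, as [sol] it
   satisfies the subdifferential relation. [uE] identifies the two at every point. *)
pose u := evolve T g' q.
have uE x t : u x t = sol mu (cube_kernel K) tau g' f' w x t.
  rewrite /u /evolve /sol /disp -addrA; congr (_ + _).
  rewrite /primitive -RintegralD//; [|exact: integrable_primitive (ifx' x)|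
    exact: integrable_primitive (idrx x)].
  by apply: eq_Rintegral => s _; rewrite mulrDl.
have iut t : mu.-integrable setT (EFin \o (fun x => u x t)).
  exact: integrable_evolve_fst.
have integral_time (h : R -> R) : tau.-integrable setT (EFin \o h) ->
    (\int[@lebesgue_measure R]_(t in I0T T) (h t)%:E = (\int[tau]_t h t)%:E)%E.
  move=> ih; rewrite fineK; last exact: (integrable_fin_num _ ih).
  by rewrite (integral_mrestr (@lebesgue_measure R) (measurable_I0T T))//; exact: measurable_int ih.
have integral_cube (h : X -> R) : mu.-integrable setT (EFin \o h) ->
    (\int[@lebn R d]_(x in Omega d) (h x)%:E = (\int[mu]_x h x)%:E)%E.
  move=> ih; rewrite fineK; last exact: (integrable_fin_num _ ih).
  by rewrite (integral_mrestr (@lebn R d) (@measurable_Omega R d))//; exact: measurable_int ih.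
(* The weak derivative is the integrand [q], and [eta] is minus the drift, so that [- eta + f] gives
   back [q] wherever [f'] equals [f]. *)
exists u; split; [split|exists q, (fun x t => - dr x t); split].
- by move=> t _; exact: cube_integrableT (iut t).
- move=> t0 t0T.
  have iB t : mu.-integrable setT (EFin \o (fun x => `|u x t - u x t0|)).
    by apply: integrable_norm; exact: (integrableB measurableT (iut t) (iut t0)).
  rewrite (_ : (fun t => _) = EFin \o (fun t => \int[mu]_x `|u x t - u x t0|)); last first.
    by apply/funext => t; exact: integral_cube (iB t).
  apply: cvg_EFin; first exact: nearW.
  apply: cvg_within_filter; apply/cvgrPdist_le => e e0.
  have [del del0 Hdel] := evolve_L1_continuous ig' iq iqx t0 e0.
  near=> t; rewrite sub0r normrN ger0_norm; last by apply: Rintegral_ge0 => x _; exact: normr_ge0.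
  change (\int[mu]_x `|u x t - u x t0| <= e); under eq_Rintegral do rewrite distrC.
  apply: Hdel; rewrite distrC; near: t; exact: (nbhsx_ballx t0 del del0).
- split; first by apply: integrable_cylT; exact: integrable_evolve.
  split; first exact: integrable_cylT.
  move=> phi tphi; apply: aeW => x _.
  have [C [Cphi Cdphi]] := test_fun_bounded tphi.
  have [dphi cdphi] := test_fun_derivable tphi.
  have mdphi : measurable_fun setT (phi^`()%classic : RT -> R).
    exact: continuous_measurable_fun.
  have mphi : measurable_fun setT (phi : RT -> R).
    by apply: continuous_measurable_fun => s; apply: differentiable_continuous;
      exact/derivable1_diffP.
  rewrite (integral_time (fun t => u x t * phi^`()%classic t)); last first.
    exact: (integrable_test (integrable_evolve_snd ig' iq iqx x) mdphi Cdphi).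
  rewrite (integral_time (fun t => q x t * phi t)); last exact: (integrable_test (iqx x) mphi Cphi).
  by rewrite (evolve_by_parts g' iq iqx x T0 tphi) EFinN.
- apply: aeW => x Ox; rewrite /u /evolve /g' patchE mem_set//.
  rewrite (primitive_le0 (time_measure_supp T)) ?addr0//.
  by apply/measurable_EFinP; exact: measurable_int (iqx x).
- apply: (cylinder_aeP T (fun p => q p.1 p.2 = - - dr p.1 p.2 + f p.1 p.2)).1.
  have QTae : {ae (mu \x tau)%E, forall z : X * RT, QT d T z}.
    by apply: (cylinder_aeP T (QT d T)).2; exact: aeW.
  apply: ae_imply2 f'E QTae => z; rewrite /q opprK addrC => ->.
  by rewrite /cyl -surjective_pairing patchE => Qz; rewrite mem_set.
- apply: (time_aeP T (fun s => Delta1 d K (fun x => u x s) (fun x => - dr x s))).1.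
  apply: ae_imply2 wa ws => s was wss.
  apply: (cube_Delta1 (w := fun x y => w x y s)) => //.
  + apply: (bounded_integrable (c := 1 * `|M|)); first exact: finite_measure_lty.
      apply: measurable_funN; exact: (measurableT_comp mdr (pair2_measurable (s : RT))).
    by move=> x; rewrite normrN.
  + exact: measurable3_pair.
  + by apply: ae_imply wss => z; rewrite !uE.
Unshelve. all: by end_near. Qed.

End problem.

Unset Implicit Arguments.

Theorem theorem4p8 (R : realType) (d : nat) (T : R)
    (K : d.-tuple R -> d.-tuple R -> R)
    (g : d.-tuple R -> R) (f : d.-tuple R -> R -> R) :
  (1 <= d)%N -> 0 < T ->
  H1 d K -> H2 d K -> H3 d K ->
  (lebn d).-integrable (Omega d) (fun x => (g x)%:E) ->
  (mOT d).-integrable (QT d T) (fun p => (f p.1 p.2)%:E) ->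
  (exists u, solution d K f g T u) /\
  (forall u1 u2, solution d K f g T u1 -> solution d K f g T u2 ->
     forall t, 0 <= t <= T ->
       {ae lebn d, forall x, Omega d x -> u1 x t = u2 x t}).
Proof.
move=> _ T0 K1 K2 [M K3] ig intf; split.
  exact: (exists_solution T0 K1 K2 K3 ig intf).
exact: (solution_unique T0 K1 K2 K3).
Qed.
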